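(* Let $N\ge2$ be an integer, let $\theta\in\mathbb R\setminus\mathbb Q$, let $r_0(0),r_1(0)$ be positive integers, let $l_{j,k}(n)$ be positive integers for $n\in\{0,1,2,\ldots\}$ and $j,k\in\{0,1\}$, and let $A$ and $\alpha\colon S^1\to\operatorname{Aut}(A)$ be the algebra and action obtained from these parameters by the construction described in the context. Assume that $r_0(0)\le r_1(0)$ and that for all $n\in\{0,1,2,\ldots\}$ we have $$l_{1,0}(n)\ge l_{0,0}(n),\quad l_{0,1}(n)\ge l_{0,0}(n),\quad l_{1,1}(n)\ge l_{0,1}(n),\quad l_{1,1}(n)\ge l_{1,0}(n).$$ Further assume that $$\lim_{n\to\infty}\frac{l_{0,1}(n)}{l_{0,0}(n)}=\infty\quad\text{and}\quad\lim_{n\to\infty}\frac{l_{1,1}(n)}{l_{1,0}(n)}=\infty.$$ Then $\alpha$ has the tracial Rokhlin property with comparison and has the modified tracial Rokhlin property. Moreover, given finite sets $F\subseteq A$, $F_0\subseteq A^\alpha$, and $S\subseteq C(S^1)$, as well as $\varepsilon>0$, $x\in A_+$ with $\|x\|=1$, and $y\in(A^\alpha)_+\setminus\{0\}$, it is possible to choose a projection $p\in A^\alpha$, a unital completely positive contractive map $\varphi\colon C(S^1)\to pAp$, and a partial isometry $s\in A^\alpha$, such that the conditions in the definition of the tracial Rokhlin property with comparison (for $F,S,\varepsilon,x,y$) and the conditions in the definition of the modified tracial Rokhlin property (for $F_1=F$, $F_2=F_0$, $S$, $\varepsilon$, $x$) are simultaneously satisfied.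
   Context: Construction. The parameters are an integer $N\ge2$, $\theta\in\mathbb R\setminus\mathbb Q$, positive integers $r_0(0),r_1(0)$, and positive integers $l_{j,k}(n)$ for $n\in\{0,1,2,\ldots\}$ and $j,k\in\{0,1\}$. For C*-algebras $D,E$, a homomorphism $\psi\colon D\to E$, and $k,n\ge1$, let $\psi^{(k)}\colon D\to M_k\otimes E$ be $a\mapsto1_{M_k}\otimes\psi(a)$ and $\psi_n^{(k)}=\mathrm{id}_{M_n}\otimes\psi^{(k)}\colon M_n\otimes D\to M_{kn}\otimes E$. (a) $\beta\colon S^1\to\operatorname{Aut}(C(S^1))$ is $\beta_\zeta(f)(z)=f(\zeta^{-1}z)$; for $n\ge1$, $\beta_{\zeta,n}=\mathrm{id}_{M_n}\otimes\beta_\zeta$ on $M_n(C(S^1))=C(S^1,M_n)$. For $\lambda\in\mathbb R$, $\tilde\beta_\lambda=\beta_{\exp(2\pi i\lambda)}$. (b) $\omega=\exp(2\pi i/N)$, and $s\in M_N$ is the permutation unitary with entries $s_{j,j+1}=1$ for $1\le j\le N-1$, $s_{N,1}=1$, all others $0$. (c) $R=\{f\in C(S^1,M_N):f(\omega z)=sf(z)s^*\text{ for all }z\in S^1\}$, which is invariant under $\zeta\mapsto\beta_{\zeta,N}$; $\gamma$ is the restriction of this action to $R$, and $\gamma_{\zeta,n}=\mathrm{id}_{M_n}\otimes\gamma_\zeta$ on $M_n(R)$. (d) $\iota\colon R\to C(S^1,M_N)$ is the inclusion, and $\xi\colon C(S^1)\to R$ is $\xi(f)(z)=\operatorname{diag}(f(z),f(\omega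 z),\ldots,f(\omega^{N-1}z))$. (e) For $n\ge0$: $r_0(n+1)=l_{0,0}(n)r_0(n)+l_{0,1}(n)r_1(n)$ and $r_1(n+1)=Nl_{1,0}(n)r_0(n)+2Nl_{1,1}(n)r_1(n)$. (f) $A_{n,0}=M_{r_0(n)}(R)$, $A_{n,1}=M_{r_1(n)}(C(S^1))$, $A_n=A_{n,0}\oplus A_{n,1}$, with action $\alpha^{(n)}_\zeta=\gamma_{\zeta,r_0(n)}\oplus\beta_{\zeta,r_1(n)}$ of $S^1$ on $A_n$. (g) $\nu_{n,0,0}=(\mathrm{id}_R)^{(l_{0,0}(n))}_{r_0(n)}\colon A_{n,0}\to M_{l_{0,0}(n)r_0(n)}(R)$; $\nu_{n,0,1}=\xi^{(l_{0,1}(n))}_{r_1(n)}\colon A_{n,1}\to M_{l_{0,1}(n)r_1(n)}(R)$; $\nu_{n,1,0}=\iota^{(l_{1,0}(n))}_{r_0(n)}\colon A_{n,0}\to M_{Nl_{1,0}(n)r_0(n)}(C(S^1))$; and $\nu_{n,1,1}\colon A_{n,1}\to M_{2Nl_{1,1}(n)r_1(n)}(C(S^1))$ is the block diagonal sum of the $2N$ homomorphisms $(\tilde\beta_{j/N})^{(l_{1,1}(n))}_{r_1(n)}$ and $(\tilde\beta_{\theta+j/N})^{(l_{1,1}(n))}_{r_1(n)}$ for $j=0,1,\ldots,N-1$. (h) $\nu_n\colon A_n\to A_{n+1}$ is $\nu_n(a_0,a_1)=\bigl(\operatorname{diag}(\nu_{n,0,0}(a_0),\nu_{n,0,1}(a_1)),\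 \operatorname{diag}(\nu_{n,1,0}(a_0),\nu_{n,1,1}(a_1))\bigr)$; these maps are equivariant. (i) $A=\varinjlim_nA_n$ with connecting maps $\nu_n$, and $\alpha\colon S^1\to\operatorname{Aut}(A)$ is the direct limit action $\varinjlim\alpha^{(n)}$. (The algebra $A$ is simple, unital, separable and infinite dimensional.) Notation. Actions are pointwise norm continuous; $A^\alpha$ is the fixed point algebra. For $a,b\in M_\infty(A)_+$ with $M_\infty(A)=\bigcup_nM_n(A)$, $a\precsim_Ab$ means there is a sequence $(v_n)$ in $M_\infty(A)$ with $v_nbv_n^*\to a$. For a compact group $G$, $\mathrm{Lt}_g(f)(h)=f(g^{-1}h)$ for $f\in C(G)$. Let $\alpha$ be an action of a second countable compact group $G$ on an infinite dimensional simple separable unital C*-algebra $A$. For finite $F\subseteq A$, $S\subseteq C(G)$ and $\varepsilon>0$, a unital completely positive map $\varphi\colon C(G)\to pAp$ (so $\varphi(1)=p$), with $p\in A^\alpha$ a projection, is called $(F,S,\varepsilon)$-approximately equivariant central multiplicative if $\|\varphi(f_1f_2)-\varphi(f_1)\varphi(f_2)\|<\varepsilon$ for $f_1,f_2\in S$, $\|\varphi(f)a-a\varphi(f)\|<\varepsilon$ for $f\in S,a\in F$, and $\sup_{g\in G}\|\varphi(\mathrm{Lt}_g(f))-\alpha_g(\varphi(f))\|<\varepsilon$ for $f\in S$. Definition (tracial Rokhlin property with comparison). For every finite $F\subseteq A$, finite $S\subseteq C(G)$, $\varepsilon>0$, $x\in A_+$ with $\|x\|=1$, and $y\in(A^\alpha)_+\setminus\{0\}$,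 there exist a projection $p\in A^\alpha$ and a unital completely positive $\varphi\colon C(G)\to pAp$ such that (1) $\varphi$ is $(F,S,\varepsilon)$-approximately equivariant central multiplicative; (2) $1-p\precsim_Ax$; (3) $1-p\precsim_{A^\alpha}y$; (4) $1-p\precsim_{A^\alpha}p$; (5) $\|pxp\|>1-\varepsilon$. Definition (modified tracial Rokhlin property). For every finite $F_1\subseteq A$, finite $F_2\subseteq A^\alpha$, finite $S\subseteq C(G)$, $\varepsilon>0$, and $x\in A_+$ with $\|x\|=1$, there exist a projection $p\in A^\alpha$, a partial isometry $s\in A^\alpha$, and a unital completely positive contractive map $\varphi\colon C(G)\to pAp$ such that (1) $\varphi$ is $(F_1,S,\varepsilon)$-approximately equivariant central multiplicative; (2) $1-p\precsim_Ax$; (3) $s^*s=1-p$ and $ss^*\le p$; (4) $\|sa-as\|<\varepsilon$ for all $a\in F_2$; (5) $\|pxp\|>1-\varepsilon$. *)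

(* Defs.v *)
From HB Require Import structures.
From mathcomp Require Import all_boot all_order all_algebra.
From mathcomp Require Import all_classical all_reals all_analysis.
From mathcomp Require Import complex mxtens.

Set Implicit Arguments.
Unset Strict Implicit.
Unset Printing Implicit Defensive.

Import Order.TTheory GRing.Theory Num.Theory.
Import numFieldNormedType.Exports.

Local Open Scope classical_set_scope.
Local Open Scope ring_scope.
Local Open Scope complex_scope.

Local Notation normc := ComplexField.Normc.normc.

(* Unital algebras over [R[i]]. The scalar multiplication is an operation of its
   own, because ['M[D]_n] is canonically a module over [D] and because the
   library has no join of [pzRingType] and [lmodType]. For the same reason the
   norm of a C*-algebra is not that of [completeNormedModType], which has no
   join with ring types. *)
HB.mixin Record isStarAlgebra (R : realType) A of GRing.PzRing A := {
  star : A -> A;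
  cscale : R[i] -> A -> A;
  starD : {morph star : x y / x + y};
  starM : forall x y : A, star (x * y) = star y * star x;
  starK : involutive star;
  starZ : forall c x, star (cscale c x) = cscale c^* (star x);
  cscaleDr : forall c, {morph cscale c : x y / x + y};
  cscaleDl : forall b c x, cscale (b + c) x = cscale b x + cscale c x;
  cscaleA : forall b c x, cscale b (cscale c x) = cscale (b * c) x;
  cscale1 : forall x, cscale 1 x = x;
  cscaleAl : forall c (x y : A), cscale c (x * y) = cscale c x * y;
  cscaleAr : forall c (x y : A), cscale c (x * y) = x * cscale c y
}.

#[short(type="starAlgType")]
HB.structure Definition StarAlgebra (R : realType) :=
  {A of isStarAlgebra R A & GRing.PzRing A}.

HB.mixin Record isCstarAlgebra (R : realType) A of StarAlgebra R A := {
  cnorm : A -> R;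
  cnorm0_eq0 : forall x, cnorm x = 0 -> x = 0;
  cnormZ : forall c x, cnorm (cscale c x) = normc c * cnorm x;
  ler_cnormD : forall x y, cnorm (x + y) <= cnorm x + cnorm y;
  ler_cnormM : forall x y, cnorm (x * y) <= cnorm x * cnorm y;
  cnorm_star : forall x, cnorm (star x * x) = cnorm x ^+ 2;
  cnorm_complete : forall u : nat -> A,
    (forall e : R, 0 < e -> exists n0, forall m n,
       (n0 <= m)%N -> (n0 <= n)%N -> cnorm (u m - u n) < e) ->
    exists a, cnorm (u n - a) @[n --> \oo] --> (0 : R)
}.

#[short(type="cstarAlgType")]
HB.structure Definition CstarAlgebra (R : realType) :=
  {A of isCstarAlgebra R A & StarAlgebra R A}.

Section StarAlgebraTheory.
Variables (R : realType).

Definition clinear (D E : starAlgType R) (f : D -> E) : Prop :=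
  {morph f : x y / x + y} /\ (forall c x, f (cscale c x) = cscale c (f x)).

Definition star_hom (D E : starAlgType R) (f : D -> E) : Prop :=
  [/\ clinear f, f 1 = 1, {morph f : x y / x * y} &
      forall x, f (star x) = star (f x)].

Definition adjmx (T : Type) (st : T -> T) m n (a : 'M[T]_(m, n)) : 'M[T]_(n, m) :=
  map_mx st a^T.

(* The norm of [a] as an operator on the Hilbert module of columns over a
   C*-algebra with ring [D], involution [st] and norm [nrm]: it is the C*-norm
   of the matrix algebra, and the usual operator norm when [D] is [R[i]]. *)
Definition op_norm (D : pzRingType) (st : D -> D) (nrm : D -> R) n
    (a : 'M[D]_n) : R :=
  let colnorm (x : 'cV[D]_n) := Num.sqrt (nrm ((adjmx st x *m x) 0 0)) in
  sup [set colnorm (a *m x) | x in [set x | colnorm x <= 1]].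

Section MatrixStarAlgebra.
Variables (D : starAlgType R) (n : nat).
Implicit Types a : 'M[D]_n.

Let mxstar a : 'M[D]_n := adjmx star a.
Let mxcscale (c : R[i]) a : 'M[D]_n := map_mx (cscale c) a.

Let cscale_sum (c : R[i]) (F : 'I_n -> D) :
  cscale c (\sum_i F i) = \sum_i cscale c (F i).
Proof.
have c0 : cscale c (0 : D) = 0.
  by apply: (addrI (cscale c 0)); rewrite -cscaleDr !addr0.
exact: (big_morph (cscale c) (@cscaleDr _ _ c) c0).
Qed.

Let star_sum (F : 'I_n -> D) : star (\sum_i F i) = \sum_i star (F i).
Proof.
have s0 : star (0 : D) = 0.
  by apply: (addrI (star 0)); rewrite -starD !addr0.
exact: (big_morph star (@starD _ _) s0).
Qed.

Let mxstarD : {morph mxstar : x y / x + y}.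
Proof. by move=> x y; apply/matrixP => i j; rewrite !mxE starD. Qed.
Let mxstarM (x y : 'M[D]_n) : mxstar (x * y) = mxstar y * mxstar x.
Proof.
apply/matrixP => i j; rewrite !mxE star_sum.
by apply: eq_bigr => k _; rewrite !mxE starM.
Qed.
Let mxstarK : involutive mxstar.
Proof. by move=> x; apply/matrixP => i j; rewrite !mxE starK. Qed.
Let mxstarZ c x : mxstar (mxcscale c x) = mxcscale c^* (mxstar x).
Proof. by apply/matrixP => i j; rewrite !mxE starZ. Qed.
Let mxcscaleDr c : {morph mxcscale c : x y / x + y}.
Proof. by move=> x y; apply/matrixP => i j; rewrite !mxE cscaleDr. Qed.
Let mxcscaleDl b c x : mxcscale (b + c) x = mxcscale b x + mxcscale c x.
Proof. by apply/matrixP => i j; rewrite !mxE cscaleDl. Qed.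
Let mxcscaleA b c x : mxcscale b (mxcscale c x) = mxcscale (b * c) x.
Proof. by apply/matrixP => i j; rewrite !mxE cscaleA. Qed.
Let mxcscale1 x : mxcscale 1 x = x.
Proof. by apply/matrixP => i j; rewrite !mxE cscale1. Qed.
Let mxcscaleAl c (x y : 'M[D]_n) : mxcscale c (x * y) = mxcscale c x * y.
Proof.
apply/matrixP => i j; rewrite !mxE cscale_sum.
by apply: eq_bigr => k _; rewrite !mxE cscaleAl.
Qed.
Let mxcscaleAr c (x y : 'M[D]_n) : mxcscale c (x * y) = x * mxcscale c y.
Proof.
apply/matrixP => i j; rewrite !mxE cscale_sum.
by apply: eq_bigr => k _; rewrite !mxE cscaleAr.
Qed.

HB.instance Definition _ := isStarAlgebra.Build R 'M[D]_n
  mxstarD mxstarM mxstarK mxstarZ mxcscaleDr mxcscaleDl mxcscaleA mxcscale1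
  mxcscaleAl mxcscaleAr.

End MatrixStarAlgebra.

Section PairStarAlgebra.
Variables (D E : starAlgType R).
Implicit Types a : (D * E)%type.

Let pstar a : (D * E)%type := (star a.1, star a.2).
Let pcscale (c : R[i]) a : (D * E)%type := (cscale c a.1, cscale c a.2).

Let pstarD : {morph pstar : x y / x + y}.
Proof. by move=> x y; rewrite /pstar !starD. Qed.
Let pstarM x y : pstar (x * y) = pstar y * pstar x.
Proof. by rewrite /pstar !starM. Qed.
Let pstarK : involutive pstar.
Proof. by move=> [x y]; rewrite /pstar !starK. Qed.
Let pstarZ c x : pstar (pcscale c x) = pcscale c^* (pstar x).
Proof. by rewrite /pstar !starZ. Qed.
Let pcscaleDr c : {morph pcscale c : x y / x + y}.
Proof. by move=> x y; rewrite /pcscale !cscaleDr. Qed.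
Let pcscaleDl b c x : pcscale (b + c) x = pcscale b x + pcscale c x.
Proof. by rewrite /pcscale !cscaleDl. Qed.
Let pcscaleA b c x : pcscale b (pcscale c x) = pcscale (b * c) x.
Proof. by rewrite /pcscale !cscaleA. Qed.
Let pcscale1 x : pcscale 1 x = x.
Proof. by rewrite /pcscale !cscale1; case: x. Qed.
Let pcscaleAl c x y : pcscale c (x * y) = pcscale c x * y.
Proof. by rewrite /pcscale !cscaleAl. Qed.
Let pcscaleAr c x y : pcscale c (x * y) = x * pcscale c y.
Proof. by rewrite /pcscale !cscaleAr. Qed.

HB.instance Definition _ := isStarAlgebra.Build R (D * E)%type
  pstarD pstarM pstarK pstarZ pcscaleDr pcscaleDl pcscaleA pcscale1
  pcscaleAl pcscaleAr.

End PairStarAlgebra.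

(* [B] is the carrier of a C*-subalgebra of [D], not necessarily with the same
   unit; take [B := setT] for [D] itself. *)
Definition positive_in (D : starAlgType R) (B : set D) (a : D) : Prop :=
  exists2 b, B b & a = star b * b.

Definition positive_mx_in (D : starAlgType R) (B : set D) n (a : 'M[D]_n) :=
  positive_in [set b : 'M[D]_n | forall i j, B (b i j)] a.

Definition cstar_le (D : starAlgType R) (a b : D) : Prop :=
  positive_in setT (b - a).

Definition projection (D : starAlgType R) (p : D) : Prop :=
  star p = p /\ p * p = p.

Definition partial_isometry (D : starAlgType R) (s : D) : Prop :=
  s * star s * s = s.

Definition corner (D : starAlgType R) (p : D) : set D :=
  [set a | p * a * p = a].

Definition completely_positive_into (D E : starAlgType R) (B : set E)
    (f : D -> E) : Prop :=
  clinear f /\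
  forall n (a : 'M[D]_n), positive_mx_in setT a -> positive_mx_in B (map_mx f a).

Definition ucp_into_corner (D E : starAlgType R) (p : E) (f : D -> E) : Prop :=
  [/\ forall a, corner p (f a), f 1 = p & completely_positive_into (corner p) f].

(* The matrix [a] as an element of a larger matrix algebra; an element of
   [M_oo] is a matrix up to this operation. *)
Definition pad_mx (D : pzRingType) n m (a : 'M[D]_n) : 'M[D]_m :=
  \matrix_(i, j)
    match insub (val i), insub (val j) with
    | Some i', Some j' => a i' j'
    | _, _ => 0
    end.

Definition cuntz_sub_in (A : cstarAlgType R) (B : set A) m n
    (a : 'M[A]_m) (b : 'M[A]_n) : Prop :=
  exists (d : nat -> nat) (v : forall k, 'M[A]_(d k)),
    [/\ forall k, (m <= d k)%N /\ (n <= d k)%N,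
        forall k i j, B (v k i j) &
        op_norm star cnorm
          (v k *m pad_mx (d k) b *m adjmx star (v k) - pad_mx (d k) a)
        @[k --> \oo] --> (0 : R)].

Definition cuntz_sub1_in (A : cstarAlgType R) (B : set A) (a b : A) : Prop :=
  cuntz_sub_in B (a%:M : 'M[A]_1) (b%:M : 'M[A]_1).

Fixpoint connecting (D : nat -> Type) (nu : forall n, D n -> D n.+1) n k :
    D n -> D (k + n)%N :=
  match k return D n -> D (k + n)%N with
  | 0%N => fun a => a
  | k'.+1 => fun a => nu (k' + n)%N (connecting nu k' a)
  end.

(* [A] is the completion of the algebraic direct limit of the C*-algebras [D n],
   with norms [nrm n], for the seminorm sending the class of [a : D n] to the
   limit of the norms of its images in the [D (k + n)]. *)
Record direct_limit (D : nat -> starAlgType R) (nrm : forall n, D n -> R)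
    (nu : forall n, D n -> D n.+1) (A : cstarAlgType R)
    (phi : forall n, D n -> A) : Prop := DirectLimit {
  dl_hom : forall n, star_hom (phi n);
  dl_compat : forall n a, phi n.+1 (nu n a) = phi n a;
  dl_norm : forall n a,
    nrm (k + n)%N (connecting nu k a) @[k --> \oo] --> cnorm (phi n a);
  dl_dense : forall a (e : R), 0 < e -> exists n b, cnorm (a - phi n b) < e
}.

End StarAlgebraTheory.

HB.mixin Record isTopologicalGroup G of Group G & Topological G := {
  mulg_continuous : continuous (fun x : (G * G)%type => (x.1 * x.2)%g);
  invg_continuous : continuous (fun x : G => x^-1%g)
}.

#[short(type="topologicalGroupType")]
HB.structure Definition TopologicalGroup :=
  {G of isTopologicalGroup G & Group G & Topological G}.

Definition cfun (R : realType) (X : topologicalType) :=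
  continuousType X R[i]^o.

Section ContinuousFunctions.
Variables (R : realType) (X : topologicalType).
Local Notation T := (cfun R X).
Implicit Types f g h : T.

HB.instance Definition _ := Choice.copy T (continuousType X R[i]^o).

Lemma cfunP f g : f = g <-> f =1 g.
Proof. exact: continuousEP. Qed.

Let cfun_const (c : R[i]) : T := mkcts (@cst_continuous X R[i]^o c).

Let addf_continuous f g : continuous (fun x => f x + g x : R[i]^o).
Proof. by move=> x; apply: cvgD; apply: cts_fun. Qed.

Let oppf_continuous f : continuous (fun x => - f x : R[i]^o).
Proof. by move=> x; apply: cvgN; apply: cts_fun. Qed.

Let mulf_continuous f g : continuous (fun x => f x * g x : R[i]^o).
Proof. by move=> x; apply: cvgM; apply: cts_fun. Qed.

Let conjc_continuous : continuous (fun z : R[i]^o => z^* : R[i]^o).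
Proof.
move=> z A /(@nbhs_ballP _ R[i]^o)[e e0 eA].
apply/(@nbhs_ballP _ R[i]^o); exists e => //= w zw; apply: eA.
by rewrite /ball/= -[_ - _]/(z^* - w^* : R[i]) -rmorphB normcJ.
Qed.

Let conjf_continuous f : continuous (fun x => (f x)^* : R[i]^o).
Proof.
move=> x; apply: (@continuous_comp _ _ _ f (fun z : R[i]^o => z^* : R[i]^o)).
  exact: cts_fun.
exact: conjc_continuous.
Qed.

Let addf f g : T := mkcts (@addf_continuous f g).
Let oppf f : T := mkcts (@oppf_continuous f).
Let mulf f g : T := mkcts (@mulf_continuous f g).
Let conjf f : T := mkcts (@conjf_continuous f).

Let addfA : associative addf.
Proof. by move=> f g h; apply/cfunP => x; apply: addrA. Qed.
Let addfC : commutative addf.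
Proof. by move=> f g; apply/cfunP => x; apply: addrC. Qed.
Let add0f : left_id (cfun_const 0) addf.
Proof. by move=> f; apply/cfunP => x; apply: add0r. Qed.
Let addNf : left_inverse (cfun_const 0) oppf addf.
Proof. by move=> f; apply/cfunP => x; apply: addNr. Qed.

HB.instance Definition _ := GRing.isZmodule.Build T addfA addfC add0f addNf.

Let mulfA : associative mulf.
Proof. by move=> f g h; apply/cfunP => x; apply: mulrA. Qed.
Let mulfC : commutative mulf.
Proof. by move=> f g; apply/cfunP => x; apply: mulrC. Qed.
Let mul1f : left_id (cfun_const 1) mulf.
Proof. by move=> f; apply/cfunP => x; apply: mul1r. Qed.
Let mulfDl : left_distributive mulf +%R.
Proof. by move=> f g h; apply/cfunP => x; apply: mulrDl. Qed.
Let mul0f : left_zero 0 mulf.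
Proof. by move=> f; apply/cfunP => x; apply: mul0r. Qed.

HB.instance Definition _ :=
  GRing.Zmodule_isComPzRing.Build T mulfA mulfC mul1f mulfDl.

Let scalef (c : R[i]) f : T := cfun_const c * f.

Let conjfD : {morph conjf : f g / f + g}.
Proof. by move=> f g; apply/cfunP => x; apply: rmorphD. Qed.
Let conjfM f g : conjf (f * g) = conjf g * conjf f.
Proof. by rewrite [RHS]mulrC; apply/cfunP => x; apply: rmorphM. Qed.
Let conjfK : involutive conjf.
Proof. by move=> f; apply/cfunP => x; apply: conjcK. Qed.
Let conjfZ c f : conjf (scalef c f) = scalef c^* (conjf f).
Proof. by apply/cfunP => x; apply: rmorphM. Qed.
Let scalefDr c : {morph scalef c : f g / f + g}.
Proof. exact: mulrDr. Qed.
Let scalefDl b c f : scalef (b + c) f = scalef b f + scalef c f.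
Proof. by apply/cfunP => x; apply: mulrDl. Qed.
Let scalefA b c f : scalef b (scalef c f) = scalef (b * c) f.
Proof. by apply/cfunP => x; apply: mulrA. Qed.
Let scalef1 f : scalef 1 f = f.
Proof. exact: mul1r. Qed.
Let scalefAl c f g : scalef c (f * g) = scalef c f * g.
Proof. exact: mulrA. Qed.
Let scalefAr c f g : scalef c (f * g) = f * scalef c g.
Proof. exact: mulrCA. Qed.

HB.instance Definition _ := isStarAlgebra.Build R T
  conjfD conjfM conjfK conjfZ scalefDr scalefDl scalefA scalef1
  scalefAl scalefAr.

Lemma cfunD f g x : (f + g) x = f x + g x. Proof. by []. Qed.
Lemma cfunM f g x : (f * g) x = f x * g x. Proof. by []. Qed.
Lemma cfunS f x : (star f) x = (f x)^*. Proof. by []. Qed.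
Lemma cfunZ c f x : (cscale c f) x = c * f x. Proof. by []. Qed.
Lemma cfun0 x : (0 : T) x = 0. Proof. by []. Qed.
Lemma cfun1 x : (1 : T) x = 1. Proof. by []. Qed.

(* Evaluation at [x] identifies [M_n(C(X))] with [C(X, M_n)]. *)
Definition mxeval n (f : 'M[T]_n) (x : X) : 'M[R[i]]_n :=
  map_mx (fun g : T => g x) f.

(* The norms of [C(X)] and of [M_n(C(X))], for compact [X]. *)
Definition cfun_norm f : R := sup (range (fun x => @normc R (f x))).

Definition cfun_mx_norm n (f : 'M[T]_n) : R :=
  sup (range (fun x => op_norm conjc (@normc R) (mxeval f x))).

End ContinuousFunctions.

Section Actions.
Variables (R : realType) (G : topologicalGroupType).
Local Notation CG := (cfun R G).

Let mull_continuous (g : G) : continuous (fun h : G => (g * h)%g).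
Proof.
move=> h.
apply: (@continuous_comp G (G * G)%type G (fun h => (g, h))
         (fun x => (x.1 * x.2)%g)).
  by apply: cvg_pair; [exact: cvg_cst|exact: cvg_id].
exact: mulg_continuous.
Qed.

Let translate_continuous (g : G) (f : CG) :
  continuous (fun h : G => f (g * h)%g : R[i]^o).
Proof.
move=> h; apply: (@continuous_comp G G R[i]^o (fun h => (g * h)%g) f).
  exact: mull_continuous.
exact: cts_fun.
Qed.

Definition translate (g : G) (f : CG) : CG :=
  mkcts (@translate_continuous g f).

Definition Lt (g : G) (f : CG) : CG := translate g^-1%g f.

Variable (A : cstarAlgType R).

(* The notions below are meant for compact second countable [G]. *)
Record is_action (alpha : G -> A -> A) : Prop := IsAction {
  act_hom : forall g, star_hom (alpha g);
  act1 : forall a, alpha 1%g a = a;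
  actM : forall g h a, alpha (g * h)%g a = alpha g (alpha h a);
  act_continuous : forall a g,
    cnorm (alpha h a - alpha g a) @[h --> g] --> (0 : R)
}.

Variable (alpha : G -> A -> A).

Definition fixed : set A := [set a | forall g, alpha g a = a].

Definition approx_equivariant_central_mult (F : set A) (S : set CG) (e : R)
    (phi : CG -> A) : Prop :=
  [/\ forall f1 f2, S f1 -> S f2 ->
        cnorm (phi (f1 * f2) - phi f1 * phi f2) < e,
      forall f a, S f -> F a -> cnorm (phi f * a - a * phi f) < e &
      forall f, S f ->
        (ereal_sup (range (fun g =>
           (cnorm (phi (Lt g f) - alpha g (phi f)))%:E)) < e%:E)%E].

Definition rokhlin_data (p : A) (phi : CG -> A) : Prop :=
  [/\ fixed p, projection p & ucp_into_corner p phi].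

Definition contractive (phi : CG -> A) : Prop :=
  forall f, cnorm (phi f) <= cfun_norm f.

Definition trpc_conditions (F : set A) (S : set CG) (e : R) (x y p : A)
    (phi : CG -> A) : Prop :=
  [/\ approx_equivariant_central_mult F S e phi,
      cuntz_sub1_in setT (1 - p) x,
      cuntz_sub1_in fixed (1 - p) y,
      cuntz_sub1_in fixed (1 - p) p &
      cnorm (p * x * p) > 1 - e].

Definition tracial_rokhlin_comparison : Prop :=
  forall (F : set A) (S : set CG) (e : R) (x y : A),
    finite_set F -> finite_set S -> 0 < e ->
    positive_in setT x -> cnorm x = 1 -> positive_in fixed y -> y <> 0 ->
  exists p phi, rokhlin_data p phi /\ trpc_conditions F S e x y p phi.

Definition mtrp_conditions (F1 F2 : set A) (S : set CG) (e : R) (x p s : A)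
    (phi : CG -> A) : Prop :=
  [/\ approx_equivariant_central_mult F1 S e phi,
      cuntz_sub1_in setT (1 - p) x,
      star s * s = 1 - p /\ cstar_le (s * star s) p,
      forall a, F2 a -> cnorm (s * a - a * s) < e &
      cnorm (p * x * p) > 1 - e].

Definition modified_tracial_rokhlin : Prop :=
  forall (F1 F2 : set A) (S : set CG) (e : R) (x : A),
    finite_set F1 -> finite_set F2 -> F2 `<=` fixed -> finite_set S -> 0 < e ->
    positive_in setT x -> cnorm x = 1 ->
  exists p s phi,
    [/\ rokhlin_data p phi, contractive phi, fixed s, partial_isometry s &
        mtrp_conditions F1 F2 S e x p s phi].

End Actions.

Definition circle (R : realType) := {z : R[i] | normc z == 1}.

Section Circle.
Variable R : realType.
Local Notation S1 := (circle R).

HB.instance Definition _ := Choice.copy S1 {z : R[i] | normc z == 1}.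

Definition circle_val (z : S1) : R[i]^o := val z.

HB.instance Definition _ := Topological.copy S1 (initial_topology circle_val).

Let normc_val (z : S1) : normc (val z) = 1.
Proof. exact/eqP/(valP z). Qed.

Let mul_proof (z w : S1) : normc (val z * val w) == 1.
Proof. by rewrite ComplexField.Normc.normcM !normc_val mulr1. Qed.

Let inv_proof (z : S1) : normc (val z)^-1 == 1.
Proof. by rewrite ComplexField.Normc.normcV normc_val invr1. Qed.

Let one_proof : normc (1 : R[i]) == 1.
Proof. by rewrite ComplexField.Normc.normc1. Qed.

Let cmul (z w : S1) : S1 := exist _ (val z * val w) (mul_proof z w).
Let cinv (z : S1) : S1 := exist _ (val z)^-1 (inv_proof z).
Let cone : S1 := exist _ 1 one_proof.

Let val_neq0 (z : S1) : val z != 0.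
Proof.
apply/eqP => z0; have := normc_val z.
by rewrite z0 ComplexField.Normc.normc0 => /esym/eqP; rewrite oner_eq0.
Qed.

Let cmulA : associative cmul.
Proof. by move=> x y z; apply: val_inj; apply: mulrA. Qed.
Let cmul1 : left_id cone cmul.
Proof. by move=> x; apply: val_inj; apply: mul1r. Qed.
Let cmulr1 : right_id cone cmul.
Proof. by move=> x; apply: val_inj; apply: mulr1. Qed.
Let cmulV : left_inverse cone cinv cmul.
Proof. by move=> x; apply: val_inj; apply: mulVf. Qed.
Let cmulrV : right_inverse cone cinv cmul.
Proof. by move=> x; apply: val_inj; apply: mulfV. Qed.

HB.instance Definition _ := isGroup.Build S1 cmulA cmul1 cmulr1 cmulV cmulrV.

Let val_continuous : continuous circle_val.
Proof. exact: initial_continuous. Qed.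

Let circle_mul_continuous : continuous (fun x : (S1 * S1)%type => (x.1 * x.2)%g).
Proof.
apply: continuous_comp_initial => x.
apply: (@cvgM _ _ _ _ (fun x : S1 * S1 => circle_val x.1)
          (fun x : S1 * S1 => circle_val x.2)).
  by apply: (cvg_comp _ _ cvg_fst); apply: val_continuous.
by apply: (cvg_comp _ _ cvg_snd); apply: val_continuous.
Qed.

Let circle_inv_continuous : continuous (fun x : S1 => x^-1%g).
Proof.
apply: continuous_comp_initial => x.
apply: (@cvgV _ _ _ _ circle_val);
  [exact: (@nbhs_filter S1)|exact: val_neq0|exact: val_continuous].
Qed.

HB.instance Definition _ :=
  isTopologicalGroup.Build S1 circle_mul_continuous circle_inv_continuous.

Let expi_proof (t : R) : normc (cos t +i* sin t) == 1.
Proof. by rewrite /= cos2Dsin2 sqrtr1. Qed.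

Definition exp2pi (t : R) : S1 :=
  exist _ (cos (2 * pi * t) +i* sin (2 * pi * t)) (expi_proof (2 * pi * t)).

Lemma exp2piD (a b : R) : exp2pi (a + b) = (exp2pi a * exp2pi b)%g.
Proof.
apply: val_inj => /=; rewrite mulrDr cosD sinD.
by apply/eqP; rewrite eq_complex /= eqxx addrC [cos _ * sin _]mulrC
  [sin (2 * pi * b) * _]mulrC addrC eqxx.
Qed.

Lemma exp2pi_nat (a : R) n : (exp2pi a ^+ n)%g = exp2pi (a *+ n).
Proof.
elim: n => [|n IHn]; last by rewrite expgS mulrS exp2piD IHn.
by apply: val_inj; rewrite /= mulr0n mulr0 cos0 sin0.
Qed.

Lemma exp2pi1 : exp2pi 1 = 1%g.
Proof. by apply: val_inj; rewrite /= mulr1 mulr_natl cos2pi sin2pi. Qed.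

End Circle.

Section RotationAlgebra.
Variables (R : realType) (N : nat).
Local Notation CS1 := (cfun R (circle R)).

Definition beta_act (z : circle R) : CS1 -> CS1 := Lt z.

Definition beta_tilde (lambda : R) : CS1 -> CS1 := beta_act (exp2pi lambda).

Definition omega : circle R := exp2pi N%:R^-1.

(* The permutation unitary [s] in the definition of [rotalg]; [ordS] is the
   successor modulo [N]. *)
Definition rot_shift : 'M[R[i]]_N := \matrix_(i, j) (j == ordS i)%:R.

Definition rot_equivariant : {pred 'M[CS1]_N} :=
  mem [set f | forall z : circle R,
    mxeval f (omega * z)%g = rot_shift *m mxeval f z *m adjmx conjc rot_shift].

Let shift_adj : rot_shift *m adjmx conjc rot_shift = 1%:M.
Proof.
apply/matrixP => i j; rewrite !mxE (bigD1 (ordS i)) //= big1 ?addr0.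
- rewrite !mxE eqxx mul1r (inj_eq (can_inj (@ordSK N))) eq_sym.
  by case: (j == i); [exact: (rmorph1 conjc)|exact: (rmorph0 conjc)].
- by move=> k /negbTE ki; rewrite !mxE ki mul0r.
Qed.

Let adj_shift : adjmx conjc rot_shift *m rot_shift = 1%:M.
Proof. exact: mulmx1C shift_adj. Qed.

Let mxevalB (f g : 'M[CS1]_N) z : mxeval (f - g) z = mxeval f z - mxeval g z.
Proof. by apply/matrixP => i j; rewrite !mxE. Qed.

Let sum_eval n (F : 'I_n -> CS1) z : (\sum_i F i) z = \sum_i F i z.
Proof. exact: (big_morph (fun f : CS1 => f z) (fun f g => erefl) erefl). Qed.

Let mxevalM (f g : 'M[CS1]_N) z : mxeval (f *m g) z = mxeval f z *m mxeval g z.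
Proof.
apply/matrixP => i j; rewrite !mxE sum_eval.
by apply: eq_bigr => k _; rewrite !mxE.
Qed.

Let mxeval1 z : mxeval (1%:M : 'M[CS1]_N) z = 1%:M.
Proof. by apply/matrixP => i j; rewrite !mxE; case: (i == j). Qed.

Let mxeval_star (f : 'M[CS1]_N) z : mxeval (star f) z = adjmx conjc (mxeval f z).
Proof. by apply/matrixP => i j; rewrite !mxE. Qed.

Let rotP f : reflect (forall z : circle R,
    mxeval f (omega * z)%g = rot_shift *m mxeval f z *m adjmx conjc rot_shift)
  (f \in rot_equivariant).
Proof. by apply: (iffP idP) => [/set_mem|fP]; [|apply/mem_set]. Qed.

Let rot_subring : subring_closed rot_equivariant.
Proof.
split.
- by apply/rotP => z; rewrite !mxeval1 mulmx1 shift_adj.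
- move=> f g /rotP fP /rotP gP; apply/rotP => z.
  by rewrite !mxevalB fP gP mulmxBr mulmxBl.
- move=> f g /rotP fP /rotP gP; apply/rotP => z.
  rewrite !mxevalM fP gP !mulmxA; congr (_ *m _ *m _).
  by rewrite -mulmxA adj_shift mulmx1.
Qed.

(* The algebra of the [f] in [C(S^1, M_N)] with [f (omega z) = s (f z) s^*]. *)
Record rotalg : Type := RotAlg {
  rotval : 'M[CS1]_N;
  rotvalP : rotval \in rot_equivariant
}.

HB.instance Definition _ := [isSub for rotval].
HB.instance Definition _ := [Choice of rotalg by <:].
HB.instance Definition _ :=
  GRing.SubChoice_isSubPzRing.Build _ rot_equivariant rotalg rot_subring.

Let rot_star_proof (f : rotalg) : star (rotval f) \in rot_equivariant.
Proof.
apply/rotP => z; rewrite !mxeval_star (rotP _ (rotvalP f)).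
have tr (m n p : nat) (a : 'M[R[i]]_(m, n)) (b : 'M[R[i]]_(n, p)) :
    adjmx conjc (a *m b) = adjmx conjc b *m adjmx conjc a.
  by rewrite /adjmx trmx_mul (map_mxM conjc).
have trK (m n : nat) (a : 'M[R[i]]_(m, n)) : adjmx conjc (adjmx conjc a) = a.
  by apply/matrixP => i j; rewrite !mxE conjcK.
by rewrite !tr trK mulmxA.
Qed.

Let rot_cscale_proof c (f : rotalg) : cscale c (rotval f) \in rot_equivariant.
Proof.
have ev (g : 'M[CS1]_N) z : mxeval (cscale c g) z = c *: mxeval g z.
  by apply/matrixP => i j; rewrite !mxE.
by apply/rotP => z; rewrite !ev (rotP _ (rotvalP f)) -scalemxAr -scalemxAl.
Qed.

Let rstar f : rotalg := RotAlg (rot_star_proof f).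
Let rcscale c f : rotalg := RotAlg (rot_cscale_proof c f).

Let rstarD : {morph rstar : x y / x + y}.
Proof. by move=> x y; apply: val_inj; exact: starD. Qed.
Let rstarM x y : rstar (x * y) = rstar y * rstar x.
Proof. by apply: val_inj; exact: starM. Qed.
Let rstarK : involutive rstar.
Proof. by move=> x; apply: val_inj; exact: starK. Qed.
Let rstarZ c x : rstar (rcscale c x) = rcscale c^* (rstar x).
Proof. by apply: val_inj; exact: starZ. Qed.
Let rcscaleDr c : {morph rcscale c : x y / x + y}.
Proof. by move=> x y; apply: val_inj; exact: cscaleDr. Qed.
Let rcscaleDl b c x : rcscale (b + c) x = rcscale b x + rcscale c x.
Proof. by apply: val_inj; exact: cscaleDl. Qed.
Let rcscaleA b c x : rcscale b (rcscale c x) = rcscale (b * c) x.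
Proof. by apply: val_inj; exact: cscaleA. Qed.
Let rcscale1 x : rcscale 1 x = x.
Proof. by apply: val_inj; exact: cscale1. Qed.
Let rcscaleAl c x y : rcscale c (x * y) = rcscale c x * y.
Proof. by apply: val_inj; exact: cscaleAl. Qed.
Let rcscaleAr c x y : rcscale c (x * y) = x * rcscale c y.
Proof. by apply: val_inj; exact: cscaleAr. Qed.

HB.instance Definition _ := isStarAlgebra.Build R rotalg
  rstarD rstarM rstarK rstarZ rcscaleDr rcscaleDl rcscaleA rcscale1
  rcscaleAl rcscaleAr.

Let gamma_proof (z : circle R) (f : rotalg) :
  map_mx (beta_act z) (rotval f) \in rot_equivariant.
Proof.
have ev w : mxeval (map_mx (beta_act z) (rotval f)) w
          = mxeval (rotval f) (z^-1 * w)%g.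
  by apply/matrixP => i j; rewrite !mxE.
apply/rotP => w; rewrite !ev -(rotP _ (rotvalP f)); congr mxeval.
by apply: val_inj => /=; rewrite mulrCA.
Qed.

Definition rot_gamma (z : circle R) (f : rotalg) : rotalg :=
  RotAlg (gamma_proof z f).

Let xi_mx (f : CS1) : 'M[CS1]_N :=
  \matrix_(i, j) if i == j then translate (omega ^+ i)%g f else 0.

Let omegaN : (0 < N)%N -> (omega ^+ N)%g = 1%g.
Proof.
move=> N0; rewrite /omega exp2pi_nat -[_ *+ N]mulr_natl mulfV ?exp2pi1 //.
by rewrite pnatr_eq0 -lt0n.
Qed.

Let omega_mod n : (0 < N)%N -> (omega ^+ (n %% N))%g = (omega ^+ n)%g.
Proof.
move=> N0; rewrite {2}(divn_eq n N) mulnC expgnDr expgnA.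
by rewrite omegaN // expg1n mul1g.
Qed.

Let shift_conj (a : 'M[R[i]]_N) i j :
  (rot_shift *m a *m adjmx conjc rot_shift) i j = a (ordS i) (ordS j).
Proof.
rewrite !mxE (bigD1 (ordS j)) //= [X in _ + X]big1 ?addr0.
- rewrite !mxE eqxx rmorph1 mulr1 (bigD1 (ordS i)) //= big1 ?addr0.
  + by rewrite mxE eqxx mul1r.
  + by move=> k /negbTE ki; rewrite !mxE ki mul0r.
- move=> k /negbTE kj; rewrite [adjmx _ _ _ _]mxE !mxE kj.
  by rewrite (rmorph0 conjc) mulr0.
Qed.

Let xi_proof (f : CS1) : xi_mx f \in rot_equivariant.
Proof.
apply/rotP => z; apply/matrixP => i j; rewrite shift_conj !mxE.
rewrite (inj_eq (can_inj (@ordSK N))); case: eqP => // _.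
have N0 : (0 < N)%N by apply: leq_ltn_trans (ltn_ord i).
congr (f _); rewrite /= omega_mod // expgSr.
by apply: val_inj => /=; rewrite mulrA.
Qed.

Definition rot_xi (f : CS1) : rotalg := RotAlg (xi_proof f).

Definition rot_iota : rotalg -> 'M[CS1]_N := rotval.

End RotationAlgebra.

Section Blocks.

Definition block_diag (D : pzRingType) m k (F : 'I_m -> 'M[D]_k) : 'M[D]_(m * k) :=
  \matrix_(i, j)
    let: (i1, i2) := mxtens_unindex i in let: (j1, j2) := mxtens_unindex j in
    if i1 == j1 then F i1 i2 j2 else 0.

Definition flatten_mx (D : pzRingType) n m (a : 'M['M[D]_n]_m) : 'M[D]_(n * m) :=
  \matrix_(i, j)
    let: (i1, i2) := mxtens_unindex i in let: (j1, j2) := mxtens_unindex j in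
    a i2 j2 i1 j1.

(* [id_(M_n)] tensor the map [d |-> 1_(M_k)] tensor [psi d]. Here and in
   [flatten_mx], the order of the tensor factors only matters up to conjugation
   by a permutation matrix. *)
Definition ampl (D E : pzRingType) (psi : D -> E) k n (a : 'M[D]_n) :
    'M[E]_(k * n) :=
  block_diag (fun _ : 'I_k => map_mx psi a).

End Blocks.

Section Tower.
Variables (R : realType) (N : nat) (theta : R) (r00 r10 : nat).
Variables (l00 l01 l10 l11 : nat -> nat).
Local Notation CS1 := (cfun R (circle R)).

Fixpoint ranks n : nat * nat :=
  if n is n'.+1 then
    (l00 n' * (ranks n').1 + l01 n' * (ranks n').2,
     N * (l10 n' * (ranks n').1) + 2 * N * (l11 n' * (ranks n').2))%N
  else (r00, r10).

Definition stage n : starAlgType R :=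
  ('M[rotalg R N]_((ranks n).1) * 'M[CS1]_((ranks n).2))%type.

Definition stage_norm n (a : stage n) : R :=
  Num.max (cfun_mx_norm (flatten_mx (map_mx (@rot_iota R N) a.1)))
          (cfun_mx_norm a.2).

Definition stage_act n (z : circle R) (a : stage n) : stage n :=
  (map_mx (rot_gamma z) a.1, map_mx (beta_act z) a.2).

Definition angle (j : nat) : R :=
  if (j < N)%N then j%:R / N%:R else theta + (j - N)%:R / N%:R.

Definition nu n (a : stage n) : stage n.+1 :=
  (block_mx (ampl id (l00 n) a.1) 0
            0 (ampl (@rot_xi R N) (l01 n) a.2),
   block_mx (flatten_mx (ampl (@rot_iota R N) (l10 n) a.1)) 0
            0 (block_diag (fun j : 'I_(2 * N) =>
                 ampl (beta_tilde (angle j)) (l11 n) a.2))).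

Definition limit_action (A : cstarAlgType R) (phi : forall n, stage n -> A)
    (alpha : circle R -> A -> A) : Prop :=
  [/\ direct_limit stage_norm nu phi,
      is_action alpha &
      forall n z a, alpha z (phi n a) = phi n (stage_act z a)].

End Tower.

(* Main.v *)
Require Import Defs.
From HB Require Import structures.
From mathcomp Require Import all_boot all_order all_algebra.
From mathcomp Require Import all_classical all_reals all_analysis.
From mathcomp Require Import complex mxtens.
From mathcomp Require Import zify ring lra.

Set Implicit Arguments.
Unset Strict Implicit.
Unset Printing Implicit Defensive.

Import Order.TTheory GRing.Theory Num.Theory.
Import numFieldNormedType.Exports.

Local Open Scope classical_set_scope.
Local Open Scope ring_scope.

(* Let [p = (0, 1)] and [q = 1 - p = (1, 0)] in [A_(M+1)]. The map
   [f |-> (0, f 1)] from [C(S^1)] to [p A p] is an equivariant homomorphism whose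
   range commutes with [A_(M+1)], so for large [M] only the comparison properties
   of [q] are at stake.

   Let [T] be such that [T l_00 <= l_01] and [T l_10 <= l_11] at [M + 1]; such [M]
   exist by the growth hypotheses. Then there are [T] partial isometries
   [s_1, ..., s_T] in [A_(M+2)], fixed by the action, with orthogonal ranges below
   [p] and [s_t^* s_t = q], that commute with all of [A_M]: counting copies, the
   representation of [A_M] cut down by [q] occurs [T] times in the one cut down by
   [p], via intertwiners with constant entries. The only copies that are not
   obvious come from the rotation algebra, in which [f] is intertwined with
   [xi (iota f)] by the column of the [s^h / sqrt N], for the permutation unitary
   [s]. Each [s_t] is the partial isometry of the modified Rokhlin property and
   shows [q <= p].

   Let [b <> 0] in [A], let [c] in some [A_n] be close to [b^* b], and let [W_t] in
   [A_n] satisfy [sum_t W_t c W_t^* = 1], with a bound on [sum_t W_t W_t^*] that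
   depends only on the norm of [b]. Then [w = sum_t W_t s_t^*] satisfies
   [w c w^* = q], so that [w b^* b w^*] is at distance less than 1 from [q] and [q]
   is Cuntz below [b^* b]. For [b] fixed, [c] and the [W_t] are constant matrices;
   in general the [W_t] come from finitely many rotates by multiples of [theta] of
   an arc on which [c] is large. *)

(** The isometries sit two stages above [A_M]. The passage to [A_(M+1)] places what the rotation
    summand sees of [A_M] inside what the circle summand sees, by [l_00 <= l_10] and [l_01 <= l_11];
    the next passage, where the blocks of [q] and [p] stand side by side, supplies the factor [T].

    The order of choices matters: [b] determines the number of the [W_t], hence [T], and only then
    is [M] chosen, so that arbitrarily large ratios are called for. How close [c] must be to [b^* b]
    is dictated by the bound on [w w^*], so this bound may depend on the norm of [b] alone.

    The estimate for [p x p] rests on another inclusion: the circle summand of a stage contains both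
    summands of the stage before, so compression by [p] is isometric on [A_M].

    Norms in the stages are treated as pointwise bounds on operators on [C^n], which pass along
    isometric intertwiners; in [A], explicit iterations replace spectral theory. For fixed elements
    an average over the [N]-th roots of unity suffices: evaluation at 1 then stays in the rotation
    algebra. *)

Local Notation normc := ComplexField.Normc.normc.
Local Notation cscale := Defs.cscale.

(** * C*-algebras *)

Section StarAlgebra.
Variables (R : realType) (D : starAlgType R).
Implicit Types x y : D.

Lemma star0 : star (0 : D) = 0.
Proof. by apply: (addrI (star 0)); rewrite -starD !addr0. Qed.

Lemma starN x : star (- x) = - star x.
Proof. by apply: (addrI (star x)); rewrite -starD !subrr star0. Qed.

Lemma starB x y : star (x - y) = star x - star y.
Proof. by rewrite starD starN. Qed.

Lemma star1 : star (1 : D) = 1.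
Proof. by rewrite -[RHS]starK -[star 1]mul1r starM !starK mul1r. Qed.

Lemma star_sum (I : Type) (r : seq I) (P : pred I) (F : I -> D) :
  star (\sum_(i <- r | P i) F i) = \sum_(i <- r | P i) star (F i).
Proof. exact: (big_morph star (@starD _ _) star0). Qed.

Lemma cscaler0 c : cscale c (0 : D) = 0.
Proof. by apply: (addrI (cscale c 0)); rewrite -cscaleDr !addr0. Qed.

Lemma cscale0r x : cscale 0 x = 0.
Proof. by apply: (addrI (cscale 0 x)); rewrite -cscaleDl !addr0. Qed.

Lemma cscaleN c x : cscale (- c) x = - cscale c x.
Proof. by apply: (addrI (cscale c x)); rewrite -cscaleDl !subrr cscale0r. Qed.

Lemma cscalerN c x : cscale c (- x) = - cscale c x.
Proof. by apply: (addrI (cscale c x)); rewrite -cscaleDr !subrr cscaler0. Qed.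

Lemma cscalerB c x y : cscale c (x - y) = cscale c x - cscale c y.
Proof. by rewrite cscaleDr cscalerN. Qed.

Lemma cscale_sumr c (I : Type) (r : seq I) (P : pred I) (F : I -> D) :
  cscale c (\sum_(i <- r | P i) F i) = \sum_(i <- r | P i) cscale c (F i).
Proof. exact: (big_morph _ (cscaleDr c) (cscaler0 c)). Qed.

Lemma cscale_mulrn c x n : cscale c x *+ n = cscale (c *+ n) x.
Proof. by elim: n => [|n IHn]; rewrite ?mulr0n ?cscale0r // !mulrS cscaleDl IHn. Qed.

Lemma half_double x : cscale 2^-1 (x + x) = x.
Proof.
rewrite -[X in X + X]cscale1 -cscaleDl cscaleA -[RHS]cscale1; congr cscale.
by rewrite -[1 + 1]/(2 : R[i]) mulVf // pnatr_eq0.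
Qed.

Lemma conjc_half : conjc (2^-1 : R[i]) = 2^-1.
Proof. by rewrite conjc_inv conjc_nat. Qed.

End StarAlgebra.

Section StarHom.
Variables (R : realType) (D E : starAlgType R) (f : D -> E).
Hypothesis hf : star_hom f.

Lemma shD x y : f (x + y) = f x + f y. Proof. by case: hf => -[]. Qed.
Lemma shM x y : f (x * y) = f x * f y. Proof. by case: hf. Qed.
Lemma sh1 : f 1 = 1. Proof. by case: hf. Qed.
Lemma shS x : f (star x) = star (f x). Proof. by case: hf. Qed.
Lemma shZ c x : f (cscale c x) = cscale c (f x). Proof. by case: hf => -[]. Qed.
Lemma sh0 : f 0 = 0.
Proof. by apply: (addrI (f 0)); rewrite -shD !addr0. Qed.
Lemma shN x : f (- x) = - f x.
Proof. by apply: (addrI (f x)); rewrite -shD !subrr sh0. Qed.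
Lemma shB x y : f (x - y) = f x - f y.
Proof. by rewrite shD shN. Qed.
Lemma sh_sum (I : Type) (r : seq I) (P : pred I) (F : I -> D) :
  f (\sum_(i <- r | P i) F i) = \sum_(i <- r | P i) f (F i).
Proof. exact: (big_morph f shD sh0). Qed.

End StarHom.

(** * Norm estimates and self-adjoint square roots in a C*-algebra *)

Section CstarNorm.
Variables (R : realType) (A : cstarAlgType R).
Implicit Types x y z : A.

Lemma normc_real (r : R) : 0 <= r -> normc r%:C%C = r.
Proof. by move=> r0; rewrite /= expr0n /= addr0 sqrtr_sqr ger0_norm. Qed.

Lemma cnorm0 : cnorm (0 : A) = 0.
Proof. by rewrite -(cscale0r (0 : A)) cnormZ ComplexField.Normc.normc0 mul0r. Qed.

Lemma cnormN x : cnorm (- x) = cnorm x.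
Proof.
by rewrite -[- x]cscale1 cscalerN -cscaleN cnormZ normcN
  ComplexField.Normc.normc1 mul1r.
Qed.

Lemma cnorm_ge0 x : 0 <= cnorm x.
Proof.
have := ler_cnormD x (- x); rewrite subrr cnorm0 cnormN -mulr2n.
by rewrite pmulrn_lge0.
Qed.

Lemma cnormBC x y : cnorm (x - y) = cnorm (y - x).
Proof. by rewrite -cnormN opprB. Qed.

Lemma ler_cnormB x y : cnorm (x - y) <= cnorm x + cnorm y.
Proof. by rewrite -(cnormN y) ler_cnormD. Qed.

Lemma ler_cnorm_dist z x y : cnorm (x - y) <= cnorm (x - z) + cnorm (z - y).
Proof. by apply: le_trans (ler_cnormD _ _); rewrite addrA subrK. Qed.

Lemma ler_cnorm_sub x y : cnorm x - cnorm y <= cnorm (x - y).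
Proof. by rewrite lerBlDr; apply: le_trans (ler_cnormD _ _); rewrite subrK. Qed.

Lemma cnorm_gt0 x : x <> 0 -> 0 < cnorm x.
Proof.
by move=> x0; rewrite lt_neqAle cnorm_ge0 andbT eq_sym; apply/eqP => /cnorm0_eq0.
Qed.

Lemma cnorm_starE x : cnorm (star x) = cnorm x.
Proof.
have le z : cnorm z <= cnorm (star z).
  have [->|/eqP z0] := eqVneq z 0; first by rewrite star0.
  have := ler_cnormM (star z) z; rewrite cnorm_star expr2 ler_pM2r //.
  exact: cnorm_gt0.
by apply/eqP; rewrite eq_le le andbT -[X in _ <= cnorm X]starK le.
Qed.

Lemma cnorm_mulstar x : cnorm (x * star x) = cnorm x ^+ 2.
Proof. by rewrite -[x in x * _]starK cnorm_star cnorm_starE. Qed.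

Lemma cnorm_projection_le1 (p : A) : projection p -> cnorm p <= 1.
Proof.
case=> ps pp; have := cnorm_star p; rewrite ps pp.
have [->|/eqP/cnorm_gt0 p0] := eqVneq p 0; first by rewrite cnorm0.
rewrite expr2 -[LHS]mulr1 => /mulfI e; by rewrite -e ?gt_eqF.
Qed.

Lemma cnorm1_le : cnorm (1 : A) <= 1.
Proof. by apply: cnorm_projection_le1; split; rewrite ?star1 ?mulr1. Qed.

Lemma cnorm_sum_le (I : Type) (r : seq I) (F : I -> A) :
  cnorm (\sum_(i <- r) F i) <= \sum_(i <- r) cnorm (F i).
Proof.
elim: r => [|i r IHr]; first by rewrite !big_nil cnorm0.
by rewrite !big_cons; apply: le_trans (ler_cnormD _ _) _; rewrite lerD2l.
Qed.

Lemma ler_cnormM2 x y (a b : R) : cnorm x <= a -> cnorm y <= b ->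
  cnorm (x * y) <= a * b.
Proof.
move=> xa yb; apply: le_trans (ler_cnormM _ _) _.
by apply: ler_pM => //; apply: cnorm_ge0.
Qed.

Lemma cnorm_half x : cnorm (cscale 2^-1 x) = cnorm x / 2.
Proof.
rewrite cnormZ mulrC; congr (_ * _).
by rewrite -(@rmorph_nat _ _ (real_complex R) 2) -fmorphV normc_real ?invr_ge0.
Qed.

(* [p + i q] is normal, and [p] is its real part. *)
Lemma cnorm_sqr_le (p q : A) : star p = p -> star q = q -> p * q = q * p ->
  cnorm p ^+ 2 <= cnorm (p * p + q * q).
Proof.
move=> ps qs pq.
set iq := cscale 'i%C q.
have iqs : star iq = - iq.
  rewrite /iq starZ qs -cscaleN; congr cscale.
  by apply/eqP; rewrite eq_complex /= oppr0 !eqxx.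
have e1 : star (p + iq) * (p + iq) = p * p + q * q.
  rewrite starD ps iqs mulrDr !mulrDl !mulNr /iq -!cscaleAl -!cscaleAr pq.
  rewrite addrA subrK cscaleA; have -> : 'i%C * 'i%C = -1 :> R[i] by exact: sqr_i.
  by rewrite cscaleN cscale1 opprK.
have -> : cnorm (p * p + q * q) = cnorm (p + iq) ^+ 2 by rewrite -e1 cnorm_star.
rewrite lerXn2r ?nnegrE ?cnorm_ge0 //.
have {1}-> : p = cscale 2^-1 ((p + iq) + star (p + iq)).
  by rewrite starD ps iqs addrACA subrr addr0 half_double.
rewrite [X in X <= _]cnorm_half ler_pdivrMr // mulr_natr mulr2n.
apply: le_trans (ler_cnormD _ _) _.
by rewrite cnorm_starE.
Qed.

Lemma cnorm_eq0_small x : (forall e : R, 0 < e -> cnorm x <= e) -> x = 0.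
Proof.
move=> xe; apply: cnorm0_eq0; apply/eqP; rewrite eq_le cnorm_ge0 andbT.
by apply/ler_addgt0Pl => e /xe; rewrite addr0.
Qed.

(* With [k = 1 - y] the equation [k^2 = 1 - t] reads [y = (t + y^2) / 2], and
   the right-hand side is a contraction of the ball of radius [tau]. *)
Lemma sqrt_one_sub (t : A) (tau : R) : star t = t -> cnorm t <= tau -> tau < 1 ->
  exists k, [/\ star k = k, k * k = 1 - t &
    forall v, v * t = t * v -> k * v = v * k].
Proof.
move=> ts tt tau1; have tau0 : 0 <= tau := le_trans (cnorm_ge0 _) tt.
pose step y := cscale 2^-1 (t + y * y).
pose u n := iter n step 0.
have us n : star (u n) = u n.
  elim: n => [|n IHn]; first exact: star0.
  by rewrite /= /step starZ conjc_half starD starM IHn ts.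
have uc v n : v * t = t * v -> u n * v = v * u n.
  move=> vt; elim: n => [|n IHn]; first by rewrite mul0r mulr0.
  rewrite /= /step -cscaleAl -cscaleAr; congr cscale.
  by rewrite mulrDl mulrDr mulrA -IHn vt -!mulrA -IHn.
have un n : cnorm (u n) <= tau.
  elim: n => [|n IHn]; first by rewrite cnorm0.
  rewrite /= /step cnorm_half ler_pdivrMr //.
  apply: le_trans (ler_cnormD _ _) _; rewrite mulr_natr mulr2n lerD //.
  by apply: le_trans (ler_cnormM2 IHn IHn) _; rewrite ler_piMr // ltW.
have step_dist a b (c : R) : cnorm a <= c -> cnorm b <= c ->
    cnorm (step a - step b) <= c * cnorm (a - b).
  move=> ac bc; rewrite /step -cscalerB cnorm_half ler_pdivrMr //.
  have -> : t + a * a - (t + b * b) = a * (a - b) + (a - b) * b.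
    by rewrite opprD addrACA subrr add0r mulrBr mulrBl addrA subrK.
  apply: le_trans (ler_cnormD _ _) _; rewrite mulr_natr mulr2n lerD //.
    exact: ler_cnormM2.
  by rewrite mulrC; apply: ler_cnormM2.
have ud k n : cnorm (u (n + k)%N - u n) <= tau ^+ n * tau.
  elim: n => [|n IHn]; first by rewrite add0n subr0 expr0 mul1r.
  rewrite addSn exprS -mulrA.
  by apply: le_trans (step_dist _ _ _ (un _) (un _)) _; rewrite ler_wpM2l.
have [|a ua] := @cnorm_complete _ _ u.
  move=> e e0.
  (* By [ud], all later terms lie within [tau ^+ n0 * tau] of [u n0]; the factor 2 compares two of
     them. *)
  have /cvgrPdist_lt/(_ e e0)[n0 _ n0e] : (tau ^+ n * tau * 2 @[n --> \oo] --> (0 : R)).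
    rewrite -(mul0r (tau * 2)); under eq_fun do rewrite -mulrA.
    by apply: cvgMl; apply: cvg_expr; rewrite ger0_norm.
  exists n0 => m n n0m n0n.
  have := n0e n0 (leqnn _); rewrite /= sub0r normrN ger0_norm; last first.
    by rewrite !mulr_ge0 ?exprn_ge0.
  apply: le_lt_trans; apply: le_trans (ler_cnorm_dist (u n0) _ _) _.
  rewrite mulr_natr mulr2n lerD //; last rewrite cnormBC.
    by rewrite -{1}(subnKC n0m).
  by rewrite -{1}(subnKC n0n).
have near e : 0 < e -> exists n, cnorm (u n - a) < e /\ cnorm (u n.+1 - a) < e.
  move=> e0; have /cvgrPdist_lt/(_ e e0)[n0 _ n0e] := ua.
  by exists n0; split; [have := n0e n0 | have := n0e n0.+1];
    rewrite /= sub0r normrN ger0_norm ?cnorm_ge0 //; apply.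
have as_ : star a = a.
  apply/eqP; rewrite -subr_eq0; apply/eqP/cnorm_eq0_small => e e0.
  have [n [na _]] := near _ (divr_gt0 e0 (ltr0n _ 2)).
  apply: le_trans (ler_cnorm_dist (u n) _ _) _; rewrite (splitr e) lerD //; last exact: ltW.
  by rewrite -{1}us -starB cnorm_starE cnormBC ltW.
have ac v : v * t = t * v -> a * v = v * a.
  move=> vt; apply/eqP; rewrite -subr_eq0; apply/eqP/cnorm_eq0_small => e e0.
  have e' : 0 < e / 2 / (cnorm v + 1).
    by rewrite !divr_gt0 // ltr_wpDl ?cnorm_ge0.
  have [n [/ltW na _]] := near _ e'.
  apply: le_trans (ler_cnorm_dist (u n * v) _ _) _; rewrite (splitr e).
  have h : cnorm v <= cnorm v + 1 by rewrite lerDl.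
  have tn0 : cnorm v + 1 != 0 by rewrite gt_eqF // ltr_wpDl ?cnorm_ge0.
  rewrite lerD //; last rewrite uc //.
    rewrite -mulrBl; rewrite cnormBC in na; apply: le_trans (ler_cnormM2 na h) _.
    by rewrite divfK.
  rewrite -mulrBr; apply: le_trans (ler_cnormM2 h na) _.
  by rewrite mulrC divfK.
have ae : step a = a.
  apply/eqP; rewrite -subr_eq0; apply/eqP/cnorm_eq0_small => e e0.
  (* A crude Lipschitz constant of [step], valid at both [a] and [u n]. *)
  pose c := cnorm a + tau + 1.
  have c0 : 0 < c by rewrite ltr_wpDl // addr_ge0 ?cnorm_ge0.
  have [n [na nSa]] := near _ (divr_gt0 e0 (addr_gt0 c0 ltr01)).
  apply: le_trans (ler_cnorm_dist (u n.+1) _ _) _.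
  apply: (@le_trans _ _ (c * (e / (c + 1)) + e / (c + 1))); last first.
    by rewrite -{2}[e / _]mul1r -mulrDl mulrC divfK // gt_eqF // addr_gt0.
  rewrite lerD //; last exact: ltW.
  apply: le_trans (step_dist a (u n) c _ _) _.
  - by rewrite /c -addrA lerDl addr_ge0.
  - by apply: le_trans (un n) _; rewrite /c addrAC lerDr addr_ge0 ?cnorm_ge0.
  - by rewrite ler_pM2l // cnormBC ltW.
exists (1 - a); split.
- by rewrite starB star1 as_.
- have : t + a * a = a + a.
    by rewrite -{3 4}ae /step -cscaleDr half_double.
  move/(canRL (addKr _)) => aa.
  rewrite mulrBl mul1r mulrBr mulr1 aa [_ + (a + a)]addrA -[a - _]opprB addrK.
  by rewrite opprK [- t + a]addrC addrA subrK.
- by move=> v /ac av; rewrite mulrBl mulrBr mul1r mulr1 av.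
Qed.

End CstarNorm.

(** For self-adjoint [h] of norm below 1, the root [k] of [1 - h * h] commutes with [h], so [f h]
    and [f k] are commuting self-adjoint elements whose squares add up to 1. The general case
    rescales [star x * x]; the extra [e] makes its norm strictly less than 1. *)
Lemma star_hom_contractive (R : realType) (A B : cstarAlgType R) (f : A -> B) x :
  star_hom f -> cnorm (f x) <= cnorm x.
Proof.
move=> hf.
have contr h : star h = h -> cnorm h < 1 -> cnorm (f h) <= 1.
  move=> hs h1; have n0 := cnorm_ge0 h.
  have hh : cnorm (h * h) <= cnorm h ^+ 2 by rewrite expr2 ler_cnormM.
  have [||k [ks kk kh]] := sqrt_one_sub _ hh.
  - by rewrite starM hs.
  - by rewrite exprn_ilt1.
  have fk : f k * f h = f h * f k by rewrite -!(shM hf) kh // mulrA.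
  rewrite -(@expr_le1 _ 2) ?cnorm_ge0 //.
  have := @cnorm_sqr_le _ _ (f h) (f k).
  rewrite -!(shS hf) hs ks -!(shM hf) kk -(shD hf) addrC subrK (sh1 hf).
  move=> le; apply: le_trans (le _ _ _) (cnorm1_le _) => //.
  by rewrite !(shM hf) fk.
apply/ler_addgt0Pl => e e0; set c := e + cnorm x.
have c0 : 0 < c by rewrite ltr_pwDl ?cnorm_ge0.
have nc r z : 0 <= r -> cnorm (cscale r%:C%C z : A) = r * cnorm z.
  by move=> r0; rewrite cnormZ normc_real.
have nc' r z : 0 <= r -> cnorm (cscale r%:C%C z : B) = r * cnorm z.
  by move=> r0; rewrite cnormZ normc_real.
have ci0 : 0 <= (c ^+ 2)^-1 by rewrite invr_ge0 exprn_ge0 // ltW.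
have := contr (cscale ((c ^+ 2)^-1)%:C%C (star x * x)).
rewrite starZ starM starK conjc_real (shZ hf) (shM hf) (shS hf) nc // nc' //.
rewrite !cnorm_star !ler_pdivrMl ?ltr_pdivrMl ?exprn_gt0 // !mulr1.
have xc : cnorm x < c by rewrite /c ltrDr.
rewrite ltrXn2r ?nnegrE ?cnorm_ge0 ?xc ?ler_pXn2r ?nnegrE ?cnorm_ge0 ?(ltW c0) //.
by apply.
Qed.

Lemma op_norm_ge0 (R : realType) (D : pzRingType) (st : D -> D) (nrm : D -> R) n
  (a : 'M[D]_n) : 0 <= op_norm st nrm a.
Proof.
rewrite /op_norm /=; set E := [set _ | _ in _].
(* Without a supremum, [sup] takes the default value 0. *)
have [sE|/sup_out e0] := pselect (has_sup E); last by rewrite e0.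
have [[y [v v1 vy]] _] := sE; apply: (@le_trans _ _ y); first by rewrite -vy sqrtr_ge0.
by apply: (ub_le_sup sE.2); exists v.
Qed.

(** * Cuntz subequivalence of a projection *)

Section CuntzComparison.
Variables (R : realType) (A : cstarAlgType R).
Implicit Types x y : A.

Lemma op_norm_scalar_le x :
  op_norm star cnorm (x%:M : 'M[A]_1) <= cnorm x.
Proof.
apply: ge_sup => [|_ [v /= v1 <-]].
  eexists; exists 0 => //=.
  by rewrite mulmx0 mxE cnorm0 sqrtr0 ler01.
have e (w : 'cV[A]_1) : Num.sqrt (cnorm ((adjmx star w *m w) 0 0)) = cnorm (w 0 0).
  by rewrite mxE big_ord1 !mxE cnorm_star sqrtr_sqr ger0_norm ?cnorm_ge0.
move: v1; rewrite !e => v1; rewrite mul_scalar_mx mxE -[X in _ <= X]mulr1.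
exact: ler_cnormM2.
Qed.

Definition star_subring (B : set A) : Prop :=
  [/\ forall x y, B x -> B y -> B (x + y), forall x y, B x -> B y -> B (x * y),
      forall x, B x -> B (star x) & forall c x, B x -> B (cscale c x)].

(* If [h = w y w^*] and [t = q - h], then replacing [w] by [(q + t / 2) w]
   replaces [t] by [3/4 t^2 + 1/4 t^3], so that iterating gives [q]. *)
Lemma cuntz_sub_projection (B : set A) (q y w : A) :
  star_subring B -> projection q -> B q -> B w -> B y -> star y = y ->
  cnorm (w * y * star w - q) < 1 -> cuntz_sub1_in B q y.
Proof.
move=> [BD BM BS BZ] [qs qq] Bq Bw By ys wq.
set e := cnorm _ in wq; have e0 : 0 <= e by apply: cnorm_ge0.
have q1 : cnorm q <= 1 by apply: cnorm_projection_le1.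
have BB a b : B a -> B b -> B (a - b).
  by move=> Ba Bb; apply: BD => //; rewrite -[b]cscale1 -cscaleN; apply: BZ.
pose d v := q - v * y * star v.
pose step v := (q + cscale 2^-1 (d v)) * v.
(* Starting from [q * w] keeps every iterate under [q], so that the defect [d] stays in the corner
   of [q]. *)
pose u n := iter n step (q * w).
have uB n : B (u n).
  elim: n => [|n IHn]; first exact: BM.
  apply: (BM) => //; apply: BD => //; apply: BZ; apply: BB => //.
  by apply: (BM); [exact: BM | exact: BS].
have uq n : q * u n = u n.
  elim: n => [|n IHn]; first by rewrite mulrA qq.
  rewrite /= /step mulrA mulrDr qq -cscaleAr; congr ((_ + cscale _ _) * _).
  by rewrite /d mulrBr qq !mulrA IHn.
have ud n : cnorm (d (u n)) <= e ^+ n.+1.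
  have ds v : star (d v) = d v.
    by rewrite /d starB !starM starK ys qs mulrA.
  have qd n0 : q * d (u n0) = d (u n0) by rewrite /d mulrBr qq !mulrA uq.
  have dq n0 : d (u n0) * q = d (u n0).
    by have := congr1 star (qd n0); rewrite starM ds qs.
  elim: n => [|n IHn].
    rewrite expr1 /d -cnormN opprB /= starM qs.
    have -> : q * w * y * (star w * q) - q = q * (w * y * star w - q) * q.
      by rewrite mulrBr mulrBl qq qq !mulrA.
    by rewrite -[e]mulr1 -[e]mul1r; apply: ler_cnormM2 => //; apply: ler_cnormM2.
  set t := d (u n) in IHn; set z := cscale 2^-1 t.
  have zs : star z = z by rewrite /z starZ conjc_half ds.
  have h : u n * y * star (u n) = q - t by rewrite /t /d opprB addrCA subrr addr0.
  have tt : t = z + z by rewrite /z -cscaleDr half_double.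
  have qz : q * z = z by rewrite /z -cscaleAr qd.
  have zq : z * q = z by rewrite /z -cscaleAl dq.
  have dE : d (u n.+1) = z * z + (z * z + z * z) + (z * z * z + z * z * z).
    rewrite /d /= /step -/t -/z starM starD qs zs.
    have -> : (q + z) * u n * y * (star (u n) * (q + z)) = (q + z) * (q - t) * (q + z).
      by rewrite -h !mulrA.
    have -> : (q + z) * (q - t) = q - z - (z * z + z * z).
      rewrite tt mulrDl mulrBr mulrBr qq mulrDr qz zq mulrDr opprD addrA.
      by rewrite addrA subrK.
    set S := z * z + z * z; have Sq : S * q = S by rewrite /S mulrDl -mulrA zq.
    have -> : (q - z - S) * (q + z) = q - (z * z + S + S * z).
      rewrite mulrDr !mulrBl qq zq Sq qz !opprD !addrA.
      by rewrite [_ + z]addrAC [_ - z * z + z]addrAC subrK.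
    by rewrite subKr /S mulrDl.
  have t1 : e ^+ n.+1 <= 1 by apply: exprn_ile1 => //; apply: ltW.
  set r := e ^+ n.+1 in t1 IHn.
  have r0 : 0 <= r by apply: exprn_ge0.
  have nz : cnorm z <= r / 2 by rewrite /z cnorm_half ler_pM2r // invr_gt0.
  have nzz := ler_cnormM2 nz nz; have nzzz := ler_cnormM2 nzz nz.
  rewrite dE; apply: le_trans (ler_cnormD _ _) _.
  apply: le_trans (lerD (ler_cnormD _ _) (ler_cnormD _ _)) _.
  apply: le_trans (lerD (lerD nzz (ler_cnormD _ _)) (lerD nzzz nzzz)) _.
  apply: le_trans (lerD (lerD (lexx _) (lerD nzz nzz)) (lexx _)) _.
  (* As [r <= 1], the bound [3/4 r^2 + 1/4 r^3] is at most [r^2], and [r <= e] turns this into the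
     next power of [e]. *)
  have re : r <= e by rewrite /r exprS ler_piMr // exprn_ile1 // ltW.
  apply: (@le_trans _ _ (r * r)); last by rewrite exprS -/r ler_wpM2r.
  have : r * r * r <= r * r by rewrite ler_piMr // mulr_ge0.
  lra.
exists (fun=> 1%N), (fun n => (u n)%:M); split => //.
  by move=> n i j; rewrite mxE !ord1 eqxx mulr1n.
have pad1 (a : A) : pad_mx 1 (a%:M : 'M[A]_1) = a%:M.
  apply/matrixP => i j; rewrite !ord1 !mxE /=.
  by case: insubP => [k _ _|//]; rewrite !ord1 mxE.
have adj1 (a : A) : adjmx star (a%:M : 'M[A]_1) = (star a)%:M.
  by apply/matrixP => i j; rewrite !ord1 !mxE eqxx !mulr1n.
have mul1 (a b : A) : (a%:M : 'M[A]_1) *m b%:M = (a * b)%:M.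
  by rewrite -scalar_mxM.
apply: (@squeeze_cvgr _ _ _ _ (cst 0) (fun n => e ^+ n.+1)).
- near=> n; rewrite !pad1 adj1 !mul1 -raddfB /=; apply/andP; split.
    exact: op_norm_ge0.
  apply: le_trans (op_norm_scalar_le _) _.
  by rewrite cnormBC ud.
- exact: cvg_cst.
- by rewrite (cvg_shiftS (fun n => e ^+ n)); apply: cvg_expr; rewrite ger0_norm.
Unshelve. all: by end_near.
Qed.

End CuntzComparison.

(** * Intertwiners between matrix-valued maps *)

Section StarMatrices.
Variables (R : realType) (D : starAlgType R).

Local Notation "a ^*m" := (adjmx star a) (at level 2, format "a ^*m").

Lemma adjmxM m n p (a : 'M[D]_(m, n)) (b : 'M[D]_(n, p)) :
  (a *m b)^*m = b^*m *m a^*m.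
Proof.
apply/matrixP => i j; rewrite !mxE star_sum.
by apply: eq_bigr => k _; rewrite !mxE starM.
Qed.

Lemma adjmxK m n (a : 'M[D]_(m, n)) : (a^*m)^*m = a.
Proof. by apply/matrixP => i j; rewrite !mxE starK. Qed.

Lemma adjmxD m n (a b : 'M[D]_(m, n)) : (a + b)^*m = a^*m + b^*m.
Proof. by apply/matrixP => i j; rewrite !mxE starD. Qed.

Lemma adjmx0 m n : (0 : 'M[D]_(m, n))^*m = 0.
Proof. by apply/matrixP => i j; rewrite !mxE star0. Qed.

Lemma adjmx_scalar n (d : D) : (d%:M : 'M[D]_n)^*m = (star d)%:M.
Proof.
by apply/matrixP => i j; rewrite !mxE eq_sym; case: (_ == _); rewrite // star0.
Qed.

Lemma adjmx1 n : (1%:M : 'M[D]_n)^*m = 1%:M.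
Proof. by rewrite adjmx_scalar star1. Qed.

Lemma adjmx_sum m n (I : Type) (r : seq I) (P : pred I) (F : I -> 'M[D]_(m, n)) :
  (\sum_(i <- r | P i) F i)^*m = \sum_(i <- r | P i) (F i)^*m.
Proof. exact: (big_morph _ (@adjmxD m n) (adjmx0 m n)). Qed.

Lemma adj_block_mx m1 m2 n1 n2 (a : 'M[D]_(m1, n1)) (b : 'M[D]_(m1, n2))
    (c : 'M[D]_(m2, n1)) (d : 'M[D]_(m2, n2)) :
  (block_mx a b c d)^*m = block_mx a^*m c^*m b^*m d^*m.
Proof. by rewrite /adjmx tr_block_mx map_block_mx. Qed.

Lemma adj_col_mx m1 m2 n (a : 'M[D]_(m1, n)) (b : 'M[D]_(m2, n)) :
  (col_mx a b)^*m = row_mx a^*m b^*m.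
Proof. by rewrite /adjmx tr_col_mx map_row_mx. Qed.

End StarMatrices.

Section MapStarHom.
Variables (R : realType) (D E : starAlgType R) (f : D -> E).
Hypothesis hf : star_hom f.

Lemma map_mx_shM m n p (a : 'M[D]_(m, n)) (b : 'M[D]_(n, p)) :
  map_mx f (a *m b) = map_mx f a *m map_mx f b.
Proof.
apply/matrixP => i j; rewrite !mxE (sh_sum hf).
by apply: eq_bigr => k _; rewrite !mxE (shM hf).
Qed.

Lemma map_mx_shD m n (a b : 'M[D]_(m, n)) :
  map_mx f (a + b) = map_mx f a + map_mx f b.
Proof. by apply/matrixP => i j; rewrite !mxE (shD hf). Qed.

Lemma map_mx_sh0 m n : map_mx f (0 : 'M[D]_(m, n)) = 0.
Proof. by apply/matrixP => i j; rewrite !mxE (sh0 hf). Qed.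

Lemma map_mx_sh_sum m n (I : Type) (r : seq I) (P : pred I) (F : I -> 'M[D]_(m, n)) :
  map_mx f (\sum_(i <- r | P i) F i) = \sum_(i <- r | P i) map_mx f (F i).
Proof. exact: (big_morph _ (@map_mx_shD m n) (map_mx_sh0 m n)). Qed.

Lemma map_mx_sh_scalar n (d : D) : map_mx f (d%:M : 'M[D]_n) = (f d)%:M.
Proof.
by apply/matrixP => i j; rewrite !mxE; case: (_ == _); rewrite // (sh0 hf).
Qed.

Lemma map_mx_sh1 n : map_mx f (1%:M : 'M[D]_n) = 1%:M.
Proof. by rewrite map_mx_sh_scalar (sh1 hf). Qed.

Lemma map_mx_shS m n (a : 'M[D]_(m, n)) :
  map_mx f (adjmx star a) = adjmx star (map_mx f a).
Proof. by apply/matrixP => i j; rewrite !mxE (shS hf). Qed.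

End MapStarHom.

Lemma sum_mxtens (V : nmodType) m n (F : 'I_(m * n) -> V) :
  \sum_k F k = \sum_i \sum_j F (mxtens_index (i, j)).
Proof.
rewrite pair_big (reindex (@mxtens_index m n)) /=; first by apply: eq_bigr => -[].
by exists (@mxtens_unindex _ _) => k _; rewrite (mxtens_indexK, mxtens_unindexK).
Qed.

Section Intertwiners.
Variables (R : realType) (G : Type) (X : Type).

(* Matrix-valued functions on [X] play the role of representations, and
   matrices over the fixed points of [act] that of intertwiners. *)
Section Fixed.
Variables (D : starAlgType R) (act : G -> D -> D).

Definition fixed_mx m n (V : 'M[D]_(m, n)) : Prop :=
  forall z, map_mx (act z) V = V.

Definition subrep m n (rho : X -> 'M[D]_m) (sig : X -> 'M[D]_n) : Prop :=
  exists V : 'M[D]_(n, m), [/\ adjmx star V *m V = 1%:M, fixed_mx V &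
    forall x, V *m rho x = sig x *m V].

Definition copies (I : finType) m n (r : I -> X -> 'M[D]_m) (sig : X -> 'M[D]_n)
    (K : I -> 'M[D]_(n, m)) : Prop :=
  [/\ forall i j, adjmx star (K i) *m K j = if i == j then 1%:M else 0,
      forall i, fixed_mx (K i) & forall i x, K i *m r i x = sig x *m K i].

Definition has_copies (I : finType) m n (r : I -> X -> 'M[D]_m)
    (sig : X -> 'M[D]_n) : Prop := exists K, copies r sig K.

(** The ranges of the isometries exhaust the space: [rho] is the orthogonal direct sum of the
    [r i]. *)
Definition splits (I : finType) m n (rho : X -> 'M[D]_n) (r : I -> X -> 'M[D]_m) :
    Prop :=
  exists2 J, copies r rho J & \sum_i J i *m adjmx star (J i) = 1%:M.

Hypothesis hact : forall z, star_hom (act z).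

Lemma fixed_mxM m n p (a : 'M[D]_(m, n)) (b : 'M[D]_(n, p)) :
  fixed_mx a -> fixed_mx b -> fixed_mx (a *m b).
Proof. by move=> ha hb z; rewrite (map_mx_shM (hact z)) ha hb. Qed.

Lemma fixed_mxS m n (a : 'M[D]_(m, n)) : fixed_mx a -> fixed_mx (adjmx star a).
Proof. by move=> ha z; rewrite (map_mx_shS (hact z)) ha. Qed.

Lemma fixed_mx0 m n : fixed_mx (0 : 'M[D]_(m, n)).
Proof. by move=> z; rewrite (map_mx_sh0 (hact z)). Qed.

Lemma fixed_mx1 n : fixed_mx (1%:M : 'M[D]_n).
Proof. by move=> z; rewrite (map_mx_sh1 (hact z)). Qed.

Lemma fixed_mx_sum m n (I : Type) (r : seq I) (F : I -> 'M[D]_(m, n)) :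
  (forall i, fixed_mx (F i)) -> fixed_mx (\sum_(i <- r) F i).
Proof.
by move=> hF z; rewrite (map_mx_sh_sum (hact z)); apply: eq_bigr => i _; apply: hF.
Qed.

Lemma fixed_col_mx m1 m2 n (a : 'M[D]_(m1, n)) (b : 'M[D]_(m2, n)) :
  fixed_mx a -> fixed_mx b -> fixed_mx (col_mx a b).
Proof. by move=> ha hb z; rewrite map_col_mx ha hb. Qed.

Lemma has_copies_trans (I : finType) l m n (r' : I -> X -> 'M[D]_l)
    (r : I -> X -> 'M[D]_m) (sig : X -> 'M[D]_n) :
  (forall i, subrep (r' i) (r i)) -> has_copies r sig -> has_copies r' sig.
Proof.
move=> /fin_all_exists[V hV] [K [Kd Kf KE]].
exists (fun i => K i *m V i); split.
- move=> i j; rewrite adjmxM mulmxA -[_ *m _ *m K j]mulmxA Kd.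
  case: eqP => [<-|_]; last by rewrite mulmx0 mul0mx.
  by rewrite mulmx1; case: (hV i).
- by move=> i; apply: fixed_mxM; [exact: Kf | case: (hV i)].
- by move=> i x; rewrite -mulmxA; case: (hV i) => _ _ ->; rewrite !mulmxA KE.
Qed.

Lemma has_copies_sub (I : finType) l m n (r : I -> X -> 'M[D]_l)
    (rho : X -> 'M[D]_m) (sig : X -> 'M[D]_n) :
  has_copies r rho -> subrep rho sig -> has_copies r sig.
Proof.
move=> [K [Kd Kf KE]] [V [VV Vf VE]]; exists (fun i => V *m K i); split.
- by move=> i j; rewrite adjmxM mulmxA -[_ *m _ *m V]mulmxA VV mulmx1 Kd.
- by move=> i; apply: fixed_mxM.
- by move=> i x; rewrite -mulmxA KE !mulmxA VE.
Qed.

Lemma has_copies_inj (I J : finType) m n (r : I -> X -> 'M[D]_m)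
    (sig : X -> 'M[D]_n) (g : J -> I) :
  injective g -> has_copies r sig -> has_copies (fun j => r (g j)) sig.
Proof.
move=> ginj [K [Kd Kf KE]]; exists (fun j => K (g j)); split=> // i j.
by rewrite Kd (inj_eq ginj).
Qed.

Lemma copy_subrep (I : finType) m n (r : I -> X -> 'M[D]_m) (sig : X -> 'M[D]_n) i :
  has_copies r sig -> subrep (r i) sig.
Proof.
by move=> [K [Kd Kf KE]]; exists (K i); split=> //; rewrite Kd eqxx.
Qed.

Lemma subrep_trans l m n (tau : X -> 'M[D]_l) (rho : X -> 'M[D]_m)
    (sig : X -> 'M[D]_n) : subrep tau rho -> subrep rho sig -> subrep tau sig.
Proof.
move=> tr [V [VV Vf VE]]; apply: (copy_subrep (r := fun=> tau) tt).
apply: (has_copies_trans (r := fun=> rho)) => [//|].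
by exists (fun=> V); split=> // -[] [].
Qed.

(** The isometry for [r i] cuts it into the pieces [rr i j] by the adjoints of the splitting
    isometries [L i j], and sends each piece to its own copy in [sig]. It thus suffices to count
    copies of small pieces. *)
Lemma has_copies_group (I J : finType) l m n (rr : I -> J -> X -> 'M[D]_l)
    (r : I -> X -> 'M[D]_m) (sig : X -> 'M[D]_n) :
  has_copies (fun ij : I * J => rr ij.1 ij.2) sig ->
  (forall i, splits (r i) (rr i)) -> has_copies r sig.
Proof.
move=> [K [Kd Kf KE]] hs.
have /fin_all_exists[L hL] : forall i, exists L : J -> 'M[D]_(m, l),
  copies (rr i) (r i) L /\ \sum_j L j *m adjmx star (L j) = 1%:M.
  by move=> i; have [L] := hs i; exists L.
exists (fun i => \sum_j K (i, j) *m adjmx star (L i j)); split.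
- move=> i i'; rewrite adjmx_sum mulmx_suml.
  transitivity (\sum_j if i == i' then L i j *m adjmx star (L i j) else 0).
    apply: eq_bigr => j _; rewrite mulmx_sumr adjmxM adjmxK (bigD1 j) //=.
    rewrite mulmxA -[_ *m _ *m K _]mulmxA Kd xpair_eqE eqxx andbT.
    rewrite big1 ?addr0; last first.
      move=> j' j'j; rewrite mulmxA -[_ *m _ *m K _]mulmxA Kd xpair_eqE.
      by rewrite [j == j']eq_sym (negbTE j'j) andbF mulmx0 mul0mx.
    by case: eqP => [<-|_]; rewrite ?mulmx1 // mulmx0 mul0mx.
  case: eqP => _; last by rewrite big1.
  by have [_ ->] := hL i.
- move=> i; apply: fixed_mx_sum => j; apply: fixed_mxM => //.
  by have [[_ Lf _] _] := hL i; apply: fixed_mxS.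
- move=> i x; have [[Ld Lf LE] L1] := hL i.
  rewrite mulmx_suml mulmx_sumr; apply: eq_bigr => j _.
  rewrite mulmxA -KE -!mulmxA; congr (_ *m _).
  rewrite -[LHS]mulmx1 -L1 mulmx_sumr (bigD1 j) //= big1 ?addr0.
    by rewrite !mulmxA -[_ *m r i x *m _]mulmxA -LE mulmxA Ld eqxx mul1mx.
  move=> j' j'j; rewrite !mulmxA -[_ *m r i x *m _]mulmxA -LE mulmxA Ld.
  by rewrite eq_sym (negbTE j'j) !mul0mx.
Qed.

Lemma splits_subrep (J : finType) l m n (rr : J -> X -> 'M[D]_l)
    (rho : X -> 'M[D]_m) (sig : X -> 'M[D]_n) :
  splits rho rr -> has_copies rr sig -> subrep rho sig.
Proof.
move=> rs [K [Kd Kf KE]]; apply: (copy_subrep (r := fun=> rho) tt).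
apply: (has_copies_group (rr := fun=> rr)) => [|//].
exists (fun ij => K ij.2); by split=> //= -[[] i] [[] j]; rewrite Kd xpair_eqE.
Qed.

(* Stated with the two inclusions, because the functors below do not preserve
   the block decomposition of the index set. *)
Lemma subrep_block_sum m m1 m2 n1 n2 (rho : X -> 'M[D]_m)
    (rho1 : X -> 'M[D]_m1) (rho2 : X -> 'M[D]_m2)
    (sig1 : X -> 'M[D]_n1) (sig2 : X -> 'M[D]_n2)
    (J1 : 'M[D]_(m, m1)) (J2 : 'M[D]_(m, m2)) :
  adjmx star J1 *m J1 = 1%:M -> adjmx star J2 *m J2 = 1%:M ->
  adjmx star J1 *m J2 = 0 -> J1 *m adjmx star J1 + J2 *m adjmx star J2 = 1%:M ->
  fixed_mx J1 -> fixed_mx J2 ->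
  (forall x, J1 *m rho1 x = rho x *m J1) -> (forall x, J2 *m rho2 x = rho x *m J2) ->
  subrep rho1 sig1 -> subrep rho2 sig2 ->
  subrep rho (fun x => block_mx (sig1 x) 0 0 (sig2 x)).
Proof.
move=> J11 J22 J12 Js f1 f2 E1 E2 [V1 [VV1 Vf1 VE1]] [V2 [VV2 Vf2 VE2]].
have J21 : adjmx star J2 *m J1 = 0.
  by rewrite -[LHS]adjmxK adjmxM adjmxK J12 adjmx0.
exists (col_mx (V1 *m adjmx star J1) (V2 *m adjmx star J2)); split.
- rewrite adj_col_mx mul_row_col !adjmxM !adjmxK -Js.
  rewrite -!mulmxA [adjmx star V1 *m _]mulmxA [adjmx star V2 *m _]mulmxA.
  by rewrite VV1 VV2 !mul1mx.
- by apply: fixed_col_mx; apply: fixed_mxM => //; apply: fixed_mxS.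
- move=> x; rewrite mul_block_col !mul0mx addr0 add0r mul_col_mx.
  rewrite !mulmxA -VE1 -VE2 -!mulmxA; congr col_mx; congr (_ *m _).
  + rewrite -[LHS]mulmx1 -Js mulmxDr !mulmxA -!(mulmxA _ (rho x)) -E1 -E2.
    by rewrite !mulmxA J11 J12 mul1mx !mul0mx addr0.
  + rewrite -[LHS]mulmx1 -Js mulmxDr !mulmxA -!(mulmxA _ (rho x)) -E1 -E2.
    by rewrite !mulmxA J22 J21 mul1mx !mul0mx add0r.
Qed.

Section BlockInclusions.
Variables (m1 m2 : nat).
Local Notation J1 := (col_mx 1%:M 0 : 'M[D]_(m1 + m2, m1)).
Local Notation J2 := (col_mx 0 1%:M : 'M[D]_(m1 + m2, m2)).

Lemma block_inclusions : [/\ adjmx star J1 *m J1 = 1%:M,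
  adjmx star J2 *m J2 = 1%:M, adjmx star J1 *m J2 = 0 &
  J1 *m adjmx star J1 + J2 *m adjmx star J2 = 1%:M].
Proof.
rewrite !adj_col_mx !mul_row_col !adjmx1 !adjmx0 !mul0mx !mulmx0 !mulmx1.
rewrite !addr0 !add0r; split=> //.
rewrite !mul_col_row !mulmx0 !mul0mx !mulmx1 add_block_mx !addr0 !add0r.
by rewrite -scalar_mx_block.
Qed.

Lemma fixed_block_inclusions : fixed_mx J1 /\ fixed_mx J2.
Proof.
by split; apply: fixed_col_mx;
  [exact: fixed_mx1 | exact: fixed_mx0 | exact: fixed_mx0 | exact: fixed_mx1].
Qed.

Lemma block_inclusionsE (a : 'M[D]_m1) (b : 'M[D]_m2) :
  J1 *m a = block_mx a 0 0 b *m J1 /\ J2 *m b = block_mx a 0 0 b *m J2.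
Proof.
rewrite !mul_block_col !mul_col_mx !mulmx0 !mul0mx !mulmx1 !mul1mx.
by rewrite !addr0 !add0r.
Qed.

End BlockInclusions.

Lemma subrep_block m1 m2 n1 n2 (rho1 : X -> 'M[D]_m1) (rho2 : X -> 'M[D]_m2)
    (sig1 : X -> 'M[D]_n1) (sig2 : X -> 'M[D]_n2) :
  subrep rho1 sig1 -> subrep rho2 sig2 ->
  subrep (fun x => block_mx (rho1 x) 0 0 (rho2 x))
         (fun x => block_mx (sig1 x) 0 0 (sig2 x)).
Proof.
have [J11 J22 J12 Js] := block_inclusions m1 m2.
have [f1 f2] := fixed_block_inclusions m1 m2.
move=> s1 s2; apply: (subrep_block_sum J11 J22 J12 Js f1 f2 _ _ s1 s2) => x;
  by have [] := block_inclusionsE (rho1 x) (rho2 x).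
Qed.

Lemma subrep_block1 m1 m2 (rho1 : X -> 'M[D]_m1) (rho2 : X -> 'M[D]_m2) :
  subrep rho1 (fun x => block_mx (rho1 x) 0 0 (rho2 x)).
Proof.
exists (col_mx 1%:M 0); have [J11 _ _ _] := block_inclusions m1 m2.
have [f1 _] := fixed_block_inclusions m1 m2.
by split=> // x; have [] := block_inclusionsE (rho1 x) (rho2 x).
Qed.

Lemma subrep_block2 m1 m2 (rho1 : X -> 'M[D]_m1) (rho2 : X -> 'M[D]_m2) :
  subrep rho2 (fun x => block_mx (rho1 x) 0 0 (rho2 x)).
Proof.
exists (col_mx 0 1%:M); have [_ J22 _ _] := block_inclusions m1 m2.
have [_ f2] := fixed_block_inclusions m1 m2.
by split=> // x; have [] := block_inclusionsE (rho1 x) (rho2 x).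
Qed.

Definition diag_incl m k (i : 'I_m) : 'M[D]_(m * k, k) :=
  \matrix_(x, y) (((mxtens_unindex x).1 == i)%:R * ((mxtens_unindex x).2 == y)%:R).

Lemma diag_inclE m k i (j : 'I_m * 'I_k) y :
  diag_incl k i (mxtens_index j) y = if (j.1 == i) && (j.2 == y) then 1 else 0.
Proof.
by rewrite mxE mxtens_indexK; do 2 case: (_ == _); rewrite ?mulr0 ?mulr1 ?mul0r.
Qed.

Lemma mul_diag_inclE m k p (i : 'I_m) (a : 'M[D]_(k, p)) j y :
  (diag_incl k i *m a) (mxtens_index j) y = if j.1 == i then a j.2 y else 0.
Proof.
rewrite mxE (bigD1 j.2) //= diag_inclE eqxx andbT big1 ?addr0.
  by case: (_ == _); rewrite ?mul1r ?mul0r.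
by move=> l /negbTE lj; rewrite diag_inclE [_ == l]eq_sym lj andbF mul0r.
Qed.

Lemma mul_adj_diag_inclE m k p (i : 'I_m) (a : 'M[D]_(m * k, p)) x y :
  (adjmx star (diag_incl k i) *m a) x y = a (mxtens_index (i, x)) y.
Proof.
rewrite mxE sum_mxtens (bigD1 i) //= (bigD1 x) //=.
rewrite 2!mxE diag_inclE !eqxx /= star1 mul1r big1 ?addr0 => [|l /negbTE lx]; last first.
  by rewrite 2!mxE diag_inclE /= lx andbF star0 mul0r.
rewrite big1 ?addr0 // => l /negbTE li; rewrite big1 // => l' _.
by rewrite 2!mxE diag_inclE /= li star0 mul0r.
Qed.

Lemma block_diag_copies m k (F : 'I_m -> X -> 'M[D]_k) :
  copies F (fun x => block_diag (fun i => F i x)) (@diag_incl m k).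
Proof.
split.
- move=> i j; apply/matrixP => x y; rewrite mul_adj_diag_inclE diag_inclE /=.
  by case: (i == j); rewrite mxE //; case: (x == y).
- move=> i z; apply/matrixP => x y; rewrite mxE; case: (mxtens_indexP x) => a b.
  by rewrite diag_inclE; case: (_ && _); rewrite ((sh1 (hact z)), (sh0 (hact z))).
- move=> i x; apply/matrixP => u v; case: (mxtens_indexP u) => a b.
  rewrite mul_diag_inclE mxE sum_mxtens (bigD1 i) //= (bigD1 v) //=.
  rewrite [in RHS]big1 ?addr0 => [|l /negbTE lv]; last first.
    by rewrite diag_inclE /= lv andbF mulr0.
  rewrite [in RHS]big1 ?addr0 => [|l /negbTE li]; last first.
    by rewrite big1 // => l' _; rewrite diag_inclE /= li mulr0.
  by rewrite mxE diag_inclE !mxtens_indexK !eqxx mulr1; case: eqP => [->|].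
Qed.

Lemma block_diag_splits m k (F : 'I_m -> X -> 'M[D]_k) :
  splits (fun x => block_diag (fun i => F i x)) F.
Proof.
exists (@diag_incl m k); first exact: block_diag_copies.
apply/matrixP => u v; case: (mxtens_indexP u) => a b; rewrite summxE.
rewrite (bigD1 a) //= mul_diag_inclE eqxx big1 ?addr0; last first.
  by move=> l /negbTE la; rewrite mul_diag_inclE eq_sym la.
case: (mxtens_indexP v) => c d; rewrite 2!mxE diag_inclE mxE.
rewrite (inj_eq (can_inj (@mxtens_indexK _ _))) xpair_eqE /= eq_sym [b == d]eq_sym.
by case: (_ && _); rewrite ((star1 D), (star0 D)).
Qed.

End Fixed.

Lemma subrep_map (D E : starAlgType R) (act : G -> D -> D) (act' : G -> E -> E)
    (f : D -> E) m n (rho : X -> 'M[D]_m) (sig : X -> 'M[D]_n) :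
  star_hom f -> (forall z d, f (act z d) = act' z (f d)) ->
  subrep act rho sig ->
  subrep act' (fun x => map_mx f (rho x)) (fun x => map_mx f (sig x)).
Proof.
move=> hf fe [V [VV Vf VE]]; exists (map_mx f V); split.
- by rewrite -(map_mx_shS hf) -(map_mx_shM hf) VV (map_mx_sh1 hf).
- move=> z; rewrite -map_mx_comp -[in RHS](Vf z) -map_mx_comp.
  by apply: eq_map_mx => d /=; rewrite fe.
- by move=> x; rewrite -!(map_mx_shM hf) VE.
Qed.

End Intertwiners.

(** * The rotation algebra *)

Section RotationMaps.
Variables (R : realType) (N : nat).
Local Notation S1 := (circle R).
Local Notation CS1 := (cfun R S1).
Local Notation rot := (rotalg R N).

Lemma circle_mulC (z w : S1) : (z * w)%g = (w * z)%g.
Proof. by apply: val_inj => /=; rewrite mulrC. Qed.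

Lemma beta_actE z (f : CS1) w : beta_act z f w = f (z^-1 * w)%g.
Proof. by []. Qed.

Lemma beta_act_hom (z : S1) : star_hom (@beta_act R z).
Proof. by split; [split|..] => [f g|c f||f g|f]; apply/cfunP. Qed.

Lemma translate_hom (z : S1) : star_hom (@translate R (circle R) z).
Proof. by split; [split|..] => [f g|c f||f g|f]; apply/cfunP. Qed.

Lemma rotval_inj : injective (@rotval R N).
Proof. exact: val_inj. Qed.

Lemma rot_eq (f g : rot) : (forall i j z, rotval f i j z = rotval g i j z) -> f = g.
Proof. by move=> fg; apply: rotval_inj; apply/matrixP => i j; apply/cfunP. Qed.

Lemma rotvalD (f g : rot) : rotval (f + g) = rotval f + rotval g. Proof. by []. Qed.
Lemma rotvalM (f g : rot) : rotval (f * g) = rotval f *m rotval g. Proof. by []. Qed.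
Lemma rotval0 : rotval (0 : rot) = 0. Proof. by []. Qed.
Lemma rotval1 : rotval (1 : rot) = 1%:M. Proof. by []. Qed.
Lemma rotval_sum (I : Type) (r : seq I) (P : pred I) (F : I -> rot) :
  rotval (\sum_(i <- r | P i) F i) = \sum_(i <- r | P i) rotval (F i).
Proof. exact: (big_morph _ rotvalD rotval0). Qed.

Lemma rot_gamma_hom (z : S1) : star_hom (@rot_gamma R N z).
Proof.
have hb := beta_act_hom z.
split; [split|..] => [f g|c f||f g|f]; apply: rotval_inj => /=.
- exact: (map_mx_shD hb).
- by apply/matrixP => i j; rewrite !mxE (shZ hb).
- exact: (map_mx_sh1 hb).
- exact: (map_mx_shM hb).
- exact: (map_mx_shS hb).
Qed.

Lemma rot_gammaE z (f : rot) i j w :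
  rotval (rot_gamma z f) i j w = rotval f i j (z^-1 * w)%g.
Proof. by rewrite mxE. Qed.

Lemma rot_xi_hom : star_hom (@rot_xi R N).
Proof.
split; [split|..] => [f g|c f||f g|f]; apply: rotval_inj; apply/matrixP => i j.
- by rewrite /= !mxE; case: eqP => _; rewrite ?addr0 // (shD (translate_hom _)).
- rewrite /= !mxE; case: eqP => _; rewrite ?(shZ (translate_hom _)) //.
  by rewrite cscaler0.
- by rewrite /= !mxE; case: eqP => _ //; rewrite (sh1 (translate_hom _)).
- rewrite rotvalM [RHS]mxE (bigD1 i) //= big1 ?addr0; last first.
    by move=> k /negbTE ki; rewrite !mxE eq_sym ki mul0r.
  rewrite !mxE eqxx; case: eqP => _; rewrite ?mulr0 //.
  by rewrite (shM (translate_hom _)).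
- rewrite /= !mxE eq_sym; case: eqP => [->|_]; rewrite ?star0 //.
  by rewrite (shS (translate_hom _)).
Qed.

Lemma rot_gamma_xi z (f : CS1) : rot_gamma z (rot_xi N f) = rot_xi N (beta_act z f).
Proof.
apply: rot_eq => i j w; rewrite /= !mxE; case: eqP => // _.
by rewrite /beta_act /Lt /=; congr (f _); apply: val_inj => /=; rewrite mulrCA.
Qed.

(** The amplified inclusion [rot_iota], in rectangular form so that it applies to intertwiners as
    well as to elements of the stages. *)
Definition flat_mx m n (a : 'M[rot]_(m, n)) : 'M[CS1]_(N * m, N * n) :=
  \matrix_(i, j) rotval (a (mxtens_unindex i).2 (mxtens_unindex j).2)
                   (mxtens_unindex i).1 (mxtens_unindex j).1.

Lemma flat_mxE m n (a : 'M[rot]_(m, n)) i j :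
  flat_mx a (mxtens_index i) (mxtens_index j) = rotval (a i.2 j.2) i.1 j.1.
Proof. by rewrite mxE !mxtens_indexK. Qed.

Lemma flatten_mx_iota m (a : 'M[rot]_m) :
  flatten_mx (map_mx (@rot_iota R N) a) = flat_mx a.
Proof. apply/matrixP => i j; by rewrite !mxE /mxtens_unindex mxE. Qed.

Lemma flat_mxM m n p (a : 'M[rot]_(m, n)) (b : 'M[rot]_(n, p)) :
  flat_mx (a *m b) = flat_mx a *m flat_mx b.
Proof.
apply/matrixP => i j; case: (mxtens_indexP i) => i1 i2; case: (mxtens_indexP j) => j1 j2.
rewrite flat_mxE !mxE rotval_sum sum_mxtens exchange_big summxE.
apply: eq_bigr => k _; rewrite rotvalM mxE; apply: eq_bigr => l _.
by rewrite !flat_mxE.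
Qed.

Lemma flat_mxD m n (a b : 'M[rot]_(m, n)) : flat_mx (a + b) = flat_mx a + flat_mx b.
Proof. by apply/matrixP => i j; rewrite !mxE. Qed.

Lemma flat_mx0 m n : flat_mx (0 : 'M[rot]_(m, n)) = 0.
Proof. by apply/matrixP => i j; rewrite !mxE. Qed.

Lemma flat_mx_sum m n (I : Type) (r : seq I) (P : pred I) (F : I -> 'M[rot]_(m, n)) :
  flat_mx (\sum_(i <- r | P i) F i) = \sum_(i <- r | P i) flat_mx (F i).
Proof. exact: (big_morph _ (@flat_mxD m n) (flat_mx0 m n)). Qed.

Lemma flat_mx1 n : flat_mx (1%:M : 'M[rot]_n) = 1%:M.
Proof.
apply/matrixP => i j; case: (mxtens_indexP i) => i1 i2; case: (mxtens_indexP j) => j1 j2.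
rewrite flat_mxE !mxE (inj_eq (can_inj (@mxtens_indexK _ _))) xpair_eqE /= andbC.
by case: (i2 == j2) => /=; rewrite ?rotval0 ?rotval1 !mxE.
Qed.

Lemma flat_mxS m n (a : 'M[rot]_(m, n)) : flat_mx (adjmx star a) = adjmx star (flat_mx a).
Proof. by apply/matrixP => i j; rewrite !mxE. Qed.

Lemma flat_mx_gamma z m n (a : 'M[rot]_(m, n)) :
  flat_mx (map_mx (rot_gamma z) a) = map_mx (beta_act z) (flat_mx a).
Proof. by apply/matrixP => i j; rewrite !mxE. Qed.

(** This composition of [xi] and [iota] is a sum of rotations by the [N]-th roots of unity, which
    are also the rational angles of [nu]. *)
Lemma flat_mx_xi m (a : 'M[CS1]_m) :
  flat_mx (map_mx (rot_xi N) a) =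
  block_diag (fun h : 'I_N => map_mx (translate (omega R N ^+ h)%g) a).
Proof.
by apply/matrixP => i j; rewrite !mxE /mxtens_unindex; case: eqP => // _; rewrite mxE.
Qed.

Local Notation gam := (@rot_gamma R N).
Local Notation bet := (@beta_act R).

Lemma fixed_flat_mx m n (a : 'M[rot]_(m, n)) : fixed_mx gam a -> fixed_mx bet (flat_mx a).
Proof. by move=> fa z; rewrite -flat_mx_gamma fa. Qed.

Section Functor.
Variable X : Type.

Lemma subrep_flat m n (rho : X -> 'M[rot]_m) (sig : X -> 'M[rot]_n) :
  subrep gam rho sig ->
  subrep bet (fun x => flat_mx (rho x)) (fun x => flat_mx (sig x)).
Proof.
move=> [V [VV Vf VE]]; exists (flat_mx V); split.
- by rewrite -flat_mxS -flat_mxM VV flat_mx1.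
- exact: fixed_flat_mx.
- by move=> x; rewrite -!flat_mxM VE.
Qed.

Lemma splits_flat (I : finType) m n (rho : X -> 'M[rot]_m) (r : I -> X -> 'M[rot]_n) :
  splits gam rho r -> splits bet (fun x => flat_mx (rho x)) (fun i x => flat_mx (r i x)).
Proof.
move=> [J [Jd Jf JE] Js]; exists (fun i => flat_mx (J i)).
  split=> [i j|i|i x].
  - rewrite -flat_mxS -flat_mxM Jd; case: eqP => _; first exact: flat_mx1.
    exact: flat_mx0.
  - exact: fixed_flat_mx.
  - by rewrite -!flat_mxM JE.
rewrite -flat_mx1 -Js flat_mx_sum; apply: eq_bigr => i _.
by rewrite flat_mxM flat_mxS.
Qed.

(** [flat_mx] interleaves the two diagonal blocks, so the flattened block inclusions take the place
    of the standard ones. *)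
Lemma subrep_flat_block m1 m2 n1 n2 (rho1 : X -> 'M[rot]_m1) (rho2 : X -> 'M[rot]_m2)
    (sig1 : X -> 'M[CS1]_n1) (sig2 : X -> 'M[CS1]_n2) :
  subrep bet (fun x => flat_mx (rho1 x)) sig1 ->
  subrep bet (fun x => flat_mx (rho2 x)) sig2 ->
  subrep bet (fun x => flat_mx (block_mx (rho1 x) 0 0 (rho2 x)))
             (fun x => block_mx (sig1 x) 0 0 (sig2 x)).
Proof.
have [J11 J22 J12 Js] := @block_inclusions _ rot m1 m2.
have [f1 f2] := fixed_block_inclusions rot_gamma_hom m1 m2.
have E x := block_inclusionsE (rho1 x) (rho2 x).
apply: (subrep_block_sum beta_act_hom (J1 := flat_mx (col_mx 1%:M 0))
  (J2 := flat_mx (col_mx 0 1%:M))).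
- by rewrite -flat_mxS -flat_mxM J11 flat_mx1.
- by rewrite -flat_mxS -flat_mxM J22 flat_mx1.
- by rewrite -flat_mxS -flat_mxM J12 flat_mx0.
- by rewrite -!flat_mxS -!flat_mxM -flat_mxD Js flat_mx1.
- exact: fixed_flat_mx.
- exact: fixed_flat_mx.
- by move=> x; rewrite -!flat_mxM; have [-> _] := E x.
- by move=> x; rewrite -!flat_mxM; have [_ ->] := E x.
Qed.

End Functor.

Lemma ordS_inj (n : nat) : injective (@ordS n).
Proof. exact: can_inj (@ordSK n). Qed.

Lemma val_iter_ordS k (i : 'I_N) : val (iter k (@ordS N) i) = ((i + k) %% N)%N.
Proof.
elim: k => [|k IHk]; first by rewrite addn0 modn_small.
by rewrite /= IHk addnS -addn1 modnDml addn1.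
Qed.

Lemma iter_ordSC (i j : 'I_N) : iter i (@ordS N) j = iter j (@ordS N) i.
Proof. by apply: val_inj; rewrite !val_iter_ordS addnC. Qed.

Lemma rot_shift_conj (a : 'M[R[i]]_N) i j :
  (rot_shift R N *m a *m adjmx conjc (rot_shift R N)) i j = a (ordS i) (ordS j).
Proof.
rewrite mxE (bigD1 (ordS j)) //= [X in _ + X]big1 ?addr0.
- rewrite !mxE eqxx (rmorph1 conjc) mulr1 (bigD1 (ordS i)) //= big1 ?addr0.
  + by rewrite mxE eqxx mul1r.
  + by move=> k /negbTE ki; rewrite mxE ki mul0r.
- move=> k /negbTE kj; rewrite [adjmx _ _ _ _]mxE !mxE kj.
  by rewrite (rmorph0 conjc) mulr0.
Qed.

(** The defining relation of the rotation algebra, iterated: conjugation by the permutation unitary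
    shifts both indices. *)
Lemma rotval_omega (f : rot) k z i j :
  rotval f i j (omega R N ^+ k * z)%g =
  rotval f (iter k (@ordS N) i) (iter k (@ordS N) j) z.
Proof.
elim: k i j z => [|k IHk] i j z; first by rewrite expg0 mul1g.
rewrite expgS -mulgA.
have /set_mem/(_ (omega R N ^+ k * z)%g)/matrixP/(_ i j) := rotvalP f.
by rewrite mxE rot_shift_conj mxE => ->; rewrite IHk -!iterSr !iterS.
Qed.

Lemma translate_rotval (f : rot) k i j :
  translate (omega R N ^+ k)%g (rotval f i j) =
  rotval f (iter k (@ordS N) i) (iter k (@ordS N) j).
Proof. by apply/cfunP => z; rewrite -rotval_omega. Qed.

Definition shift_mx (h : nat) : 'M[CS1]_N := \matrix_(i, j) (j == iter h (@ordS N) i)%:R.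

Lemma iter_ordS_inj h : injective (iter h (@ordS N)).
Proof. by elim: h => [|h IHh] x y //= /ordS_inj /IHh. Qed.

(** A constant function lies in the rotation algebra when its value commutes with the permutation
    unitary, as its powers do. *)
Lemma shift_mx_proof h : shift_mx h \in @rot_equivariant R N.
Proof.
apply/mem_set => z; apply/matrixP => i j; rewrite rot_shift_conj !mxE.
by rewrite -iterSr iterS (inj_eq (@ordS_inj _)); case: (_ == _).
Qed.

Definition rot_shift_pow h : rot := RotAlg (shift_mx_proof h).

Lemma rot_gamma_shift z h : rot_gamma z (rot_shift_pow h) = rot_shift_pow h.
Proof. by apply: rot_eq => i j w; rewrite /= !mxE; case: eqP. Qed.

Lemma rot_shift_pow_unitary h : star (rot_shift_pow h) * rot_shift_pow h = 1.
Proof.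
apply: rotval_inj; apply: mulmx1C; apply/matrixP => i j; rewrite !mxE.
rewrite (bigD1 (iter h (@ordS N) i)) //= big1 ?addr0 => [|k /negbTE ki]; last first.
  by rewrite !mxE ki mul0r.
rewrite !mxE eqxx mul1r (inj_eq (@iter_ordS_inj h)).
by case: (i == j); rewrite ?((star1 CS1), (star0 CS1)).
Qed.

(** With indices modulo [N], the entry [(i, j)] on the left is the entry [(i + h, j)] of [f]. On the
    right only [k = j - i] contributes, with the translate by [omega ^+ i] of the entry [(h, k)] of
    [f], which is its entry [(h + i, k + i)]. *)
Lemma rot_shift_pow_intertwines (f : rot) (h : 'I_N) :
  rot_shift_pow h * f = \sum_(k < N) rot_xi N (rotval f h k) * rot_shift_pow k.
Proof.
apply: rotval_inj; apply/matrixP => i j; rewrite rotval_sum summxE rotvalM mxE.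
rewrite (bigD1 (iter h (@ordS N) i)) //= [X in _ + X]big1 ?addr0; last first.
  by move=> k /negbTE ki; rewrite mxE ki mul0r.
(* [g j] is the index [j - i] modulo [N]. *)
have /injF_bij[g _ gK] := @iter_ordS_inj i.
rewrite mxE eqxx mul1r iter_ordSC -(gK j) -translate_rotval (bigD1 (g j)) //=.
rewrite [X in _ + X]big1 ?addr0 => [|k /negbTE kj].
  rewrite mxE (bigD1 i) //= [X in _ + X]big1 ?addr0; last first.
    by move=> k /negbTE ki; rewrite mxE eq_sym ki mul0r.
  by rewrite !mxE eqxx iter_ordSC eqxx mulr1.
rewrite mxE big1 // => l _; rewrite !mxE; case: eqP => [<-|_]; rewrite ?mul0r //.
by rewrite [iter k _ _]iter_ordSC (inj_eq (@iter_ordS_inj i)) eq_sym kj mulr0.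
Qed.

End RotationMaps.

(** * The rotation algebra inside the image of xi after iota *)

Section FlatXi.
Variables (R : realType) (N : nat) (X : Type).
Hypothesis N0 : (0 < N)%N.
Local Notation CS1 := (cfun R (circle R)).
Local Notation rot := (rotalg R N).

(* The row of [V] with index [h] is [s ^ h / sqrt N], with [s] the permutation
   unitary, and [s ^ h f = sum_k xi(f_hk) s ^ k] for [f] in the rotation algebra. *)
Let c : R[i] := (Num.sqrt (N%:R : R))^-1%:C%C.

Let V n : 'M[rot]_(N * n, n) := \matrix_(i, j)
  if (mxtens_unindex i).2 == j then cscale c (rot_shift_pow R N (mxtens_unindex i).1)
  else 0.

Let VE n i j : V n (mxtens_index i) j =
  if i.2 == j then cscale c (rot_shift_pow R N i.1) else 0.
Proof. by rewrite mxE mxtens_indexK. Qed.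

Lemma subrep_xi_flat n (rho : X -> 'M[rot]_n) :
  subrep (@rot_gamma R N) rho (fun x => map_mx (rot_xi N) (flat_mx (rho x))).
Proof.
exists (V n); split.
- apply/matrixP => i j; rewrite mxE sum_mxtens exchange_big (bigD1 i) //=.
  rewrite [X in _ + X]big1 ?addr0 => [|k /negbTE ki]; last first.
    by rewrite big1 // => l _; rewrite 2!mxE VE /= ki star0 mul0r.
  transitivity (\sum_(k < N) if i == j then cscale (c * c) (1 : rot) else 0).
    apply: eq_bigr => k _; rewrite 2!mxE !VE /= eqxx.
    case: eqP => _; rewrite ?mulr0 // starZ -cscaleAl -cscaleAr cscaleA.
    by rewrite rot_shift_pow_unitary conjc_real.
  rewrite mxE; case: (i == j); last by rewrite big1.
  rewrite sumr_const card_ord; rewrite -{1}[1 : rot]cscale1.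
  rewrite cscaleA mulr1 cscale_mulrn -[RHS]cscale1; congr cscale.
  rewrite -mulr_natl /c -rmorphM -(rmorph_nat (real_complex R)) -rmorphM.
  rewrite -invfM -expr2 sqr_sqrtr ?ler0n // mulfV ?rmorph1 //.
  by rewrite pnatr_eq0 -lt0n.
- move=> z; apply/matrixP => i j; rewrite !mxE; case: eqP => _.
    by rewrite (shZ (rot_gamma_hom N z)) rot_gamma_shift.
  exact: (sh0 (rot_gamma_hom N z)).
- move=> x; apply/matrixP => i j; case: (mxtens_indexP i) => h k.
  rewrite mxE (bigD1 k) //= VE eqxx /= big1 ?addr0 => [|l /negbTE lk]; last first.
    by rewrite VE /= eq_sym lk mul0r.
  rewrite mxE sum_mxtens exchange_big (bigD1 j) //= [X in _ + X]big1 ?addr0; last first.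
    by move=> l /negbTE lj; rewrite big1 // => l' _; rewrite VE /= lj mulr0.
  rewrite -cscaleAl rot_shift_pow_intertwines cscale_sumr.
  apply: eq_bigr => l _.
  by rewrite VE /= eqxx mxE flat_mxE cscaleAr.
Qed.

End FlatXi.

(** * Commuting isometries in the tower *)

Section Amplifications.
Variables (R : realType) (G : Type) (X : Type).
Variables (D : starAlgType R) (act : G -> D -> D).
Hypothesis hact : forall z, star_hom (act z).

Lemma ampl_id (E : pzRingType) k n (a : 'M[E]_n) : ampl id k a = block_diag (fun _ : 'I_k => a).
Proof. by rewrite /ampl map_mx_id. Qed.

Lemma ampl_map (E E' : pzRingType) (psi : E -> E') k n (a : 'M[E]_n) :
  psi 0 = 0 -> ampl psi k a = map_mx psi (ampl id k a).
Proof.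
move=> psi0; apply/matrixP => i j; rewrite !mxE /mxtens_unindex.
by case: eqP => _; rewrite ?psi0 // !mxE.
Qed.

Lemma has_copies_diag_const m k (a : X -> 'M[D]_m) :
  has_copies act (fun _ : 'I_k => a) (fun x => block_diag (fun _ : 'I_k => a x)).
Proof. by exists (@diag_incl _ _ k m); exact: (block_diag_copies hact). Qed.

Lemma splits_diag_const m k (a : X -> 'M[D]_m) :
  splits act (fun x => block_diag (fun _ : 'I_k => a x)) (fun _ : 'I_k => a).
Proof. exact: (block_diag_splits hact). Qed.

Lemma subrep_diag_le m k k' (a : X -> 'M[D]_m) : (k <= k')%N ->
  subrep act (fun x => block_diag (fun _ : 'I_k => a x))
             (fun x => block_diag (fun _ : 'I_k' => a x)).
Proof.
move=> kk'; apply: (splits_subrep hact (splits_diag_const k a)).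
apply: (has_copies_inj (g := widen_ord kk') (r := fun _ : 'I_k' => a)).
  by move=> i j /(congr1 val) /= e; apply: val_inj.
exact: has_copies_diag_const.
Qed.

Lemma subrep_diag_nth m k (F : 'I_k -> X -> 'M[D]_m) i :
  subrep act (F i) (fun x => block_diag (fun i => F i x)).
Proof.
apply: (copy_subrep (r := F)).
by exists (@diag_incl _ _ k m); exact: (block_diag_copies hact).
Qed.

Lemma has_copies_diag_pair m T k k' (a : X -> 'M[D]_m) : (T * k <= k')%N ->
  has_copies act (fun _ : 'I_T * 'I_k => a)
    (fun x => block_diag (fun _ : 'I_k' => a x)).
Proof.
move=> kk'.
apply: (has_copies_inj (g := fun ij => widen_ord kk' (mxtens_index ij))
  (r := fun _ : 'I_k' => a)); last exact: has_copies_diag_const.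
move=> i j /(congr1 val) /= e; apply: (can_inj (@mxtens_indexK _ _)).
exact: val_inj.
Qed.

End Amplifications.

Lemma block_diag_scalar (E : pzRingType) m k (c : E) :
  block_diag (fun _ : 'I_m => (c%:M : 'M[E]_k)) = c%:M.
Proof.
apply/matrixP => i j; case: (mxtens_indexP i) => i1 i2; case: (mxtens_indexP j) => j1 j2.
rewrite !mxE !mxtens_indexK (inj_eq (can_inj (@mxtens_indexK _ _))) xpair_eqE.
by case: eqP => _; rewrite ?mxE.
Qed.

Lemma block_diag0 (E : pzRingType) m k : block_diag (fun _ : 'I_m => (0 : 'M[E]_k)) = 0.
Proof. by apply/matrixP => i j; rewrite !mxE /mxtens_unindex; case: eqP; rewrite ?mxE. Qed.

Lemma block_mx0' (E : pzRingType) m n p q :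
  block_mx (0 : 'M[E]_(m, n)) 0 0 (0 : 'M[E]_(p, q)) = 0.
Proof. exact: block_mx_const. Qed.

Section TowerIntertwiners.
Variables (R : realType) (N : nat) (theta : R) (r00 r10 : nat).
Variables (l00 l01 l10 l11 : nat -> nat).
Local Notation S1 := (circle R).
Local Notation CS1 := (cfun R S1).
Local Notation rot := (rotalg R N).
Local Notation gam := (@rot_gamma R N).
Local Notation bet := (@beta_act R).
Local Notation stg := (stage R N r00 r10 l00 l01 l10 l11).
Local Notation nu := (@nu R N theta r00 r10 l00 l01 l10 l11 _).

Hypothesis N0 : (0 < N)%N.
Hypothesis h1000 : forall n, (l00 n <= l10 n)%N.
Hypothesis h1101 : forall n, (l01 n <= l11 n)%N.

Let hgam := @rot_gamma_hom R N.
Let hbet := @beta_act_hom R.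

Lemma nu1E n (a : stg n) : (nu a).1 =
  block_mx (block_diag (fun _ : 'I_(l00 n) => a.1)) 0
           0 (map_mx (rot_xi N) (block_diag (fun _ : 'I_(l01 n) => a.2))).
Proof.
by rewrite /Defs.nu /= ampl_id ampl_map ?ampl_id //; exact: (sh0 (rot_xi_hom R N)).
Qed.

Lemma beta_tilde_hom lam : star_hom (@beta_tilde R lam).
Proof. exact: beta_act_hom. Qed.

Definition rot_blocks n k (a : 'M[CS1]_k) :=
  block_diag (fun j : 'I_(2 * N) =>
    map_mx (beta_tilde (angle N theta j)) (block_diag (fun _ : 'I_(l11 n) => a))).

Lemma nu2E n (a : stg n) : (nu a).2 =
  block_mx (flat_mx (block_diag (fun _ : 'I_(l10 n) => a.1))) 0 0 (rot_blocks n a.2).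
Proof.
have i0 : @rot_iota R N 0 = 0 by [].
rewrite /Defs.nu /= (ampl_map _ _ i0) flatten_mx_iota ampl_id; congr block_mx.
rewrite /rot_blocks; congr block_diag; apply: funext => j.
by rewrite ampl_map ?ampl_id //; exact: (sh0 (beta_tilde_hom _)).
Qed.

Lemma beta_tilde0 (f : CS1) : beta_tilde (angle N theta 0) f = f.
Proof.
apply/cfunP => z; rewrite /angle N0 mul0r; congr (f _); apply: val_inj => /=.
by rewrite mulr0 cos0 sin0 -[Complex 1 0]/(1 : R[i]) invr1 mul1r.
Qed.

(* [beta_(- h / N)] is translation by [omega ^ h]; the index is [- h] modulo [N]. *)
Lemma beta_tilde_omega (h : 'I_N) (f : CS1) :
  beta_tilde (angle N theta ((N - h) %% N)) f = translate (omega R N ^+ h)%g f.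
Proof.
apply/cfunP => z; rewrite /angle ltn_mod N0.
rewrite /beta_tilde /beta_act /Lt /=; congr (f (_ * z)%g).
have e : exp2pi (((N - h) %% N)%:R / N%:R : R) = (omega R N ^+ ((N - h) %% N))%g.
  by rewrite /omega exp2pi_nat mulr_natl.
rewrite e; apply: (mulgI (omega R N ^+ ((N - h) %% N))%g).
rewrite mulgV -expgnDr.
have /dvdnP[k ->] : (N %| (N - h) %% N + h)%N.
  by rewrite /dvdn modnDml subnK ?modnn // ltnW.
by rewrite mulnC expgnA /omega exp2pi_nat -[_ *+ N]mulr_natl mulfV ?exp2pi1 ?expg1n
  // pnatr_eq0 -lt0n.
Qed.

Lemma stage_mulE n (a b : stg n) : a * b = (a.1 *m b.1, a.2 *m b.2).
Proof. by []. Qed.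

Lemma stage_mul_pair n x y (b : stg n) : (x, y) * b = (x *m b.1, y *m b.2).
Proof. by []. Qed.

Lemma stage_pair_mul n x y (b : stg n) : b * (x, y) = (b.1 *m x, b.2 *m y).
Proof. by []. Qed.

Lemma stage_starE n (a : stg n) : star a = (adjmx star a.1, adjmx star a.2).
Proof. by []. Qed.

Lemma rot_blocks0 n k : rot_blocks n (0 : 'M[CS1]_k) = 0.
Proof.
apply/matrixP => i j; rewrite !mxE /mxtens_unindex; case: eqP => // _.
by rewrite block_diag0 (map_mx_sh0 (beta_tilde_hom _)) mxE.
Qed.

Lemma rot_blocks1 n k : rot_blocks n (1%:M : 'M[CS1]_k) = 1%:M.
Proof.
rewrite /rot_blocks -[RHS]block_diag_scalar; congr block_diag; apply: funext => j.
by rewrite block_diag_scalar (map_mx_sh1 (beta_tilde_hom _)).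
Qed.

Section Steps.
Variable X : Type.

(** Among the [2 * N] blocks only those with rational angle are used; the block of translation by
    [omega ^+ h] has index [- h] modulo [N], and distinct [h] give distinct indices. *)
Lemma has_copies_rot_blocks n k (a : X -> 'M[CS1]_k) :
  has_copies bet (fun (h : 'I_N) x =>
      map_mx (translate (omega R N ^+ h)%g) (block_diag (fun _ : 'I_(l11 n) => a x)))
    (fun x => rot_blocks n (a x)).
Proof.
have N2 (h : 'I_N) : ((N - h) %% N < 2 * N)%N.
  by apply: (@leq_trans N); rewrite ?ltn_mod // leq_pmull.
pose g (h : 'I_N) : 'I_(2 * N) := Ordinal (N2 h).
pose r (j : 'I_(2 * N)) x := map_mx (beta_tilde (angle N theta j))
  (block_diag (fun _ : 'I_(l11 n) => a x)).
have -> : (fun (h : 'I_N) x =>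
    map_mx (translate (omega R N ^+ h)%g) (block_diag (fun _ : 'I_(l11 n) => a x)))
    = fun h => r (g h).
  apply: funext => h; apply: funext => x; apply: eq_map_mx => f.
  by rewrite beta_tilde_omega.
apply: has_copies_inj; last first.
  by exists (@diag_incl _ _ (2 * N) (l11 n * k)); exact: (block_diag_copies hbet).
move=> h h' /(congr1 val) /= e; apply: ord_inj.
have lt i : (0 < i)%N -> (i <= N)%N -> (N - i < N)%N by move=> i0 iN; lia.
have [h0|h0] := posnP h; have [h0'|h0'] := posnP h'.
- by rewrite h0 h0'.
- by move: e; rewrite h0 subn0 modnn modn_small; [have := ltn_ord h'; lia | lia].
- by move: e; rewrite h0' subn0 modnn modn_small; [have := ltn_ord h; lia | lia].
- move: e; rewrite !modn_small; [|lia|lia].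
  by have := ltn_ord h; have := ltn_ord h'; lia.
Qed.

Lemma subrep_rot_blocks n k (a : X -> 'M[CS1]_k) :
  subrep bet (fun x => block_diag (fun _ : 'I_(l11 n) => a x))
             (fun x => rot_blocks n (a x)).
Proof.
have N2 : (0 < 2 * N)%N by rewrite muln_gt0.
have -> : (fun x => block_diag (fun _ : 'I_(l11 n) => a x)) =
    (fun x => map_mx (beta_tilde (angle N theta (Ordinal N2)))
      (block_diag (fun _ : 'I_(l11 n) => a x))).
  by apply: funext => x; apply/matrixP => i j; rewrite [RHS]mxE beta_tilde0.
exact: (subrep_diag_nth hbet (fun (j : 'I_(2 * N)) x =>
  map_mx (beta_tilde (angle N theta j)) (block_diag (fun _ : 'I_(l11 n) => a x)))).
Qed.

Variable n : nat.
Variable a : X -> stg n.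

(** Blockwise: the rotation block embeds through [xi] after [iota], with [l00 <= l10], and the
    circle block through the [l11 >= l01] copies of angle 0. *)
Lemma subrep_nu12 : subrep gam (fun x => (nu (a x)).1)
  (fun x => map_mx (rot_xi N) (nu (a x)).2).
Proof.
have -> : (fun x => map_mx (rot_xi N) (nu (a x)).2) = fun x =>
    block_mx (map_mx (rot_xi N) (flat_mx (block_diag (fun _ : 'I_(l10 n) => (a x).1))))
      0 0 (map_mx (rot_xi N) (rot_blocks n (a x).2)).
  by apply: funext => x; rewrite nu2E map_block_mx !(map_mx_sh0 (rot_xi_hom R N)).
have -> : (fun x => (nu (a x)).1) = fun x =>
    block_mx (block_diag (fun _ : 'I_(l00 n) => (a x).1)) 0
           0 (map_mx (rot_xi N) (block_diag (fun _ : 'I_(l01 n) => (a x).2))).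
  by apply: funext => x; rewrite nu1E.
apply: (subrep_block hgam).
  apply: (subrep_trans hgam); last exact: subrep_xi_flat.
  exact: subrep_diag_le.
apply: (subrep_map (rot_xi_hom R N)); first by move=> z d; rewrite rot_gamma_xi.
apply: (subrep_trans hbet _ (subrep_rot_blocks n (fun x => (a x).2))).
exact: (subrep_diag_le hbet).
Qed.

(** The rotation block compares by [l00 <= l10]. The flattened [xi] block is a sum of translations
    by the powers of [omega], each found among the blocks of rational angle, with multiplicity
    [l11 >= l01]. *)
Lemma subrep_flat_nu1 : subrep bet (fun x => flat_mx (nu (a x)).1) (fun x => (nu (a x)).2).
Proof.
have -> : (fun x => (nu (a x)).2) = fun x =>
  block_mx (flat_mx (block_diag (fun _ : 'I_(l10 n) => (a x).1))) 0 0
    (rot_blocks n (a x).2).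
  by apply: funext => x; rewrite nu2E.
have -> : (fun x => flat_mx (nu (a x)).1) = fun x =>
    flat_mx (block_mx (block_diag (fun _ : 'I_(l00 n) => (a x).1)) 0
           0 (map_mx (rot_xi N) (block_diag (fun _ : 'I_(l01 n) => (a x).2)))).
  by apply: funext => x; rewrite nu1E.
apply: subrep_flat_block.
  by apply: subrep_flat; apply: (subrep_diag_le hgam).
have -> : (fun x => flat_mx (map_mx (rot_xi N)
    (block_diag (fun _ : 'I_(l01 n) => (a x).2)))) = fun x =>
    block_diag (fun h : 'I_N => map_mx (translate (omega R N ^+ h)%g)
      (block_diag (fun _ : 'I_(l01 n) => (a x).2))).
  by apply: funext => x; rewrite flat_mx_xi.
apply: (splits_subrep hbet (block_diag_splits hbet (fun (h : 'I_N) x =>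
  map_mx (translate (omega R N ^+ h)%g) (block_diag (fun _ : 'I_(l01 n) => (a x).2))))).
apply: (has_copies_trans hbet); last exact: (has_copies_rot_blocks n (fun x => (a x).2)).
move=> h /=; apply: (subrep_map (act := bet) (translate_hom _)).
  move=> z f; apply/cfunP => w; set v := (omega R N ^+ h)%g.
  change (f (z^-1 * (v * w))%g = f (v * (z^-1 * w))%g); rewrite !mulgA.
  by congr (f (_ * w)%g); exact: circle_mulC.
exact: (subrep_diag_le hbet).
Qed.

End Steps.

Section Main.
Variables (n T : nat).
Hypothesis T0 : (T * l00 n.+1 <= l01 n.+1)%N.
Hypothesis T1 : (T * l10 n.+1 <= l11 n.+1)%N.

(** Each of the [T * l00] copies of [(nu a).1] to be placed is contained in [xi] of [(nu a).2], of
    which there are [l01] copies on the right. *)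
Lemma has_copies_nunu1 : has_copies gam
  (fun (_ : 'I_T) (a : stg n) => block_diag (fun _ : 'I_(l00 n.+1) => (nu a).1))
  (fun a => map_mx (rot_xi N) (block_diag (fun _ : 'I_(l01 n.+1) => (nu a).2))).
Proof.
apply: (has_copies_group hgam (rr := fun _ (_ : 'I_(l00 n.+1)) a => (nu a).1)); last first.
  by move=> t; exact: (splits_diag_const hgam).
have -> : (fun a : stg n =>
    map_mx (rot_xi N) (block_diag (fun _ : 'I_(l01 n.+1) => (nu a).2))) = fun a =>
    block_diag (fun _ : 'I_(l01 n.+1) => map_mx (rot_xi N) (nu a).2).
  apply: funext => a; rewrite -!ampl_id -ampl_map ?ampl_id //.
  exact: (sh0 (rot_xi_hom R N)).
apply: (has_copies_trans hgam); last exact: has_copies_diag_pair.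
by move=> t; exact: (subrep_nu12 id).
Qed.

(** The [l11] copies in the block of angle 0 provide [T * l10] copies of [(nu a).2], each containing
    one of [flat_mx (nu a).1]. *)
Lemma has_copies_nunu2 : has_copies bet
  (fun (_ : 'I_T) (a : stg n) => flat_mx (block_diag (fun _ : 'I_(l10 n.+1) => (nu a).1)))
  (fun a => rot_blocks n.+1 (nu a).2).
Proof.
apply: (has_copies_group hbet (rr := fun _ (_ : 'I_(l10 n.+1)) a => flat_mx (nu a).1)); last first.
  by move=> t; apply: splits_flat; exact: (splits_diag_const hgam).
apply: (has_copies_trans hbet); first by move=> t; exact: (subrep_flat_nu1 id).
apply: (has_copies_sub hbet); last exact: subrep_rot_blocks.
exact: has_copies_diag_pair.
Qed.

(** In both summands the upper left block of [nu (nu a)] comes from the rotation summand of [nu a]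
    and the lower right one from its circle summand. Intertwiners from the first block to the
    second, placed in the lower left corner, therefore commute with [nu (nu a)]. *)
Lemma commuting_isometries : exists s : 'I_T -> stg n.+2,
  [/\ forall t u, star (s t) * s u = if t == u then nu (1, 0) else 0,
      forall t z, stage_act z (s t) = s t,
      forall t (a : stg n), s t * nu (nu a) = nu (nu a) * s t &
      forall t, nu (0, 1) * s t = s t].
Proof.
have [K [Kd Kf KE]] := has_copies_nunu1.
have [L [Ld Lf LE]] := has_copies_nunu2.
exists (fun t => (block_mx 0 0 (K t) 0, block_mx 0 0 (L t) 0)); split.
- move=> t u; rewrite stage_mulE stage_starE /=.
  rewrite !adj_block_mx !adjmx0 !mulmx_block !mul0mx !mulmx0 !addr0.
  rewrite !add0r Kd Ld; case: (t == u); last by rewrite !block_mx0'.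
  rewrite [RHS]surjective_pairing nu1E nu2E /=.
  by rewrite rot_blocks0 block_diag0 !block_diag_scalar flat_mx1
    (map_mx_sh0 (rot_xi_hom R N)).
- move=> t z; rewrite /stage_act /= !map_block_mx !(map_mx_sh0 (hgam z)).
  by rewrite !(map_mx_sh0 (hbet z)) Kf Lf.
- move=> t a; rewrite stage_mul_pair stage_pair_mul nu1E [(nu (nu a)).2]nu2E.
  rewrite !mulmx_block !mul0mx !mulmx0 !addr0 !add0r.
  by rewrite KE LE.
- move=> t; rewrite stage_pair_mul nu1E nu2E /=.
  rewrite !mulmx_block !mul0mx !mulmx0 !addr0 !add0r rot_blocks1 block_diag_scalar.
  by rewrite (map_mx_sh1 (rot_xi_hom R N)) !mul1mx.
Qed.

End Main.

End TowerIntertwiners.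

(** * Pointwise operator bounds *)

Lemma scalar_mx11_inj (E : pzRingType) : injective (@scalar_mx E 1).
Proof. by move=> a b /matrixP/(_ 0 0); rewrite !mxE. Qed.

Section ComplexStar.
Variable R : realType.

Let cscaleDrC (c : R[i]) : {morph *%R c : x y / x + y}. Proof. exact: mulrDr. Qed.
Let starMC (x y : R[i]) : conjc (x * y) = conjc y * conjc x.
Proof. by rewrite mulrC (rmorphM conjc). Qed.
Let starZC (c x : R[i]) : conjc (c * x) = conjc c * conjc x.
Proof. exact: (rmorphM conjc). Qed.
Let cscaleDlC (b c x : R[i]) : (b + c) * x = b * x + c * x. Proof. exact: mulrDl. Qed.
Let cscaleAC (b c x : R[i]) : b * (c * x) = (b * c) * x. Proof. exact: mulrA. Qed.
Let cscaleAlC (c x y : R[i]) : c * (x * y) = (c * x) * y. Proof. exact: mulrA. Qed.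
Let cscaleArC (c x y : R[i]) : c * (x * y) = x * (c * y). Proof. exact: mulrCA. Qed.

(** With this structure on the scalars, evaluation at a point is a [star_hom], and the matrix
    identities for such maps apply to it. *)
HB.instance Definition _ := isStarAlgebra.Build R R[i]
  (rmorphD conjc) starMC (@conjcK R) starZC cscaleDrC cscaleDlC cscaleAC (@mul1r _)
  cscaleAlC cscaleArC.

Lemma cfun_eval_hom (X : topologicalType) (x : X) :
  star_hom ((fun f : cfun R X => f x) : cfun R X -> R[i]).
Proof. by []. Qed.

Definition nsq n (x : 'cV[R[i]]_n) : R := \sum_i normc (x i 0) ^+ 2.

Lemma normc_ge0 (x : R[i]) : 0 <= normc x.
Proof. by case: x => a b; apply: sqrtr_ge0. Qed.

Lemma nsqE n (x : 'cV[R[i]]_n) : adjmx star x *m x = ((nsq x)%:C)%C%:M.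
Proof.
apply/matrixP => i j; rewrite !ord1 !mxE eqxx mulr1n /nsq (rmorph_sum (real_complex R)).
apply: eq_bigr => k _; rewrite !mxE mulrC -[LHS]sqr_normc.
by rewrite (rmorphXn (real_complex R)).
Qed.

Lemma nsq_ge0 n (x : 'cV[R[i]]_n) : 0 <= nsq x.
Proof. by apply: sumr_ge0 => i _; apply: exprn_ge0; apply: normc_ge0. Qed.

Lemma nsq_isometry m n (V : 'M[R[i]]_(m, n)) (x : 'cV_n) :
  adjmx star V *m V = 1%:M -> nsq (V *m x) = nsq x.
Proof.
move=> VV; apply: (@complexI R); apply: scalar_mx11_inj.
by rewrite -!nsqE adjmxM mulmxA -[_ *m _ *m V]mulmxA VV mulmx1.
Qed.

Lemma nsq_col_mx m n (x : 'cV[R[i]]_m) (y : 'cV_n) : nsq (col_mx x y) = nsq x + nsq y.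
Proof.
rewrite /nsq big_split_ord /=.
by congr (_ + _); apply: eq_bigr => i _; rewrite ?col_mxEu ?col_mxEd.
Qed.

Lemma nsqZ n c (x : 'cV[R[i]]_n) : nsq (c *: x) = normc c ^+ 2 * nsq x.
Proof.
rewrite /nsq mulr_sumr; apply: eq_bigr => i _.
by rewrite mxE ComplexField.Normc.normcM exprMn.
Qed.

Lemma nsq0 n : nsq (0 : 'cV[R[i]]_n) = 0.
Proof. by rewrite /nsq big1 // => i _; rewrite mxE ComplexField.Normc.normc0 expr0n. Qed.

Lemma nsq_eq0 n (x : 'cV[R[i]]_n) : nsq x = 0 -> x = 0.
Proof.
move=> x0; apply/matrixP => i j; rewrite ord1 mxE.
apply: ComplexField.Normc.eq0_normc; apply/eqP; rewrite -sqrf_eq0; apply/eqP.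
by apply: (psumr_eq0P (fun k _ => exprn_ge0 2 (normc_ge0 (x k 0))) x0).
Qed.

End ComplexStar.

Section PointwiseBound.
Variable R : realType.
Local Notation S1 := (circle R).
Local Notation CS1 := (cfun R S1).

Definition eval_mx (z : S1) m n (a : 'M[CS1]_(m, n)) : 'M[R[i]]_(m, n) :=
  map_mx (fun f : CS1 => f z : R[i]) a.

Let ev := @cfun_eval_hom R S1.

(* [|a(z)| <= C] as operators on [C^n], for every [z]. *)
Definition mx_bounded n (a : 'M[CS1]_n) (C : R) : Prop :=
  forall z x, nsq (eval_mx z a *m x) <= C ^+ 2 * nsq x.

Lemma eval_mxM z m n p (a : 'M[CS1]_(m, n)) (b : 'M[CS1]_(n, p)) :
  eval_mx z (a *m b) = eval_mx z a *m eval_mx z b.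
Proof. exact: (map_mx_shM (ev z)). Qed.

Lemma eval_mxS z m n (a : 'M[CS1]_(m, n)) :
  eval_mx z (adjmx star a) = adjmx star (eval_mx z a).
Proof. exact: (map_mx_shS (ev z)). Qed.

Lemma eval_mx1 z n : eval_mx z (1%:M : 'M[CS1]_n) = 1%:M.
Proof. exact: (map_mx_sh1 (ev z)). Qed.

Lemma eval_mx_isometry z m n (V : 'M[CS1]_(m, n)) :
  adjmx star V *m V = 1%:M -> adjmx star (eval_mx z V) *m eval_mx z V = 1%:M.
Proof. by move=> VV; rewrite -eval_mxS -eval_mxM VV eval_mx1. Qed.

(** The vector [rho v] has the norm of [V (rho v) = sig (V v)], and [V v] has the norm of [v]. *)
Lemma mx_bounded_subrep (X : Type) m n (rho : X -> 'M[CS1]_m) (sig : X -> 'M[CS1]_n) x C :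
  subrep (@beta_act R) rho sig -> mx_bounded (sig x) C -> mx_bounded (rho x) C.
Proof.
move=> [V [VV _ VE]] bs z v; have VVz := eval_mx_isometry z VV.
rewrite -(nsq_isometry _ VVz) mulmxA -eval_mxM VE eval_mxM -mulmxA.
by apply: le_trans (bs _ _) _; rewrite nsq_isometry.
Qed.

Lemma mx_bounded_splits (X : Type) (I : finType) m n (rho : X -> 'M[CS1]_m)
    (r : I -> X -> 'M[CS1]_n) x C :
  splits (@beta_act R) rho r -> (forall i, mx_bounded (r i x) C) ->
  mx_bounded (rho x) C.
Proof.
move=> [J [Jd _ JE] Js] br z v.
(* Parseval's identity, from the completeness of the family [J]. *)
have JsE w : nsq w = \sum_i nsq (adjmx star (eval_mx z (J i)) *m w).
  apply: (@complexI R); apply: scalar_mx11_inj.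
  rewrite -nsqE -[X in X *m w]mulmx1 -(eval_mx1 z) -Js.
  rewrite /eval_mx (map_mx_sh_sum (ev z)) mulmx_sumr mulmx_suml.
  rewrite (rmorph_sum (real_complex R)) (raddf_sum (@scalar_mx _ 1)).
  apply: eq_bigr => i _; rewrite -[RHS]nsqE adjmxM adjmxK.
  by rewrite -[map_mx _ (J i *m _)]/(eval_mx z _) eval_mxM eval_mxS !mulmxA.
(* Insert the sum of the [J j] times their adjoints on the right: orthogonality leaves the term
   [j = i]. *)
have JE' i : adjmx star (J i) *m rho x = r i x *m adjmx star (J i).
  rewrite -[LHS]mulmx1 -Js mulmx_sumr (bigD1 i) //= big1 ?addr0.
    by rewrite !mulmxA -[_ *m rho x *m _]mulmxA -JE mulmxA Jd eqxx mul1mx.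
  move=> j /negbTE ji; rewrite !mulmxA -[_ *m rho x *m _]mulmxA -JE mulmxA Jd.
  by rewrite eq_sym ji !mul0mx.
rewrite (JsE v) (JsE (_ *m v)) mulr_sumr; apply: ler_sum => i _.
rewrite mulmxA -eval_mxS -eval_mxM JE' eval_mxM -mulmxA; exact: br.
Qed.

Lemma mx_bounded_block m n (a : 'M[CS1]_m) (b : 'M[CS1]_n) C :
  mx_bounded a C -> mx_bounded b C -> mx_bounded (block_mx a 0 0 b) C.
Proof.
move=> ba bb z x; rewrite -[x]vsubmxK /eval_mx map_block_mx !(map_mx_sh0 (ev z)).
rewrite mul_block_col !mul0mx addr0 add0r !nsq_col_mx mulrDr.
by apply: lerD; [apply: ba | apply: bb].
Qed.

Lemma mx_bounded_diag m k (F : 'I_m -> 'M[CS1]_k) C :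
  (forall i, mx_bounded (F i) C) -> mx_bounded (block_diag F) C.
Proof.
move=> bF; have sF := block_diag_splits (@beta_act_hom R) (fun i (_ : unit) => F i).
exact: (mx_bounded_splits (x := tt) sF bF).
Qed.

Lemma mx_bounded_translate n (a : 'M[CS1]_n) (w : S1) C :
  mx_bounded a C -> mx_bounded (map_mx (translate w) a) C.
Proof.
move=> ba z x; have -> : eval_mx z (map_mx (translate w) a) = eval_mx (w * z)%g a.
  by apply/matrixP => i j; rewrite !mxE.
exact: ba.
Qed.

Lemma mx_bounded_scalar n (f : CS1) C : (forall z, normc (f z) <= C) ->
  mx_bounded (f%:M : 'M[CS1]_n) C.
Proof.
move=> fC z x; rewrite /eval_mx (map_mx_sh_scalar (ev z)) mul_scalar_mx nsqZ.
by rewrite ler_wpM2r ?nsq_ge0 // lerXn2r ?nnegrE ?normc_ge0 // (le_trans (normc_ge0 _) (fC z)).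
Qed.

Lemma colnormE n (x : 'cV[R[i]]_n) :
  Num.sqrt (normc ((adjmx conjc x *m x) 0 0)) = Num.sqrt (nsq x).
Proof.
by rewrite -[adjmx conjc x *m x]/(adjmx star x *m x) nsqE mxE mulr1n normc_real ?nsq_ge0.
Qed.

Lemma op_norm_le n (a : 'M[R[i]]_n) C : 0 <= C ->
  (forall x, nsq (a *m x) <= C ^+ 2 * nsq x) -> op_norm conjc (@normc R) a <= C.
Proof.
move=> C0 ba; rewrite /op_norm /=; apply: ge_sup.
  by eexists; exists 0 => //=; rewrite colnormE nsq0 sqrtr0 ler01.
move=> _ [x /= x1 <-]; move: x1; rewrite !colnormE => x1.
rewrite -[C]ger0_norm // -sqrtr_sqr ler_sqrt ?exprn_ge0 //.
apply: le_trans (ba x) _; rewrite ler_piMr ?exprn_ge0 //.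
by rewrite -[nsq x]sqr_sqrtr ?nsq_ge0 // exprn_ile1 ?sqrtr_ge0.
Qed.

Lemma cfun_mx_norm_le n (a : 'M[CS1]_n) C : 0 <= C -> mx_bounded a C -> cfun_mx_norm a <= C.
Proof.
move=> C0 ba; apply: ge_sup.
  by eexists; exists (1%g : S1).
by move=> _ [z _ <-]; apply: op_norm_le => // x; apply: ba.
Qed.

(** The a priori bound [K] ensures that the supremum defining the operator norm is a genuine upper
    bound. *)
Lemma le_op_norm n (a : 'M[R[i]]_n) K x : 0 <= K ->
  (forall x, nsq (a *m x) <= K ^+ 2 * nsq x) ->
  nsq (a *m x) <= op_norm conjc (@normc R) a ^+ 2 * nsq x.
Proof.
move=> K0 ba; have [x0|/eqP x0] := eqVneq (nsq x) 0.
  by rewrite (nsq_eq0 x0) mulmx0 nsq0 mulr0.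
have xp : 0 < nsq x by rewrite lt_neqAle nsq_ge0 eq_sym andbT; apply/eqP.
set c : R[i] := (Num.sqrt (nsq x))^-1%:C%C.
have nc : normc c ^+ 2 = (nsq x)^-1.
  by rewrite normc_real ?invr_ge0 ?sqrtr_ge0 // exprVn sqr_sqrtr ?nsq_ge0.
have e1 : nsq (c *: x) = 1 by rewrite nsqZ nc mulVf //; apply/eqP.
have : Num.sqrt (nsq (a *m (c *: x))) <= op_norm conjc (@normc R) a.
  apply: ub_le_sup; last first.
    by exists (c *: x); rewrite /= ?colnormE ?e1 ?sqrtr1.
  exists K => _ [y /= y1 <-]; move: y1; rewrite !colnormE => y1.
  rewrite -[K]ger0_norm // -sqrtr_sqr ler_sqrt ?exprn_ge0 //.
  apply: le_trans (ba y) _; rewrite ler_piMr ?exprn_ge0 //.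
  by rewrite -[nsq y]sqr_sqrtr ?nsq_ge0 // exprn_ile1 ?sqrtr_ge0.
move=> le; rewrite -ler_pdivrMr // mulrC -nc -nsqZ scalemxAr.
by rewrite -[nsq _]sqr_sqrtr ?nsq_ge0 // lerXn2r ?nnegrE ?sqrtr_ge0 ?op_norm_ge0.
Qed.

End PointwiseBound.

(** * Continuity of complex-valued functions and compactness of the circle *)

Section ComplexTopology.
Variables (R : realType) (X : topologicalType).

Lemma real_complex_continuous : continuous (fun r : R => (r%:C)%C : R[i]^o).
Proof.
move=> r; apply/cvgrPdist_lt => e e0.
have := gtr0_norm e0; rewrite normc_def; set d := Num.sqrt _ => de.
have d0 : 0 < d by rewrite -ltcR de.
near=> t; rewrite -(rmorphB (real_complex R)) /= normc_def /= expr0n addr0 sqrtr_sqr.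
rewrite -de ltcR.
by near: t; apply: cvgr_dist_lt.
Unshelve. all: by end_near.
Qed.

Lemma complex_continuous (f g : X -> R) : continuous f -> continuous g ->
  continuous (fun x => Complex (f x) (g x) : R[i]^o).
Proof.
move=> fc gc.
have -> : (fun x => Complex (f x) (g x) : R[i]^o) =
    (fun x => (f x)%:C%C + 'i%C * (g x)%:C%C : R[i]^o).
  by apply: funext => x; rewrite [LHS]complexE.
have cc (h : X -> R) : continuous h -> continuous (fun x => (h x)%:C%C : R[i]^o).
  by move=> hc x; apply: (continuous_comp (hc x)); apply: real_complex_continuous.
move=> x; apply: cvgD; first exact: cc.
by apply: cvgM; [exact: cvg_cst | exact: cc].
Qed.

Lemma lipschitz_complex_continuous (g : R[i] -> R) :
  (forall x y, `|g x - g y| <= normc (x - y)) -> continuous (g : R[i]^o -> R).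
Proof.
move=> gl z A /nbhs_ballP[e /= e0 eA].
apply/(@nbhs_ballP _ R[i]^o); exists (e%:C)%C; first by rewrite /= ltcR.
move=> w zw; apply: eA; apply: le_lt_trans (gl _ _) _.
by rewrite -ltcR; apply: zw.
Qed.

Lemma cfun_normc_continuous (f : cfun R X) : continuous (fun x => normc (f x) : R).
Proof.
move=> x; apply: (@continuous_comp X R[i]^o R f (fun z : R[i]^o => normc z : R)).
  exact: cts_fun.
have t (a b : R[i]) : normc a - normc b <= normc (a - b).
  by rewrite lerBlDr; apply: le_trans (le_normcD _ _); rewrite subrK.
apply: lipschitz_complex_continuous => a b; apply/ler_normlP; split; last exact: t.
by rewrite opprB; apply: le_trans (t _ _) _; rewrite -normcN opprB.
Qed.

Lemma cfun_Re_continuous (f : cfun R X) : continuous (fun x => complex.Re (f x) : R).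
Proof.
move=> x; apply: (@continuous_comp X R[i]^o R f (fun z : R[i]^o => complex.Re z : R)).
  exact: cts_fun.
apply: lipschitz_complex_continuous => a b.
by rewrite -(raddfB (@complex.Re R)) -lecR; apply: normc_ge_Re.
Qed.

Definition real_cfun (h : X -> R) (hc : continuous h) : cfun R X :=
  mkcts (complex_continuous hc (@cst_continuous X R (0 : R))).

Lemma real_cfunE h (hc : continuous h) x : real_cfun hc x = (h x)%:C%C.
Proof. by []. Qed.

End ComplexTopology.

Section CircleTopology.
Variable R : realType.
Local Notation S1 := (circle R).
Local Notation CS1 := (cfun R S1).

Lemma exp2pi_continuous : continuous (@exp2pi R).
Proof.
apply: continuous_comp_initial.
have c t : {for t, continuous (fun t : R => 2 * pi * t)}.
  by apply: cvgM; [exact: cvg_cst | exact: cvg_id].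
apply: complex_continuous => t.
  by apply: (continuous_comp (c t)); exact: continuous_cos.
by apply: (continuous_comp (c t)); exact: continuous_sin.
Qed.

Lemma exp2pi_surj (z : S1) : exists2 t : R, -1 <= t <= 1 & exp2pi t = z.
Proof.
case: z => -[x y] n1.
have xy : x ^+ 2 + y ^+ 2 = 1.
  by move/eqP: n1 => /= e; rewrite -[LHS]sqr_sqrtr ?addr_ge0 ?sqr_ge0 // e expr1n.
have x1 : -1 <= x <= 1.
  rewrite -ler_norml -[1]normr1 -ler_sqr ?nnegrE // !real_normK ?num_real //.
  by rewrite expr1n -xy lerDl sqr_ge0.
have pi0 := pi_gt0 R.
have sx : Num.sqrt (1 - x ^+ 2) = `|y| by rewrite -xy addrC addKr sqrtr_sqr.
have a0 := acos_ge0 x1; have a1 := acos_lepi x1.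
have xi : x \in `[(-1), 1] by rewrite in_itv.
have pn0 : 2 * pi != 0 :> R by rewrite mulf_neq0 // ?gt_eqF.
have t1 (a : R) : - pi <= a <= pi -> -1 <= a / (2 * pi) <= 1.
  by move=> /andP[? ?]; rewrite ler_pdivlMr ?ler_pdivrMr ?mulr_gt0 //; lra.
have [y0|y0] := leP 0 y.
  exists (acos x / (2 * pi)); first by apply: t1; lra.
  apply: val_inj => /=; rewrite mulrC divfK // acosK // sin_acos // sx ger0_norm //.
exists (- acos x / (2 * pi)); first by apply: t1; lra.
by apply: val_inj => /=; rewrite mulrC divfK // cosN sinN acosK // sin_acos // sx
  ltr0_norm // opprK.
Qed.

Lemma circle_compact : compact [set: S1].
Proof.
have -> : [set: S1] = @exp2pi R @` `[(-1 : R), 1].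
  apply/seteqP; split => // z _; have [t t1 <-] := exp2pi_surj z.
  by exists t => //=; rewrite in_itv.
apply: continuous_compact; last exact: segment_compact.
by apply: continuous_subspaceT; exact: exp2pi_continuous.
Qed.

Lemma cfun_bounded (f : CS1) : exists2 K, 0 <= K & forall z, normc (f z) <= K.
Proof.
have [|||c _ cm] := @compact_EVT_max _ _ (fun z : S1 => normc (f z)) [set: S1].
- by exists 1%g.
- exact: circle_compact.
- by apply: continuous_subspaceT; exact: cfun_normc_continuous.
by exists (normc (f c)) => [|z]; [exact: normc_ge0 | apply: cm; rewrite inE].
Qed.

Lemma cfun_norm_ub (f : CS1) z : normc (f z) <= cfun_norm f.
Proof.
have [K K0 fK] := cfun_bounded f.
apply: ub_le_sup; last by exists z.
by exists K => _ [w _ <-].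
Qed.

(** A crude bound by Cauchy-Schwarz, in the form [2 u v <= u^2 + v^2]; it serves to make the suprema
    in the matrix norms finite. *)
Lemma nsq_mulmx_le n (a : 'M[R[i]]_n) K x : (forall i j, normc (a i j) <= K) -> 0 <= K ->
  nsq (a *m x) <= (n%:R * K) ^+ 2 * nsq x.
Proof.
move=> aK K0.
have le i : normc ((a *m x) i 0) <= K * \sum_j normc (x j 0).
  rewrite mxE mulr_sumr.
  apply: le_trans (_ : \sum_j normc (a i j * x j 0) <= _).
    elim/big_ind2: _ => [|u v u' v' uv uv'|j _] //.
      by rewrite ComplexField.Normc.normc0.
    by apply: le_trans (le_normcD _ _) _; apply: lerD.
  apply: ler_sum => j _; rewrite ComplexField.Normc.normcM.
  by rewrite ler_wpM2r ?normc_ge0.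
have cs : (\sum_j normc (x j 0)) ^+ 2 <= n%:R * nsq x.
  set u := fun j => normc (x j 0); have -> : nsq x = \sum_j u j ^+ 2 by [].
  rewrite expr2 big_distrlr /=.
  apply: le_trans (_ : \sum_i \sum_j (u i ^+ 2 + u j ^+ 2) / 2 <= _).
    apply: ler_sum => i _; apply: ler_sum => j _.
    by have := sqr_ge0 (u i - u j); rewrite sqrrB -/(u _) -/(u _) mulr2n; lra.
  set S := \sum_j u j ^+ 2.
  have -> : \sum_i \sum_j (u i ^+ 2 + u j ^+ 2) / 2 =
      \sum_i (n%:R / 2 * u i ^+ 2 + S / 2).
    apply: eq_bigr => i _; rewrite -mulr_suml big_split /= sumr_const card_ord.
    by rewrite -[_ *+ n]mulr_natl -/S; field.
  rewrite big_split /= -mulr_sumr sumr_const card_ord -/S -[_ *+ n]mulr_natl.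
  by lra.
have s0 : 0 <= \sum_j normc (x j 0) by apply: sumr_ge0 => j _; apply: normc_ge0.
rewrite /nsq; apply: le_trans (_ : \sum_(i < n) K ^+ 2 * (n%:R * nsq x) <= _).
  apply: ler_sum => i _; apply: le_trans (_ : (K * \sum_j normc (x j 0)) ^+ 2 <= _).
    by rewrite lerXn2r ?nnegrE ?normc_ge0 // (le_trans (normc_ge0 _) (le i)).
  by rewrite exprMn ler_wpM2l ?exprn_ge0.
rewrite sumr_const card_ord -[_ *+ n]mulr_natl -/(nsq x).
by rewrite le_eqVlt; apply/orP; left; apply/eqP; ring.
Qed.

Lemma mx_bounded_exists n (a : 'M[CS1]_n) : exists2 K, 0 <= K & mx_bounded a K.
Proof.
have /fin_all_exists2[K K0 aK] : forall ij : 'I_n * 'I_n,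
    exists2 K, 0 <= K & forall z, normc (a ij.1 ij.2 z) <= K.
  by move=> ij; apply: cfun_bounded.
have S0 : 0 <= \sum_ij K ij by apply: sumr_ge0.
exists (n%:R * \sum_ij K ij); first by rewrite mulr_ge0.
move=> z x; apply: nsq_mulmx_le => // i j; rewrite mxE.
apply: le_trans (aK (i, j) z) _.
by rewrite (bigD1 (i, j)) //= lerDl sumr_ge0.
Qed.

Lemma mx_bounded_of_norm n (a : 'M[CS1]_n) C : cfun_mx_norm a <= C -> mx_bounded a C.
Proof.
have [K K0 aK] := mx_bounded_exists a.
move=> aC z x; apply: le_trans (le_op_norm _ K0 (aK z)) _.
have le : op_norm conjc (@normc R) (eval_mx z a) <= C.
  apply: le_trans aC; apply: ub_le_sup; last by exists z.
  by exists K => _ [w _ <-]; apply: op_norm_le => // y; apply: aK.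
rewrite ler_wpM2r ?nsq_ge0 // lerXn2r ?nnegrE ?op_norm_ge0 //.
exact: le_trans (op_norm_ge0 _ _ _) le.
Qed.

End CircleTopology.

(** * Irrational rotations *)

Section IrrationalRotation.
Variable R : realType.

(** Dirichlet's pigeonhole argument: of the fractional parts of [0, theta, ..., Q theta], two fall
    into the same of [Q] intervals of length [1 / Q < d]. Their difference is nonzero by
    irrationality. *)
Lemma irrational_multiple_near0 (theta d : R) : irrational theta -> 0 < d ->
  exists (k : nat) (m : int), 0 < `|k%:R * theta - m%:~R| < d.
Proof.
move=> irr d0; pose Q := (Num.truncn d^-1).+1.
have Q0 : 0 < Q%:R :> R by rewrite ltr0n.
have Qd : Q%:R^-1 < d.
  have di : 0 < d^-1 by rewrite invr_gt0.
  rewrite -[X in _ < X]invrK ltf_pV2 ?posrE //.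
  by have /andP[_] := truncn_itv (ltW di).
pose fr (i : nat) : R := i%:R * theta - (Num.floor (i%:R * theta))%:~R.
have fr01 i : 0 <= fr i < 1.
  have /andP[a b] := floor_itv (i%:R * theta); rewrite /fr.
  by move: b; rewrite intrD; lra.
have frQ i : 0 <= fr i * Q%:R < Q%:R.
  have /andP[f0 f1] := fr01 i.
  by apply/andP; split; [rewrite mulr_ge0 // ltW | rewrite gtr_pMl].
have trQ i : (Num.truncn (fr i * Q%:R) < Q)%N.
  have /andP[f0 f1] := frQ i.
  by rewrite -(ltr_nat R); apply: le_lt_trans f1; rewrite truncn_le.
pose g (i : 'I_Q.+1) : 'I_Q := Ordinal (trQ i).
have [ginj|/injectivePn] := boolP (injectiveb g).
  by have := leq_card g (injectiveP _ ginj); rewrite !card_ord ltnn.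
move=> [i [j ij /(congr1 val) /= gij]].
wlog ltij : i j ij gij / (i < j)%N => [wl|].
  have [|] := ltnP i j; first exact: wl.
  rewrite leq_eqVlt => /orP[/eqP e|]; last by apply: wl => //; rewrite eq_sym.
  by move: ij; rewrite (ord_inj e) eqxx.
exists (j - i)%N, (Num.floor (j%:R * theta) - Num.floor (i%:R * theta)).
have e : (j - i)%:R * theta - (Num.floor (j%:R * theta) - Num.floor (i%:R * theta))%:~R
    = fr j - fr i :> R.
  by rewrite natrB ?(ltnW ltij) // intrB /fr; ring.
apply/andP; split.
  rewrite normr_gt0; apply/eqP => e0; apply: irr.
  move: e0; set m := (Num.floor _ - _); set k := subn _ _; move=> e0.
  have k0 : k%:R != 0 :> R by rewrite pnatr_eq0 subn_eq0 -ltnNge.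
  exists (m%:Q / k%:Q) => //; rewrite fmorph_div /= !ratr_int.
  move/eqP: e0; rewrite subr_eq0 => /eqP <-.
  by rewrite mulrAC -[k%:~R]/(k%:R) mulfV ?mul1r.
rewrite e; apply: lt_trans Qd.
rewrite -[Q%:R^-1]mul1r ltr_pdivlMr // -[X in _ * X]gtr0_norm // -normrM mulrBl.
have /andP[aj bj] := truncn_itv (proj1 (andP (frQ j))).
have /andP[ai bi] := truncn_itv (proj1 (andP (frQ i))).
move: aj bj ai bi; rewrite gij -natr1 ltr_norml; lra.
Qed.

Lemma irrational_dense (theta d x : R) : irrational theta -> 0 < d ->
  exists (k : nat) (m : int), `|x - k%:R * theta - m%:~R| < d.
Proof.
move=> irr d0; have [k [m]] := irrational_multiple_near0 irr d0.
set eta := _ - _ => /andP[eta0 etad].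
have eta_neq0 : eta != 0 by rewrite -normr_gt0.
(* The multiplier of [theta] has to be a natural number, so an integer [n] is subtracted from [x] to
   give the difference the sign of [eta]. *)
have [n xn] : exists n : int, 0 <= (x - n%:~R) / eta.
  have [e|e] := ltrP 0 eta.
    by exists (Num.floor x); rewrite divr_ge0 ?(ltW e) // subr_ge0 floor_le.
  exists (Num.floor x + 1); rewrite -[_ / _]mulrNN -invrN divr_ge0 ?oppr_ge0 //.
  by rewrite subr_le0; have /andP[_ /ltW] := floor_itv x.
have /andP[t0 t1] := truncn_itv xn; set t := Num.truncn _ in t0 t1.
exists (t * k)%N, (n - m *+ t).
have -> : x - (t * k)%:R * theta - (n - m *+ t)%:~R = ((x - n%:~R) / eta - t%:R) * eta.
  rewrite mulrBl divfK // /eta natrM intrB -[m *+ t]mulr_natr intrM natz -pmulrn.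
  by ring.
rewrite normrM; apply: lt_trans etad; rewrite -[X in _ < X]mul1r ltr_pM2r //.
by move: t1; rewrite -natr1 ger0_norm ?subr_ge0 //; lra.
Qed.

End IrrationalRotation.

(** * Covering the circle by rotates of an arc *)

Section Covers.
Variable R : realType.
Local Notation S1 := (circle R).
Local Notation CS1 := (cfun R S1).

Lemma exp2pi_int (m : int) : exp2pi (m%:~R : R) = 1%g.
Proof.
have n1 (n : nat) : exp2pi (n%:R : R) = 1%g.
  by rewrite -[n%:R]/(1 *+ n) -exp2pi_nat exp2pi1 expg1n.
case: m => n; first exact: n1.
rewrite NegzE intrN; apply: (mulgI (exp2pi n.+1%:R)).
by rewrite -exp2piD subrr mulg1 n1 -[0]/(0%:R) n1.
Qed.

(** By density, some multiple of [theta] carries any given point into the arc around [z0] where [f]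
    exceeds [kappa]; compactness of the parameter interval leaves finitely many multiples. *)
Lemma rotations_cover (theta kappa : R) (f : S1 -> R) (z0 : S1) :
  irrational theta -> continuous f -> kappa < f z0 ->
  exists K : nat, forall z, exists2 i : 'I_K, true &
    kappa < f (exp2pi (- (i%:R * theta)) * z)%g.
Proof.
move=> irr fc fz0; have [t0 _ t0z] := exp2pi_surj z0.
pose g (s : R) := f (exp2pi s).
have gc : continuous g.
  by move=> s; apply: continuous_comp; [exact: exp2pi_continuous | exact: fc].
have gt0 : kappa < g t0 by rewrite /g t0z.
have [d d0 gd] : exists2 d : R, 0 < d & forall s, `|t0 - s| < d -> kappa < g s.
  have /cvgrPdist_lt/(_ (g t0 - kappa)) := gc t0.
  rewrite subr_gt0 => /(_ gt0) /nbhs_ballP[d /= d0 dP].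
  by exists d => // s sd; have := dP s sd; rewrite /= ltr_norml; lra.
pose O (i : nat) := [set s : R | kappa < g (s - i%:R * theta)].
have gz s i : g (s - i%:R * theta) = f (exp2pi (- (i%:R * theta)) * exp2pi s)%g.
  by rewrite /g -exp2piD addrC.
have cov : cover_compact `[(-1 : R), 1].
  by rewrite -compact_cover; exact: segment_compact.
have [||D _ Dc] := cov nat setT O.
- move=> i _; have -> : O i = (fun s => g (s - i%:R * theta)) @^-1` [set x | kappa < x].
    by [].
  apply: open_comp; last exact: open_gt.
  move=> s _; apply: (continuous_comp (f := fun s : R => s - i%:R * theta)); last exact: gc.
  by apply: cvgB; [exact: cvg_id | exact: cvg_cst].
- move=> s _; have [k [m km]] := irrational_dense (s - t0) irr d0.
  exists k => //=; rewrite /O /=.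
  have -> : g (s - k%:R * theta) = g (s - k%:R * theta - m%:~R).
    by rewrite /g [in RHS]exp2piD -(intrN _ m) exp2pi_int mulg1.
  by apply: gd; rewrite distrC; congr (`|_| < d): km; ring.
pose K := (\max_(i <- finmap.enum_fset D) i).+1.
exists K => z; have [s s1 <-] := exp2pi_surj z.
have [|i /= iD iO] := Dc s; first by rewrite /= in_itv.
have iK : (i < K)%N by rewrite ltnS; apply: (leq_bigmax_seq (F := fun i => i)).
by exists (Ordinal iK) => //; rewrite -gz.
Qed.

End Covers.

(* [|h_i|^2 = (F_i - kappa)_+ / sum_j F_j (F_j - kappa)_+]. *)
Lemma weights_of_cover (R : realType) (X : topologicalType) (I : finType)
    (F : I -> X -> R) (kappa : R) :
  0 < kappa -> (forall i, continuous (F i)) ->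
  (forall z, exists2 i, true & kappa < F i z) ->
  exists h : I -> cfun R X, (forall z, \sum_i normc (h i z) ^+ 2 * F i z = 1) /\
    forall z, \sum_i normc (h i z) ^+ 2 <= kappa^-1.
Proof.
move=> k0 Fc Fcov.
pose P i z : R := ((F i z - kappa) + `|F i z - kappa|) / 2.
pose D z := \sum_j F j z * P j z.
have PE i z : P i z = if 0 <= F i z - kappa then F i z - kappa else 0.
  rewrite /P; case: ifPn => [/ger0_norm ->|]; first lra.
  by rewrite -ltNge => /ltr0_norm ->; lra.
have P0 i z : 0 <= P i z by rewrite PE; case: ifP.
have FP i z : kappa * P i z <= F i z * P i z.
  rewrite PE; case: ifPn => [Fk|_]; last by rewrite !mulr0.
  by apply: ler_wpM2r => //; rewrite -subr_ge0.
have D0 z : 0 < D z.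
  have [i _ Fi] := Fcov z; rewrite /D (bigD1 i) //=.
  rewrite ltr_wpDr ?sumr_ge0 // => [j _|].
    by apply: le_trans (FP j z); rewrite mulr_ge0 // ltW.
  by rewrite mulr_gt0 //; [exact: lt_trans Fi | rewrite PE subr_ge0 ltW // subr_gt0].
have Pc i : continuous (P i).
  move=> z; apply: cvgM; last exact: cvg_cst.
  have Fk : F i z0 - kappa @[z0 --> z] --> F i z - kappa.
    by apply: cvgB; [exact: Fc | exact: cvg_cst].
  by apply: (cvgD Fk); exact: (cvg_norm Fk).
have Dc : continuous D.
  rewrite /D; elim: (index_enum I) => [|j r IHr].
    by under eq_fun do rewrite big_nil; exact: cst_continuous.
  under eq_fun do rewrite big_cons.
  by move=> z; apply: cvgD; [apply: cvgM; [exact: Fc | exact: Pc] | exact: IHr].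
have hc i : continuous (fun z => Num.sqrt (P i z / D z)).
  move=> z; apply: (continuous_comp (f := fun z => P i z / D z)); last exact: sqrt_continuous.
  by apply: cvgM; [exact: Pc | apply: cvgV; [rewrite gt_eqF | exact: Dc]].
exists (fun i => real_cfun (hc i)).
have nE i z : normc (real_cfun (hc i) z) ^+ 2 = P i z / D z.
  by rewrite real_cfunE normc_real ?sqrtr_ge0 // sqr_sqrtr // divr_ge0 // ltW.
split=> z.
  under eq_bigr do rewrite nE mulrAC [P _ _ * _]mulrC.
  by rewrite -mulr_suml; exact: (mulfV (lt0r_neq0 (D0 z))).
under eq_bigr do rewrite nE.
rewrite -mulr_suml ler_pdivrMr // -ler_pdivrMl ?invr_gt0 // invrK mulr_sumr.
by apply: ler_sum => i _; apply: FP.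
Qed.

(** * The direct limit *)

Lemma cvg_le_const (R : realType) (u : nat -> R) (l C : R) :
  u k @[k --> \oo] --> l -> (forall k, u k <= C) -> l <= C.
Proof.
move=> ul uC; rewrite leNgt; apply/negP => Cl.
have /cvgrPdist_lt/(_ (l - C)) := ul; rewrite subr_gt0 => /(_ Cl)[k _ /(_ k (leqnn _))] /=.
by have := uC k; rewrite ltr_norml; lra.
Qed.

Section RowExpansion.
Variables (R : realType) (D : starAlgType R).

Lemma sum_delta_scalar m (g : D) :
  \sum_j delta_mx j 0 *m (g%:M : 'M[D]_1) *m delta_mx 0 j = (g%:M : 'M[D]_m).
Proof.
apply/matrixP => a b; rewrite summxE (bigD1 a) //= big1 ?addr0 => [|j /negbTE ja].
  rewrite mxE big_ord1 mxE big_ord1 !mxE !eqxx mul1r mulr1n /= eq_sym.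
  by case: (_ == _); rewrite ?mulr1 ?mulr0.
by rewrite mxE big_ord1 mxE big_ord1 !mxE eq_sym ja !mul0r.
Qed.

(** Rows [u i] produce a single scalar [g]; repeating them in each of the [m] rows, transported
    along [V], spreads [g] over the whole diagonal. *)
Lemma row_expansion m k (I : finType) (u : I -> 'M[D]_(1, k)) (V : 'M[D]_(m, k))
    (tau : 'M[D]_m) (X : 'M[D]_k) (g : D)
    (w := fun ij : I * 'I_m => delta_mx ij.2 0 *m u ij.1 *m adjmx star V) :
  adjmx star V *m tau *m V = X ->
  \sum_i u i *m X *m adjmx star (u i) = g%:M ->
  \sum_ij w ij *m tau *m adjmx star (w ij) = g%:M.
Proof.
move=> <- ug; rewrite -(pair_bigA _ (fun i j => w (i, j) *m tau *m adjmx star (w (i, j)))) /=.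
rewrite exchange_big -[RHS]sum_delta_scalar; apply: eq_bigr => j _.
rewrite -ug mulmx_sumr mulmx_suml; apply: eq_bigr => i _.
have dE : adjmx star (delta_mx j 0 : 'M[D]_(m, 1)) = delta_mx 0 j.
  by apply/matrixP => a b; rewrite !mxE andbC; case: (_ && _); rewrite ((star1 D), (star0 D)).
by rewrite /w /= !adjmxM adjmxK dE !mulmxA.
Qed.

End RowExpansion.

Section Limit.
Variables (R : realType) (N : nat) (theta : R) (r00 r10 : nat).
Variables (l00 l01 l10 l11 : nat -> nat).
Local Notation S1 := (circle R).
Local Notation CS1 := (cfun R S1).
Local Notation rot := (rotalg R N).
Local Notation gam := (@rot_gamma R N).
Local Notation bet := (@beta_act R).
Local Notation stg := (stage R N r00 r10 l00 l01 l10 l11).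
Local Notation nu := (@nu R N theta r00 r10 l00 l01 l10 l11 _).
Local Notation nus := (@Defs.nu R N theta r00 r10 l00 l01 l10 l11).

Hypothesis N0 : (0 < N)%N.
Hypothesis hl00 : forall n, (0 < l00 n)%N.
Hypothesis hl01 : forall n, (0 < l01 n)%N.
Hypothesis hl10 : forall n, (0 < l10 n)%N.
Hypothesis hl11 : forall n, (0 < l11 n)%N.
Hypothesis h1000 : forall n, (l00 n <= l10 n)%N.
Hypothesis h1101 : forall n, (l01 n <= l11 n)%N.

Let hgam := @rot_gamma_hom R N.
Let hbet := @beta_act_hom R.

Lemma nu2E_fun (X : Type) n (a : X -> stg n) : (fun x => (nu (a x)).2) = fun x =>
  block_mx (flat_mx (block_diag (fun _ : 'I_(l10 n) => (a x).1))) 0 0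
    (rot_blocks N theta l11 n (a x).2).
Proof. by apply: funext => x; rewrite nu2E. Qed.

Lemma nu1E_fun (X : Type) n (a : X -> stg n) : (fun x => (nu (a x)).1) = fun x =>
  block_mx (block_diag (fun _ : 'I_(l00 n) => (a x).1)) 0
           0 (map_mx (rot_xi N) (block_diag (fun _ : 'I_(l01 n) => (a x).2))).
Proof. by apply: funext => x; rewrite nu1E. Qed.

Lemma subrep_xi_nu1 n : subrep gam (fun a : stg n => map_mx (rot_xi N) a.2) (fun a => (nu a).1).
Proof.
rewrite nu1E_fun; apply: (subrep_trans hgam); last exact: (subrep_block2 hgam).
apply: (subrep_map (act := bet) (rot_xi_hom R N)); first by move=> z d; rewrite rot_gamma_xi.
exact: (subrep_diag_nth hbet (fun _ : 'I_(l01 n) => fun a : stg n => a.2) (Ordinal (hl01 n))).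
Qed.

Lemma subrep_flat_nu2 n : subrep bet (fun a : stg n => flat_mx a.1) (fun a => (nu a).2).
Proof.
rewrite nu2E_fun; apply: (subrep_trans hbet); last exact: (subrep_block1 hbet).
apply: subrep_flat.
exact: (subrep_diag_nth hgam (fun _ : 'I_(l10 n) => fun a : stg n => a.1) (Ordinal (hl10 n))).
Qed.

Lemma subrep_rotated_nu2 n (j : 'I_(2 * N)) :
  subrep bet (fun a : stg n => map_mx (beta_tilde (angle N theta j)) a.2) (fun a => (nu a).2).
Proof.
rewrite nu2E_fun; apply: (subrep_trans hbet); last exact: (subrep_block2 hbet).
apply: (subrep_trans hbet); last exact: (subrep_diag_nth hbet (fun (j : 'I_(2 * N))
  (a : stg n) => map_mx (beta_tilde (angle N theta j)) (block_diag (fun _ : 'I_(l11 n) => a.2))) j).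
apply: (subrep_map (act := bet) (beta_tilde_hom _)).
  move=> z f; apply/cfunP => w; pose v := exp2pi (angle N theta j).
  change (f (z^-1 * (v^-1 * w))%g = f (v^-1 * (z^-1 * w))%g); rewrite !mulgA.
  by congr (f (_ * w)%g); exact: circle_mulC.
exact: (subrep_diag_nth hbet (fun _ : 'I_(l11 n) => fun a : stg n => a.2) (Ordinal (hl11 n))).
Qed.

Lemma subrep_nu2 n : subrep bet (fun a : stg n => a.2) (fun a => (nu a).2).
Proof.
have N2 : (0 < 2 * N)%N by rewrite muln_gt0.
have -> : (fun a : stg n => a.2) =
    fun a => map_mx (beta_tilde (angle N theta (Ordinal N2))) a.2.
  by apply: funext => a; apply/matrixP => i j; rewrite [RHS]mxE (beta_tilde0 _ N0).
exact: subrep_rotated_nu2.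
Qed.

(** * Pointwise bounds in the tower and the norm of the limit *)

Definition stage_bounded n (a : stg n) (C : R) : Prop :=
  mx_bounded (flat_mx a.1) C /\ mx_bounded a.2 C.

Lemma nu_bounded n (a : stg n) C : stage_bounded a C -> stage_bounded (nu a) C.
Proof.
move=> [b1 b2]; suff h : mx_bounded (nu a).2 C.
  have sr := subrep_flat_nu1 theta N0 h1000 h1101 (fun _ : unit => a).
  by split=> //; exact: (mx_bounded_subrep (x := tt) sr h).
rewrite nu2E; apply: mx_bounded_block.
  have sp := splits_flat (splits_diag_const hgam (l10 n) (fun _ : unit => a.1)).
  exact: (mx_bounded_splits (x := tt) sp).
apply: mx_bounded_diag => j; apply: mx_bounded_translate.
exact: mx_bounded_diag.
Qed.

(** The circle summand of the next stage contains both summands of this one, so a bound there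
    controls the whole element. *)
Lemma nu2_bounded_inv n (a : stg n) C : mx_bounded (nu a).2 C -> stage_bounded a C.
Proof.
by move=> h; split; [exact: (mx_bounded_subrep (x := a) (subrep_flat_nu2 n) h)
  | exact: (mx_bounded_subrep (x := a) (subrep_nu2 n) h)].
Qed.

Lemma stage_norm_le n (a : stg n) C : 0 <= C -> stage_bounded a C -> stage_norm a <= C.
Proof.
by move=> C0 [b1 b2]; rewrite /stage_norm flatten_mx_iota ge_max !cfun_mx_norm_le.
Qed.

Lemma stage_bounded_of_norm n (a : stg n) C : stage_norm a <= C -> stage_bounded a C.
Proof.
rewrite /stage_norm flatten_mx_iota ge_max => /andP[c1 c2].
by split; apply: mx_bounded_of_norm.
Qed.

Lemma connecting_bounded n k (a : stg n) C :
  stage_bounded a C <-> stage_bounded (connecting nus k a) C.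
Proof.
elim: k => //= k ->; split=> [|[_]]; [exact: nu_bounded | exact: nu2_bounded_inv].
Qed.

Variables (A : cstarAlgType R) (phi : forall n, stg n -> A).
Variable (alpha : S1 -> A -> A).
Hypothesis hA : limit_action theta phi alpha.

Lemma phi_hom n : star_hom (@phi n).
Proof. by case: hA => -[h _ _ _] _ _; apply: h. Qed.

Lemma phi_nu n (a : stg n) : phi (nu a) = phi a.
Proof. by case: hA => -[_ h _ _] _ _; apply: h. Qed.

Lemma phi_connecting n k (a : stg n) : phi (connecting nus k a) = phi a.
Proof. by elim: k => //= k IHk; rewrite phi_nu. Qed.

Lemma cnorm_phi_le n (a : stg n) C : 0 <= C -> stage_bounded a C -> cnorm (phi a) <= C.
Proof.
move=> C0 ba; case: hA => -[_ _ nl _] _ _; apply: cvg_le_const (nl n a) _ => k.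
apply: stage_norm_le => //. exact: (proj1 (connecting_bounded k a C) ba).
Qed.

(** The strict inequality is inherited by the norm at some stage of the convergent sequence, and the
    bound descends from there to stage [n]. *)
Lemma stage_bounded_of_cnorm n (a : stg n) C : cnorm (phi a) < C -> stage_bounded a C.
Proof.
move=> aC; case: hA => -[_ _ nl _] _ _.
have /cvgrPdist_lt/(_ (C - cnorm (phi a))) := nl n a.
rewrite subr_gt0 => /(_ aC)[k _ /(_ k (leqnn _))] /=; rewrite ltr_norml => /andP[k1 _].
apply: (proj2 (connecting_bounded k a C)); apply: stage_bounded_of_norm.
by move: k1; lra.
Qed.

Lemma alpha_hom z : star_hom (alpha z).
Proof. by case: hA => _ [h _ _ _] _; apply: h. Qed.

Lemma alpha_phi n z (a : stg n) : alpha z (phi a) = phi (stage_act z a).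
Proof. by case: hA => _ _ h; apply: h. Qed.

Lemma fixed_star_subring : star_subring (fixed alpha).
Proof.
split=> [x y fx fy z|x y fx fy z|x fx z|c x fx z]; have hz := alpha_hom z.
- by rewrite (shD hz) fx fy.
- by rewrite (shM hz) fx fy.
- by rewrite (shS hz) fx.
- by rewrite (shZ hz) fx.
Qed.

Lemma fixed_phi n (a : stg n) : (forall z, stage_act z a = a) -> fixed alpha (phi a).
Proof. by move=> fa z; rewrite alpha_phi fa. Qed.

Lemma approx n0 (a : A) (e : R) : 0 < e ->
  exists n (b : stg (n + n0)), cnorm (a - phi b) < e.
Proof.
move=> e0; case: hA => -[_ _ _ dense] _ _; have [n [b ab]] := dense a e e0.
exists n; have [b' b'E] : exists b' : stg (n + n0), phi b' = phi b.
  by rewrite addnC; exists (connecting nus n0 b); rewrite phi_connecting.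
by exists b'; rewrite b'E.
Qed.

Lemma approx_finite (F : set A) (e : R) : 0 < e -> finite_set F ->
  exists n0, forall n, (n0 <= n)%N -> forall a, F a -> exists b : stg n, cnorm (a - phi b) < e.
Proof.
move=> e0 /finite_seqP[s ->]; elim: s => [|a s [n0 IHs]]; first by exists 0%N.
have [n1 [b ab]] := approx 0 a e0.
exists (maxn (n1 + 0) n0) => n; rewrite geq_max => /andP[n1n n0n] a' /=.
rewrite inE => /orP[/eqP ->|]; last exact: IHs.
by rewrite -(subnK n1n); exists (connecting nus (n - (n1 + 0)) b); rewrite phi_connecting.
Qed.

(** * Averages over the roots of unity and approximation of fixed elements *)

Lemma stage_act_hom n z : star_hom (@stage_act R N r00 r10 l00 l01 l10 l11 n z).
Proof.
have hg := hgam z; have hb := hbet z.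
split; [split|..] => [a b|c a||a b|a]; apply: injective_projections => /=.
- exact: (map_mx_shD hg).
- exact: (map_mx_shD hb).
- by apply/matrixP => i j; rewrite !mxE (shZ hg).
- by apply/matrixP => i j; rewrite !mxE (shZ hb).
- exact: (map_mx_sh1 hg).
- exact: (map_mx_sh1 hb).
- exact: (map_mx_shM hg).
- exact: (map_mx_shM hb).
- exact: (map_mx_shS hg).
- exact: (map_mx_shS hb).
Qed.

Lemma stage_actM n (z w : S1) (a : stg n) : stage_act (z * w)%g a = stage_act z (stage_act w a).
Proof.
have e (f : CS1) : beta_act (z * w)%g f = beta_act z (beta_act w f).
  apply/cfunP => x; change (f ((z * w)^-1 * x)%g = f (w^-1 * (z^-1 * x))%g).
  by rewrite invgM mulgA.
apply: injective_projections; apply/matrixP => i j /=; rewrite !mxE; last exact: e.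
by apply: rot_eq => k l x; rewrite /= !mxE e.
Qed.

Lemma omega_expN : (omega R N ^+ N)%g = 1%g.
Proof.
by rewrite /omega exp2pi_nat -[_ *+ N]mulr_natl mulfV ?exp2pi1 // pnatr_eq0 -lt0n.
Qed.

Definition omega_mean n (a : stg n) : stg n :=
  cscale (N%:R^-1)%:C%C (\sum_(i < N) stage_act (omega R N ^+ i)%g a).

Lemma omega_mean_invariant n (a : stg n) : stage_act (omega R N) (omega_mean a) = omega_mean a.
Proof.
rewrite /omega_mean (shZ (stage_act_hom n _)) (sh_sum (stage_act_hom n _)); congr cscale.
under eq_bigr do rewrite -stage_actM -expgS.
apply: (addrI (stage_act (omega R N ^+ 0)%g a)).
rewrite -(big_ord_recl N (fun i => stage_act (omega R N ^+ i)%g a)) big_ord_recr /=.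
by rewrite omega_expN expg0 addrC.
Qed.

(** The fixed element [x] is its own average, and each [alpha z] is contractive. *)
Lemma omega_mean_close n (a : stg n) x : fixed alpha x ->
  cnorm (x - phi (omega_mean a)) <= cnorm (x - phi a).
Proof.
move=> fx; rewrite /omega_mean (shZ (phi_hom n)) (sh_sum (phi_hom n)).
set c := (_%:C)%C; have Nn0 : N%:R != 0 :> R by rewrite pnatr_eq0 -lt0n.
have {1}-> : x = cscale c (\sum_(i < N) alpha (omega R N ^+ i)%g x).
  under eq_bigr do rewrite fx.
  rewrite sumr_const card_ord.
  rewrite -[x in RHS]cscale1 cscale_mulrn cscaleA -[LHS]cscale1; congr cscale.
  by rewrite /c -(rmorph_nat (real_complex R)) -rmorphM mulVf ?rmorph1.
rewrite -cscalerB -sumrB cnormZ normc_real ?invr_ge0 // ler_pdivrMl ?ltr0n //.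
apply: le_trans (cnorm_sum_le _ _) _.
rewrite mulr_natl -[in X in _ <= _ *+ X](card_ord N) -sumr_const.
apply: ler_sum => i _; rewrite -alpha_phi -(shB (alpha_hom _)).
exact: (star_hom_contractive _ (alpha_hom _)).
Qed.

(* An [omega]-invariant element [f] of the rotation algebra satisfies
   [f 1 = s (f 1) s^*], so that the constant function [f 1] is in the algebra. *)
Lemma rot_value_at_1 (f : rot) : rot_gamma (omega R N) f = f ->
  exists c : rot, forall i j z, rotval c i j z = rotval f i j 1%g.
Proof.
move=> finv; pose m : 'M[CS1]_N := \matrix_(i, j) cscale (rotval f i j 1%g) 1.
have mE i j z : m i j z = rotval f i j 1%g by rewrite mxE cfunZ cfun1 mulr1.
have mP : m \in @rot_equivariant R N.
  apply/mem_set => z; apply/matrixP => i j; rewrite rot_shift_conj !mxE !cfunZ !cfun1.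
  congr (_ * _); have := rotval_omega f 1 1%g i j; rewrite /= expg1 mulg1 => <-.
  rewrite -[in RHS]finv /= mxE beta_actE; congr (rotval f i j _).
  by rewrite mulVg.
exists (RotAlg mP) => i j z; exact: mE.
Qed.

Lemma rot_mx_subE m n (a b : 'M[rot]_(m, n)) i j k l z :
  rotval ((a - b) i j) k l z = rotval (a i j) k l z - rotval (b i j) k l z.
Proof. by rewrite !mxE. Qed.

Lemma cfun_mx_subE m n (a b : 'M[CS1]_(m, n)) i j z : (a - b) i j z = a i j z - b i j z.
Proof. by rewrite !mxE. Qed.

(* Hence the mean over the powers of [omega] can be frozen at [1], and the error
   is controlled by the defect of invariance. *)
Lemma approx_fixed (a : A) (e : R) : 0 < e -> fixed alpha a ->
  exists n (d : stg n), (forall z, stage_act z d = d) /\ cnorm (a - phi d) < e.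
Proof.
move=> e0 fa; have d0 : 0 < e / 4 by rewrite divr_gt0.
have [n [u [uinv au]]] : exists n (u : stg n),
    stage_act (omega R N) u = u /\ cnorm (a - phi u) < e / 4.
  have [n [b ab]] := approx 0 a d0; exists (n + 0)%N, (omega_mean b); split.
    exact: omega_mean_invariant.
  exact: le_lt_trans (omega_mean_close b fa) ab.
(* Both [phi u] and its image under [alpha z] are within [e / 4] of the fixed element [a]. *)
have uz z : stage_bounded (u - stage_act z u) (e / 2).
  apply: stage_bounded_of_cnorm; rewrite (shB (phi_hom _)) -alpha_phi.
  apply: le_lt_trans (ler_cnorm_dist a _ _) _.
  have := star_hom_contractive (a - phi u) (alpha_hom z).
  by rewrite (shB (alpha_hom z)) fa; rewrite [cnorm (phi u - a)]cnormBC; move: au; lra.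
have [d [d1E d2E]] : exists d : stg n,
    (forall i j k l z, rotval (d.1 i j) k l z = rotval (u.1 i j) k l 1%g) /\
    (forall i j z, d.2 i j z = u.2 i j 1%g).
  have /fin_all_exists[c1 c1E] : forall ij, exists c : rot, forall k l z,
      rotval c k l z = rotval (u.1 ij.1 ij.2) k l 1%g.
    move=> ij; apply: rot_value_at_1.
    by rewrite -[RHS](congr1 (fun v : stg _ => v.1 ij.1 ij.2) uinv) [RHS]mxE.
  exists (\matrix_(i, j) c1 (i, j), \matrix_(i, j) cscale (u.2 i j 1%g) 1).
  split=> i j; first by move=> k l z; rewrite mxE c1E.
  by move=> z; rewrite mxE cfunZ cfun1 mulr1.
exists n, d; split.
  move=> z; apply: injective_projections; apply/matrixP => i j; rewrite [LHS]mxE.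
    by apply: rot_eq => k l w; rewrite rot_gammaE !d1E.
  by apply/cfunP => w; rewrite beta_actE !d2E.
(* At the point [z], the rotate [stage_act z u] has the value of [u] at 1, which is that of [d]; so
   the bound [uz z], evaluated at [z] itself, is the required one. *)
have ud : stage_bounded (u - d) (e / 2).
  have act1 i j k l z : rotval ((stage_act z u).1 i j) k l z = rotval (u.1 i j) k l 1%g.
    by rewrite [_ i j]mxE rot_gammaE mulVg.
  have act2 i j z : (stage_act z u).2 i j z = u.2 i j 1%g by rewrite mxE beta_actE mulVg.
  split=> z x; have [b1 b2] := uz z.
    have -> : eval_mx z (flat_mx (u - d).1) = eval_mx z (flat_mx (u - stage_act z u).1).
      apply/matrixP => i j; case: (mxtens_indexP i) => i1 i2.
      case: (mxtens_indexP j) => j1 j2; rewrite ![eval_mx _ _ _ _]mxE !flat_mxE.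
      by rewrite !rot_mx_subE d1E act1.
    exact: b1.
  have -> : eval_mx z (u - d).2 = eval_mx z (u - stage_act z u).2.
    by apply/matrixP => i j; rewrite ![eval_mx _ _ _ _]mxE !cfun_mx_subE d2E act2.
  exact: b2.
apply: le_lt_trans (ler_cnorm_dist (phi u) _ _) _.
rewrite -(shB (phi_hom _)). have e2 : 0 <= e / 2 by lra.
by have := cnorm_phi_le e2 ud; move: au; lra.
Qed.

(** * Full elements with bounded witnesses *)

Lemma fst_sum_stage n (I : Type) (r : seq I) (F : I -> stg n) :
  (\sum_(i <- r) F i).1 = \sum_(i <- r) (F i).1.
Proof. exact: (big_morph (fun x : stg n => x.1) (fun x y => erefl) erefl). Qed.

Lemma snd_sum_stage n (I : Type) (r : seq I) (F : I -> stg n) :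
  (\sum_(i <- r) F i).2 = \sum_(i <- r) (F i).2.
Proof. exact: (big_morph (fun x : stg n => x.2) (fun x y => erefl) erefl). Qed.

Lemma delta_fixed (D : starAlgType R) (act : S1 -> D -> D)
    (hact : forall z, star_hom (act z)) m n i j :
  fixed_mx act (delta_mx i j : 'M[D]_(m, n)).
Proof.
move=> z; apply/matrixP => a b; rewrite !mxE.
by case: (_ && _); rewrite ((sh1 (hact z)), (sh0 (hact z))).
Qed.

(** Both summands of [nu c] contain [c.2], the rotation summand through [xi]; so rows that make
    [c.2] full make both full, after expansion to the respective sizes. The bound is the same
    computation with 1 in place of [nu c]. *)
Lemma rows_full n (c : stg n) (I : finType) (v : I -> 'M[CS1]_(1, _)) (g : CS1) (C : R) :
  \sum_i v i *m c.2 *m adjmx star (v i) = 1%:M ->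
  \sum_i v i *m adjmx star (v i) = g%:M ->
  (forall z, normc (g z) <= C) ->
  exists (J : finType) (W : J -> stg n.+1), [/\
    \sum_j W j * nu c * star (W j) = 1,
    stage_bounded (\sum_j W j * star (W j)) C &
    (forall i, fixed_mx bet (v i)) -> forall j z, stage_act z (W j) = W j].
Proof.
move=> vc vg gC.
have [V0 [VV0 Vf0 VE0]] := subrep_xi_nu1 n.
have [V1 [VV1 Vf1 VE1]] := subrep_nu2 n.
have hx := rot_xi_hom R N.
set q0 := (ranks N r00 r10 l00 l01 l10 l11 n.+1).1 in V0 VV0 Vf0 VE0 *.
set q1 := (ranks N r00 r10 l00 l01 l10 l11 n.+1).2 in V1 VV1 Vf1 VE1 *.
pose w0 (ij : I * 'I_q0) : 'M[rot]_q0 :=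
  delta_mx ij.2 0 *m map_mx (rot_xi N) (v ij.1) *m adjmx star V0.
pose w1 (ij : I * 'I_q1) : 'M[CS1]_q1 := delta_mx ij.2 0 *m v ij.1 *m adjmx star V1.
pose W (j : I * 'I_q0 + I * 'I_q1) : stg n.+1 :=
  match j with inl ij => (w0 ij, 0) | inr ij => (0, w1 ij) end.
have key (x : stg n.+1) (y : 'M[CS1]_((ranks N r00 r10 l00 l01 l10 l11 n).2)) (f : CS1) :
    adjmx star V0 *m x.1 *m V0 = map_mx (rot_xi N) y ->
    adjmx star V1 *m x.2 *m V1 = y ->
    \sum_i v i *m y *m adjmx star (v i) = f%:M ->
    \sum_j W j * x * star (W j) = ((rot_xi N f)%:M, f%:M).
  move=> e0 e1 vf.
  have s0 : \sum_ij w0 ij *m x.1 *m adjmx star (w0 ij) = (rot_xi N f)%:M.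
    apply: (row_expansion (u := fun i => map_mx (rot_xi N) (v i)) e0).
    rewrite -(map_mx_sh_scalar hx) -vf (map_mx_sh_sum hx); apply: eq_bigr => i _.
    by rewrite !(map_mx_shM hx) (map_mx_shS hx).
  have s1 : \sum_ij w1 ij *m x.2 *m adjmx star (w1 ij) = f%:M.
    exact: (row_expansion (u := v) e1 vf).
  rewrite [LHS]surjective_pairing fst_sum_stage snd_sum_stage; congr (_, _).
    rewrite big_sumType /= [X in _ + X]big1 ?addr0 => [|ij _]; first exact: s0.
    by rewrite !mul0r.
  rewrite big_sumType /= [X in X + _]big1 ?add0r => [|ij _]; first exact: s1.
  by rewrite !mul0r.
exists _, W; split.
- rewrite (key _ c.2 1).
  + by rewrite (sh1 hx).
  + by rewrite -mulmxA -VE0 mulmxA VV0 mul1mx.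
  + by rewrite -mulmxA -VE1 mulmxA VV1 mul1mx.
  + exact: vc.
- have -> : \sum_j W j * star (W j) = \sum_j W j * 1 * star (W j).
    by apply: eq_bigr => j _; rewrite mulr1.
  rewrite (key _ 1%:M g).
  + split=> /=; last exact: mx_bounded_scalar.
    rewrite -(map_mx_sh_scalar hx) flat_mx_xi; apply: mx_bounded_diag => i.
    by apply: mx_bounded_translate; apply: mx_bounded_scalar.
  + by rewrite mulmx1 VV0 (map_mx_sh1 hx).
  + by rewrite mulmx1.
  + by rewrite -vg; apply: eq_bigr => i _; rewrite mulmx1.
- move=> vf [] ij z; rewrite /stage_act /=; congr (_, _).
  + apply: (fixed_mxM hgam); last exact: (fixed_mxS hgam).
    apply: (fixed_mxM hgam); first exact: (delta_fixed hgam).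
    move=> w; rewrite -[RHS](congr1 (map_mx (rot_xi N)) (vf ij.1 w)) -!map_mx_comp.
    by apply: eq_map_mx => f; rewrite /= rot_gamma_xi.
  + exact: (map_mx_sh0 (hbet z)).
  + exact: (map_mx_sh0 (hgam z)).
  + apply: (fixed_mxM hbet); last exact: (fixed_mxS hbet).
    by apply: (fixed_mxM hbet) => //; exact: (delta_fixed hbet).
Qed.

Definition const_mx_cfun m n (x : 'M[R[i]]_(m, n)) : 'M[CS1]_(m, n) :=
  map_mx (fun c => cscale c (1 : CS1)) x.

Lemma eval_const_mx z m n (x : 'M[R[i]]_(m, n)) : eval_mx z (const_mx_cfun x) = x.
Proof. by apply/matrixP => i j; rewrite mxE mxE cfunZ cfun1 mulr1. Qed.

Lemma const_mx_fixed m n (x : 'M[R[i]]_(m, n)) : fixed_mx bet (const_mx_cfun x).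
Proof. by move=> z; apply/matrixP => i j; rewrite mxE mxE (shZ (hbet z)) (sh1 (hbet z)). Qed.

Lemma eval_gram z n (x : 'M[CS1]_(n, 1)) :
  (adjmx star x *m x) 0 0 z = ((nsq (eval_mx z x))%:C)%C.
Proof.
have : eval_mx z (adjmx star x *m x) 0 0 = ((nsq (eval_mx z x))%:C)%C.
  by rewrite eval_mxM eval_mxS nsqE mxE mulr1n.
by rewrite mxE.
Qed.

(* [y] is a constant unit column and [f] is [z |-> |d(z) y|^2], computed in the
   second summand of the next stage, which contains both summands of this one. *)
Lemma large_vector n (d : stg n) (rho : R) : 0 <= rho -> rho < cnorm (phi d) ->
  exists z0 (y : 'M[CS1]_((ranks N r00 r10 l00 l01 l10 l11 n.+1).2, 1)) (f : CS1), [/\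
    fixed_mx bet y /\ adjmx star y *m y = 1%:M,
    adjmx star y *m (nu (star d * d)).2 *m y = f%:M,
    forall z, f z = ((complex.Re (f z))%:C)%C /\ 0 <= complex.Re (f z),
    rho ^+ 2 < complex.Re (f z0) &
    (forall z, stage_act z d = d) -> forall z, bet z f = f].
Proof.
move=> rho0 dr.
(* [D] is a component of [d] that violates the pointwise bound [rho]; if neither did, the norm of
   [phi d] would be at most [rho]. *)
have [k [E [D [sub ED nD Df]]]] : exists k (E : stg n -> 'M[CS1]_k) (D : 'M[CS1]_k),
    [/\ subrep bet E (fun x => (nu x).2), E (star d * d) = adjmx star D *m D,
        ~ mx_bounded D rho & (forall z, stage_act z d = d) -> fixed_mx bet D].
  have [b1|nb1] := pselect (mx_bounded (flat_mx d.1) rho); last first.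
    exists _, (fun x : stg n => flat_mx x.1), (flat_mx d.1); split => //.
    - exact: subrep_flat_nu2.
    - by rewrite -flat_mxS -flat_mxM.
    - by move=> fd; apply: fixed_flat_mx => z; rewrite -[RHS](congr1 fst (fd z)).
  have [b2|nb2] := pselect (mx_bounded d.2 rho); last first.
    exists _, (fun x : stg n => x.2), d.2; split => //; first exact: subrep_nu2.
    by move=> fd z; rewrite -[RHS](congr1 snd (fd z)).
  by have := cnorm_phi_le rho0 (conj b1 b2); rewrite leNgt dr.
have [z0 [x0]] : exists z x, rho ^+ 2 * nsq x < nsq (eval_mx z D *m x).
  apply: contrapT => h; apply: nD => z x; rewrite leNgt; apply/negP => lt.
  by apply: h; exists z, x.
move=> Dx0.
have x0p : 0 < nsq x0.
  rewrite lt_neqAle nsq_ge0 andbT eq_sym; apply/eqP => /nsq_eq0 e.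
  by move: Dx0; rewrite e mulmx0 nsq0 mulr0 ltxx.
set c : R[i] := (Num.sqrt (nsq x0))^-1%:C%C.
have nc : normc c ^+ 2 = (nsq x0)^-1.
  by rewrite normc_real ?invr_ge0 ?sqrtr_ge0 // exprVn sqr_sqrtr ?nsq_ge0.
have [V [VV Vf VE]] := sub.
pose x := const_mx_cfun (c *: x0).
have Dx : adjmx star (V *m x) *m (nu (star d * d)).2 *m (V *m x)
    = ((adjmx star (D *m x) *m (D *m x)) 0 0)%:M.
  rewrite -mx11_scalar !adjmxM -!mulmxA [_ *m (V *m x)]mulmxA -VE ED.
  by rewrite !mulmxA -[_ *m adjmx star V *m V]mulmxA VV mulmx1.
exists z0, (V *m x), ((adjmx star (D *m x) *m (D *m x)) 0 0); split => //.
- split; first by apply: (fixed_mxM hbet) => //; apply: const_mx_fixed.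
  rewrite adjmxM mulmxA -[_ *m _ *m V]mulmxA VV mulmx1 [LHS]mx11_scalar.
  congr (_%:M); apply/cfunP => z; rewrite eval_gram eval_const_mx nsqZ nc mulVf //.
  by rewrite gt_eqF.
- by move=> z; rewrite eval_gram /= nsq_ge0.
- rewrite eval_gram eval_mxM eval_const_mx -scalemxAr nsqZ nc /=.
  by rewrite ltr_pdivlMl // mulrC.
- move=> fd z; have hf : fixed_mx bet (adjmx star (D *m x) *m (D *m x)).
    have Dxf : fixed_mx bet (D *m x).
      by apply: (fixed_mxM hbet); [exact: Df | exact: const_mx_fixed].
    by apply: (fixed_mxM hbet) => //; apply: (fixed_mxS hbet).
  by have := congr1 (fun m : 'M[CS1]_1 => m 0 0) (hf z); rewrite mxE.
Qed.

(** In each step the block of index 0 in [nu] does not rotate and the block of index [N] rotates by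
    [theta]. Following the latter in [i] of the [K] steps rotates [f] by [i] times [theta], while
    the columns, being fixed, do not change under the rotation. *)
Lemma rotated_vectors n (c : stg n) (y : 'M[CS1]_(_, 1)) (f : CS1) :
  fixed_mx bet y -> adjmx star y *m y = 1%:M -> adjmx star y *m c.2 *m y = f%:M ->
  forall K i, (i <= K)%N ->
  exists y' : 'M[CS1]_((ranks N r00 r10 l00 l01 l10 l11 (K + n)).2, 1), [/\
    fixed_mx bet y', adjmx star y' *m y' = 1%:M &
    adjmx star y' *m (connecting nus K c).2 *m y' = (iter i (beta_tilde theta) f)%:M].
Proof.
move=> fy yy cy; elim=> [|K IHK] i; first by rewrite leqn0 => /eqP ->; exists y.
rewrite leq_eqVlt => /orP[/eqP ->|iK]; last first.
  have [y' [fy' yy' cy']] := IHK i iK.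
  have [V [VV Vf VE]] := subrep_nu2 (K + n).
  exists (V *m y'); split; first exact: (fixed_mxM hbet).
    by rewrite adjmxM mulmxA -[_ *m _ *m V]mulmxA VV mulmx1.
  rewrite adjmxM -!mulmxA [_ *m (V *m y')]mulmxA -VE.
  by rewrite !mulmxA -[_ *m adjmx star V *m V]mulmxA VV mulmx1.
have [y' [fy' yy' cy']] := IHK K (leqnn K).
have N2 : (N < 2 * N)%N by rewrite mul2n -addnn -{1}[N]addn0 ltn_add2l.
have := subrep_rotated_nu2 (K + n) (Ordinal N2).
have -> : angle N theta (Ordinal N2) = theta.
  by rewrite /angle /= ltnn subnn mul0r addr0.
have hb := beta_tilde_hom theta.
move=> [V [VV Vf VE]]; exists (V *m y'); split; first exact: (fixed_mxM hbet).
  by rewrite adjmxM mulmxA -[_ *m _ *m V]mulmxA VV mulmx1.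
have by' : map_mx (beta_tilde theta) y' = y' := fy' _.
rewrite adjmxM -!mulmxA [_ *m (V *m y')]mulmxA -VE.
rewrite !mulmxA -[_ *m adjmx star V *m V]mulmxA VV mulmx1 -by'.
by rewrite -(map_mx_shS hb) -!(map_mx_shM hb) cy' (map_mx_sh_scalar hb).
Qed.

Lemma exp2pi_0 : exp2pi (0 : R) = 1%g.
Proof. by have := exp2pi_int R 0; rewrite mulr0z. Qed.

Lemma iter_beta_tilde i (f : CS1) z :
  iter i (beta_tilde theta) f z = f (exp2pi (- (i%:R * theta)) * z)%g.
Proof.
elim: i z => [|i IHi] z; first by rewrite mul0r oppr0 exp2pi_0 mul1g.
rewrite iterS /beta_tilde beta_actE IHi mulgA; congr (f (_ * z)%g).
have -> : (exp2pi theta)^-1%g = exp2pi (- theta).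
  by apply: (mulgI (exp2pi theta)); rewrite mulgV -exp2piD subrr exp2pi_0.
by rewrite -exp2piD -natr1; congr exp2pi; ring.
Qed.

Lemma normc_sqrE (x : R[i]) : ((normc x ^+ 2)%:C)%C = x * conjc x.
Proof. by rewrite -sqr_normc (rmorphXn (real_complex R)). Qed.

(** The rows are [h i] times the adjoint of [y i]: compressing [c.2] gives the sum of the
    [|h i|^2 f i], which is 1, and, as the [y i] are unit columns, the rows themselves give the sum
    of the [|h i|^2]. *)
Lemma weighted_full n (c : stg n) (I : finType) (y : I -> 'M[CS1]_(_, 1))
    (h f : I -> CS1) (C : R) :
  (forall i, adjmx star (y i) *m y i = 1%:M) ->
  (forall i, adjmx star (y i) *m c.2 *m y i = (f i)%:M) ->
  (forall i z, f i z = ((complex.Re (f i z))%:C)%C) ->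
  (forall z, \sum_i normc (h i z) ^+ 2 * complex.Re (f i z) = 1) ->
  (forall z, \sum_i normc (h i z) ^+ 2 <= C) ->
  exists (J : finType) (W : J -> stg n.+1), [/\
    \sum_j W j * nu c * star (W j) = 1,
    stage_bounded (\sum_j W j * star (W j)) C &
    (forall i, fixed_mx bet (y i)) -> (forall i z, bet z (h i) = h i) ->
    forall j z, stage_act z (W j) = W j].
Proof.
move=> yy yc fr hf hC; pose v i := (h i)%:M *m adjmx star (y i).
have sumE (F : I -> CS1) z : (\sum_i F i) z = \sum_i F i z.
  exact: (big_morph (fun f : CS1 => f z) (fun f g => erefl) erefl).
have vE i (M : 'M[CS1]__) (m : CS1) : adjmx star (y i) *m M *m y i = m%:M ->
    v i *m M *m adjmx star (v i) = (h i * m * star (h i))%:M.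
  move=> yM; rewrite /v adjmxM adjmxK adjmx_scalar -!mulmxA.
  by rewrite [M *m (_ *m _)]mulmxA [adjmx _ _ *m (_ *m _)]mulmxA
    [adjmx _ _ *m (_ *m _)]mulmxA yM -!scalar_mxM mulrA.
have [||z|J [W [W1 WC Wf]]] := @rows_full n c I v (\sum_i h i * star (h i)) C.
- under eq_bigr do rewrite (vE _ _ _ (yc _)).
  rewrite -raddf_sum; congr (_%:M); apply/cfunP => z; rewrite sumE cfun1.
  rewrite -[1](rmorph1 (real_complex R)) -(hf z) (rmorph_sum (real_complex R)).
  apply: eq_bigr => i _; rewrite (rmorphM (real_complex R)) !cfunM cfunS.
  by rewrite [in LHS]fr mulrAC -normc_sqrE.
- rewrite raddf_sum /=; apply: eq_bigr => i _.
  have /vE : adjmx star (y i) *m 1%:M *m y i = 1%:M by rewrite mulmx1.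
  by rewrite mulmx1 mulr1.
- have -> : (\sum_i h i * star (h i)) z = ((\sum_i normc (h i z) ^+ 2)%:C)%C.
    rewrite sumE (rmorph_sum (real_complex R)); apply: eq_bigr => i _.
    by rewrite cfunM cfunS -normc_sqrE.
  by rewrite normc_real ?sumr_ge0 // => i _; rewrite exprn_ge0 // normc_ge0.
exists J, W; split=> // fy fh; apply: Wf => i.
apply: (fixed_mxM hbet); last by apply: (fixed_mxS hbet).
by move=> z; rewrite (map_mx_sh_scalar (hbet z)) fh.
Qed.

Lemma gram_close (a b : A) (d : R) : cnorm (a - b) <= d ->
  cnorm (star a * a - star b * b) <= d * (cnorm a + cnorm a + d).
Proof.
move=> ab.
have -> : star a * a - star b * b = star a * (a - b) + star (a - b) * b.
  by rewrite starB mulrBr mulrBl addrA subrK.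
apply: le_trans (ler_cnormD _ _) _.
have nb : cnorm b <= cnorm a + d.
  have := ler_cnorm_sub b a; rewrite cnormBC; move: ab; lra.
have h1 := ler_cnormM2 (lexx (cnorm (star a))) ab.
have ab' : cnorm (star (a - b)) <= d by rewrite cnorm_starE.
have h2 := ler_cnormM2 ab' nb.
by move: h1 h2; rewrite cnorm_starE; lra.
Qed.

Hypothesis htheta : irrational theta.

(** The proposition [fx] is false for comparison in [A] and true for comparison in the fixed point
    algebra. When it holds, [f] is constant and a single constant weight suffices, so the [W j] stay
    fixed; otherwise rotates of an arc are used. With [rho = 9/10 r] the error in the Gram element
    is at most [21/100 r^2], less than [rho^2 = 81/100 r^2]. *)
Lemma full_elements (b : A) (fx : Prop) : b <> 0 -> (fx -> fixed alpha b) ->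
  exists n (c : stg n) (J : finType) (W : J -> stg n) (C : R), [/\
    \sum_j W j * c * star (W j) = 1,
    stage_bounded (\sum_j W j * star (W j)) C,
    0 <= C, C * cnorm (star b * b - phi c) < 1 &
    fx -> forall j z, stage_act z (W j) = W j].
Proof.
move=> b0 fb; have := cnorm_gt0 b0; set r := cnorm b => r0.
have d0 : 0 < r / 10 by rewrite divr_gt0.
have [n [d [fd bd]]] : exists n (d : stg n),
    (fx -> forall z, stage_act z d = d) /\ cnorm (b - phi d) < r / 10.
  have [/fb fb'|nfx] := pselect fx.
    by have [n [d [? ?]]] := approx_fixed d0 fb'; exists n, d.
  by have [n [d ?]] := approx 0 b d0; exists (n + 0)%N, d.
pose rho := r - r / 10; have rho0 : 0 < rho by rewrite /rho; lra.
have rd : rho < cnorm (phi d).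
  by have := ler_cnorm_sub b (phi d); rewrite /rho -/r; move: bd; lra.
have [z0 [y [f [[fy yy] yc fr fz0 ff]]]] := large_vector (ltW rho0) rd.
have C0 : 0 <= (rho ^+ 2)^-1 by rewrite invr_ge0 exprn_ge0 // ltW.
have err k (c' : stg k) : phi c' = phi (star d * d) ->
    (rho ^+ 2)^-1 * cnorm (star b * b - phi c') < 1.
  move=> ->; rewrite (shM (phi_hom _)) (shS (phi_hom _)) mulrC ltr_pdivrMr ?exprn_gt0 // mul1r.
  apply: le_lt_trans (gram_close (ltW bd)) _; rewrite -/r /rho.
  rewrite -subr_gt0; have -> : (r - r / 10) ^+ 2 - r / 10 * (r + r + r / 10) = r ^+ 2 * (3 / 5).
    by field.
  by rewrite mulr_gt0 ?exprn_gt0 // divr_gt0.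
have [hfx|nfx] := pselect fx.
  have fc z : f z = f z0.
    have e := ff (fd hfx) (z * z0^-1)%g.
    by rewrite -[in LHS]e beta_actE invgM invgK -mulgA mulVg mulg1.
  set mu := complex.Re (f z0) in fz0.
  have mu0 : 0 < mu by apply: lt_trans fz0; rewrite exprn_gt0.
  pose h : CS1 := cscale ((Num.sqrt mu)^-1)%:C%C 1.
  have hE z : normc (h z) ^+ 2 = mu^-1.
    rewrite cfunZ cfun1 mulr1 normc_real ?invr_ge0 ?sqrtr_ge0 //.
    by rewrite exprVn sqr_sqrtr // ltW.
  have sum1 (F : unit -> R) : \sum_i F i = F tt.
    by rewrite (bigD1 tt) //= big1 ?addr0 // => -[].
  have [||z|J [W [W1 WC Wf]]] := @weighted_full n.+1 (nu (star d * d)) unit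
    (fun=> y) (fun=> h) (fun=> f) (rho ^+ 2)^-1 (fun=> yy) (fun=> yc).
  - by move=> _ z; have [] := fr z.
  - by move=> z'; rewrite sum1 hE fc -/mu mulVf // gt_eqF.
  - by rewrite sum1 hE lef_pV2 ?posrE ?exprn_gt0 // ltW.
  exists n.+2, (nu (nu (star d * d))), J, W, (rho ^+ 2)^-1; split=> //.
    by apply: err; rewrite !phi_nu.
  move=> _; apply: Wf => [_|_ z]; first exact: fy.
  by rewrite /h (shZ (hbet z)) (sh1 (hbet z)).
have frc : continuous (fun z => complex.Re (f z) : R) by exact: cfun_Re_continuous.
have [K Kcov] := rotations_cover htheta frc fz0.
have /fin_all_exists[ys ysP] : forall i : 'I_K, exists y' : 'M[CS1]_(_, 1), [/\
    fixed_mx bet y', adjmx star y' *m y' = 1%:M &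
    adjmx star y' *m (connecting nus K (nu (star d * d))).2 *m y'
      = (iter i (beta_tilde theta) f)%:M].
  by move=> i; apply: rotated_vectors => //; apply: ltnW.
have [|i|z|h [h1 h2]] := @weights_of_cover R S1 'I_K
    (fun i z => complex.Re (iter i (beta_tilde theta) f z)) (rho ^+ 2).
- by rewrite exprn_gt0.
- exact: cfun_Re_continuous.
- by have [i _ Fi] := Kcov z; exists i => //; rewrite iter_beta_tilde.
have [|||||J [W [W1 WC Wf]]] := @weighted_full _ (connecting nus K (nu (star d * d)))
  'I_K ys h (fun i => iter i (beta_tilde theta) f) (rho ^+ 2)^-1.
- by move=> i; case: (ysP i).
- by move=> i; case: (ysP i).
- by move=> i z; rewrite iter_beta_tilde; have [] := fr (exp2pi (- (i%:R * theta)) * z)%g.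
- exact: h1.
- exact: h2.
exists _, (nu (connecting nus K (nu (star d * d)))), J, W, (rho ^+ 2)^-1; split=> //.
by apply: err; rewrite phi_nu phi_connecting phi_nu.
Qed.

(** * The projections and the isometries in the limit algebra *)

Definition isometry_family M T (s : 'I_T -> stg M.+2) : Prop :=
  [/\ forall t u, star (s t) * s u = if t == u then nu (1, 0) else 0,
      forall t z, stage_act z (s t) = s t,
      forall t (a : stg M), s t * nu (nu a) = nu (nu a) * s t &
      forall t, nu (0, 1) * s t = s t].

Definition small_proj M : A := phi ((1, 0) : stg M.+1).
Definition large_proj M : A := phi ((0, 1) : stg M.+1).

Lemma small_proj_large M : small_proj M = 1 - large_proj M.
Proof.
rewrite -(sh1 (phi_hom M.+1)) -(shB (phi_hom M.+1)); congr phi.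
by apply: injective_projections; rewrite /= ?subr0 ?subrr.
Qed.

Lemma small_proj_projection M : projection (small_proj M).
Proof.
rewrite /small_proj; split; first rewrite -(shS (phi_hom _)); last rewrite -(shM (phi_hom _)).
  by congr phi; rewrite stage_starE /= adjmx1 adjmx0.
by congr phi; rewrite stage_mulE /= mul0mx mul1mx.
Qed.

Lemma large_proj_projection M : projection (large_proj M).
Proof.
rewrite /large_proj; split; first rewrite -(shS (phi_hom _)); last rewrite -(shM (phi_hom _)).
  by congr phi; rewrite stage_starE /= adjmx1 adjmx0.
by congr phi; rewrite stage_mulE /= mul0mx mul1mx.
Qed.

Lemma small_proj_fixed M : fixed alpha (small_proj M).
Proof.
apply: fixed_phi => z; rewrite /stage_act /=; congr (_, _).
  exact: (map_mx_sh1 (hgam z)).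
exact: (map_mx_sh0 (hbet z)).
Qed.

Lemma large_proj_fixed M : fixed alpha (large_proj M).
Proof.
apply: fixed_phi => z; rewrite /stage_act /=; congr (_, _).
  exact: (map_mx_sh0 (hgam z)).
exact: (map_mx_sh1 (hbet z)).
Qed.

Lemma small_projC M (a : stg M) : small_proj M * phi a = phi a * small_proj M.
Proof.
rewrite -(phi_nu a) /small_proj -!(shM (phi_hom _)); congr phi.
by rewrite stage_pair_mul stage_mul_pair !mul1mx !mulmx1 !mul0mx !mulmx0.
Qed.

Lemma isometry_commute M T (s : 'I_T -> stg M.+2) t (a : stg M) :
  isometry_family s -> phi (s t) * phi a = phi a * phi (s t).
Proof.
move=> [_ _ sc _]; rewrite -(phi_nu a) -(phi_nu (nu a)) -!(shM (phi_hom _)).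
by rewrite sc.
Qed.

Lemma isometry_gram M T (s : 'I_T -> stg M.+2) t u : isometry_family s ->
  star (phi (s t)) * phi (s u) = if t == u then small_proj M else 0.
Proof.
move=> [sd _ _ _]; rewrite -(shS (phi_hom _)) -(shM (phi_hom _)) sd.
by case: (t == u); rewrite ?phi_nu // (sh0 (phi_hom _)).
Qed.

Lemma isometry_large M T (s : 'I_T -> stg M.+2) t : isometry_family s ->
  large_proj M * phi (s t) = phi (s t).
Proof. by move=> [_ _ _ ps]; rewrite /large_proj -phi_nu -(shM (phi_hom _)) ps. Qed.

(* If [sum_j W_j c W_j^* = 1] then [w = sum_j W_j s_j^*] satisfies [w c w^* = q]. *)
Lemma small_proj_subequivalent (B : set A) (b : A) (fx : Prop) :
  star_subring B -> B b -> b <> 0 -> (fx -> fixed alpha b) ->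
  (forall x, (fx -> fixed alpha x) -> B x) ->
  exists T n0, forall M, (n0 <= M)%N -> forall s : 'I_T -> stg M.+2,
    isometry_family s -> cuntz_sub1_in B (small_proj M) (star b * b).
Proof.
move=> hB Bb b0 fb BB; have [n [c [J [W [C [W1 WC C0 err fW]]]]]] := full_elements b0 fb.
(* One isometry for each [W j], at any stage beyond the one that carries [c]. *)
exists #|J|, n => M nM; have [k ->] : exists k, M = (k + n)%N by exists (M - n)%N; rewrite subnK.
move=> {M nM} s hs; set M := (k + n)%N in s hs *; set q := small_proj M.
have [BD BM BS BZ] := hB.
pose S j := phi (s (enum_rank j)); pose X j := phi (W j).
have Sd i j : star (S i) * S j = if i == j then q else 0.
  by rewrite (isometry_gram _ _ hs) (inj_eq enum_rank_inj).
have SC j (a : stg n) : S j * phi a = phi a * S j.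
  by rewrite -(phi_connecting k a); exact: isometry_commute.
have qC (a : stg n) : q * phi a = phi a * q by rewrite -(phi_connecting k a) small_projC.
pose w := \sum_j X j * star (S j).
(* The cross terms vanish because the ranges of the [S j] are orthogonal; each diagonal term
   contributes a factor [q], which commutes with stage [n]. *)
have wE (a : A) : (forall j, S j * a = a * S j) ->
    w * a * star w = q * \sum_j X j * a * star (X j).
  move=> Sa; rewrite /w star_sum mulr_suml mulr_suml mulr_sumr; apply: eq_bigr => i _.
  rewrite mulr_sumr (bigD1 i) //= big1 ?addr0 => [|j /negbTE ji].
    rewrite starM starK -!mulrA [a * (S i * _)]mulrA -Sa -!mulrA.
    by rewrite [star (S i) * (S i * _)]mulrA Sd eqxx !mulrA qC.
  rewrite starM starK -!mulrA [a * (S j * _)]mulrA -Sa -!mulrA.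
  by rewrite [star (S i) * (S j * _)]mulrA Sd eq_sym ji mul0r mulr0.
have wc : w * phi c * star w = q.
  rewrite wE => [|j]; last exact: SC.
  rewrite /X -[RHS]mulr1 -(sh1 (phi_hom n)) -W1 (sh_sum (phi_hom n)); congr (_ * _).
  by apply: eq_bigr => j _; rewrite !(shM (phi_hom n)) (shS (phi_hom n)).
(* The identity [wE] at [a = 1] expresses [w * star w] by the sum bounded by [C]. *)
have wn : cnorm w ^+ 2 <= C.
  rewrite -cnorm_mulstar -[w in w * _]mulr1 wE => [|j]; last by rewrite mulr1 mul1r.
  have -> : \sum_j X j * 1 * star (X j) = phi (\sum_j W j * star (W j)).
    rewrite (sh_sum (phi_hom n)); apply: eq_bigr => j _.
    by rewrite mulr1 (shM (phi_hom n)) (shS (phi_hom n)).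
  rewrite -[C]mul1r; apply: ler_cnormM2; last exact: cnorm_phi_le.
  exact/cnorm_projection_le1/small_proj_projection.
apply: (cuntz_sub_projection hB (small_proj_projection M) (w := w)).
- by apply: BB => _; apply: small_proj_fixed.
- have B0 : B 0 by rewrite -(cscale0r b); apply: BZ.
  apply: (big_ind B) => // j _; apply: BM.
    by apply: BB => hfx; apply: fixed_phi => z; apply: fW.
  apply: BS; apply: BB => _; apply: fixed_phi => z.
  by case: hs => _ ->.
- by apply: (BM); [exact: BS |].
- by rewrite starM starK.
rewrite -[X in _ - X]wc -mulrBl -mulrBr.
apply: le_lt_trans err; rewrite -mulrA; apply: le_trans (ler_cnormM _ _) _.
apply: le_trans (ler_wpM2l (cnorm_ge0 _) (ler_cnormM _ _)) _.
rewrite [cnorm (star w)]cnorm_starE mulrCA -expr2 mulrC.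
by rewrite ler_wpM2r ?cnorm_ge0.
Qed.

Hypothesis h0 : ((l01 n)%:R / (l00 n)%:R : R) @[n --> \oo] --> +oo.
Hypothesis h1 : ((l11 n)%:R / (l10 n)%:R : R) @[n --> \oo] --> +oo.

Lemma ratio_large (u v : nat -> nat) (T : nat) : (forall n, (0 < v n)%N) ->
  ((u n)%:R / (v n)%:R : R) @[n --> \oo] --> +oo ->
  exists n0, forall n, (n0 <= n)%N -> (T * v n <= u n)%N.
Proof.
move=> v0 /cvgryPge/(_ T%:R)[n0 _ n0T]; exists n0 => n /n0T /=.
by rewrite ler_pdivlMr ?ltr0n // -natrM ler_nat.
Qed.

Lemma isometry_families T : exists n0, forall M, (n0 <= M)%N ->
  exists s : 'I_T -> stg M.+2, isometry_family s.
Proof.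
have [n1 n1P] := ratio_large T hl00 h0; have [n2 n2P] := ratio_large T hl10 h1.
exists (maxn n1 n2) => M; rewrite geq_max => /andP[M1 M2].
apply: commuting_isometries => //; [apply: n1P | apply: n2P]; exact: leqW.
Qed.

Lemma isometry_family_sub M T T' (TT' : (T <= T')%N) (s : 'I_T' -> stg M.+2) :
  isometry_family s -> isometry_family (fun t => s (widen_ord TT' t)).
Proof. by move=> [sd sf sc sp]; split=> // t u; rewrite sd. Qed.

(** Compression by [large_proj M] keeps exactly the circle component of [nu a], which already
    carries the norm of [a]. The slack [e] provides the strict inequality that passing from the
    limit norm to a stage requires. *)
Lemma cnorm_compress M (a : stg M) :
  cnorm (phi a) <= cnorm (large_proj M * phi a * large_proj M).
Proof.
rewrite -(phi_nu a) /large_proj -!(shM (phi_hom _)); apply/ler_addgt0Pr => e e0.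
have c0 : 0 <= cnorm (phi ((0, 1) * nu a * (0, 1))) + e.
  by rewrite addr_ge0 ?cnorm_ge0 // ltW.
rewrite phi_nu; apply: cnorm_phi_le => //; apply: nu2_bounded_inv.
have [_] : stage_bounded ((0, 1) * nu a * (0, 1))
    (cnorm (phi ((0, 1) * nu a * (0, 1))) + e).
  by apply: stage_bounded_of_cnorm; rewrite ltrDl.
by rewrite !stage_mulE /= mulmx1 mul1mx.
Qed.

(** * The equivariant central map and the verification of all conditions *)

Definition central_map M (f : CS1) : A := phi ((0, f%:M) : stg M.+1).

Lemma central_mapD M : {morph @central_map M : f g / f + g}.
Proof.
move=> f g; rewrite /central_map -(shD (phi_hom _)); congr phi.
by apply: injective_projections; rewrite /= ?addr0 // raddfD.
Qed.

Lemma central_map0 M : central_map M 0 = 0.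
Proof. by apply: (addrI (central_map M 0)); rewrite -central_mapD !addr0. Qed.

Lemma central_mapM M : {morph @central_map M : f g / f * g}.
Proof.
move=> f g; rewrite /central_map -(shM (phi_hom _)); congr phi.
by rewrite stage_mulE /= mulmx0 -scalar_mxM.
Qed.

Lemma central_mapS M f : central_map M (star f) = star (central_map M f).
Proof.
by rewrite /central_map -(shS (phi_hom _)) stage_starE /= adjmx0 adjmx_scalar.
Qed.

Lemma central_mapZ M c f : central_map M (cscale c f) = cscale c (central_map M f).
Proof.
rewrite /central_map -(shZ (phi_hom _)); congr phi.
apply: injective_projections; apply/matrixP => i j; rewrite !mxE ?cscaler0 //.
by case: (_ == _); rewrite ?cscaler0.
Qed.

Lemma central_mapC M f (a : stg M) : central_map M f * phi a = phi a * central_map M f.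
Proof.
rewrite -(phi_nu a) /central_map -!(shM (phi_hom _)); congr phi.
rewrite [LHS]stage_mul_pair [RHS]stage_pair_mul.
by congr pair; [exact: etrans (mul0mx _ _) (esym (mulmx0 _ _)) | exact: (esym (scalar_mxC _ _))].
Qed.

Lemma central_map_equivariant M z f :
  alpha z (central_map M f) = central_map M (Lt z f).
Proof.
rewrite /central_map alpha_phi /stage_act /=; congr phi; congr (_, _).
  exact: (map_mx_sh0 (hgam z)).
exact: (map_mx_sh_scalar (hbet z)).
Qed.

Lemma central_map_contractive M f : cnorm (central_map M f) <= cfun_norm f.
Proof.
have nf0 : 0 <= cfun_norm f := le_trans (normc_ge0 _) (cfun_norm_ub f 1%g).
apply: cnorm_phi_le => //; split=> /=; last exact: mx_bounded_scalar (cfun_norm_ub f).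
move=> z x; rewrite flat_mx0 /eval_mx (map_mx_sh0 (cfun_eval_hom R z)) mul0mx nsq0.
by rewrite mulr_ge0 ?nsq_ge0 // exprn_ge0.
Qed.

(** Being multiplicative and star-preserving, the map sends a Gram matrix to the Gram matrix of the
    image, whose entries lie in the corner. *)
Lemma central_map_ucp M : ucp_into_corner (large_proj M) (@central_map M).
Proof.
have corn f : corner (large_proj M) (central_map M f).
  rewrite /corner /= /large_proj /central_map -!(shM (phi_hom _)); congr phi.
  by rewrite !stage_mulE /= mulmx1 mul1mx mulmx0.
split=> //; split; first by split; [exact: central_mapD | exact: central_mapZ].
move=> n a [b _ ->]; exists (map_mx (@central_map M) b).
  by move=> i j; rewrite mxE.
apply/matrixP => i j; rewrite mxE [in LHS]mxE mxE.
rewrite (big_morph _ (@central_mapD M) (central_map0 M)); apply: eq_bigr => k _.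
by rewrite central_mapM !mxE central_mapS.
Qed.

(** With [q = star s * s], the Gram element of [s * star s * s - s] is [q^3 - 2 q^2 + q = 0]; the
    C*-identity concludes. *)
Lemma partial_isometry_of_gram (s : A) : projection (star s * s) -> partial_isometry s.
Proof.
move=> [_ qq]; rewrite /partial_isometry; apply/eqP; rewrite -subr_eq0; apply/eqP.
apply: cnorm0_eq0; apply/eqP; rewrite -sqrf_eq0 -cnorm_star starB !starM starK.
rewrite mulrBl !mulrBr -!mulrA; rewrite -!mulrA in qq; rewrite ?qq.
by rewrite !subrr cnorm0.
Qed.

Lemma range_projection_le (s p : A) : projection p -> projection (star s * s) ->
  p * s = s -> cstar_le (s * star s) p.
Proof.
move=> [ps pp] sp e; have si := partial_isometry_of_gram sp.
have e' : star s * p = star s by rewrite -{1}ps -starM e.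
(* This difference is itself a projection, hence its own Gram element. *)
exists (p - s * star s) => //; rewrite starB ps starM starK.
have k : s * (star s * (s * star s)) = s * star s by rewrite !mulrA si.
by rewrite mulrBl !mulrBr pp -!mulrA e' [p * (s * _)]mulrA e k subrr subr0.
Qed.

Lemma finite_set_bounded (T : choiceType) (S : set T) (f : T -> R) : finite_set S ->
  exists2 K, 0 <= K & forall x, S x -> f x <= K.
Proof.
move=> /finite_seqP[r ->]; exists (\sum_(x <- r) `|f x|); first exact: sumr_ge0.
move=> x /= xr; rewrite (big_rem x) //=; apply: le_trans (ler_norm _) _.
by rewrite lerDl sumr_ge0.
Qed.

Lemma setT_star_subring : star_subring [set: A].
Proof. by []. Qed.

Lemma rokhlin_simultaneous (F F0 : set A) (S : set CS1) (e : R) (x y : A) :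
  finite_set F -> finite_set F0 -> F0 `<=` fixed alpha -> finite_set S -> 0 < e ->
  positive_in setT x -> cnorm x = 1 -> positive_in (fixed alpha) y -> y <> 0 ->
  exists (p : A) (psi : CS1 -> A) (s : A),
    [/\ rokhlin_data alpha p psi /\ contractive psi,
        fixed alpha s /\ partial_isometry s,
        trpc_conditions alpha F S e x y p psi &
        mtrp_conditions alpha F F0 S e x p s psi].
Proof.
move=> fF fF0 _ fS e0 xpos x1 [by_ fy yE] yn0.
have [bx _ xE] := xpos.
have star00 (b : A) : star b * b <> 0 -> b <> 0.
  by move=> bb b0; apply: bb; rewrite b0 mulr0.
have bx0 : bx <> 0.
  apply: star00 => x0; move: x1; rewrite xE x0 cnorm0 => /eqP.
  by rewrite eq_sym oner_eq0.
have by0 : by_ <> 0 by apply: star00; rewrite -yE.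
(* [fx] is [False] here, as [bx] is an arbitrary element of [A]; for [by_] below it is [True]. *)
have [Tx [nx xP]] := @small_proj_subequivalent setT bx False setT_star_subring I bx0
  (False_ind _) (fun _ _ => I).
have [Ty [ny yP]] := @small_proj_subequivalent (fixed alpha) by_ True fixed_star_subring
  fy by0 (fun _ => fy) (fun a fa => fa I).
have [K K0 KS] := @finite_set_bounded _ S (@cfun_norm R S1) fS.
(* [K] bounds the central map on [S] and 1 bounds [s], so [K + 1] serves both commutator
   estimates. *)
pose d := e / (4 * (K + 1)).
have K1 : 0 < K + 1 by rewrite ltr_wpDl.
have d0 : 0 < d by rewrite /d divr_gt0 // mulr_gt0.
have dK : d * (K + 1) = e / 4 by rewrite /d; field; rewrite gt_eqF.
have de : d <= e / 4 by rewrite -dK ler_peMr ?(ltW d0) // lerDr.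
have finG : finite_set (F `|` F0 `|` [set x]) by rewrite !finite_setU.
have [nF FP] := approx_finite d0 finG.
(* The successor guarantees at least one isometry, [sf ord0]. *)
pose T := (Tx + Ty).+1.
have [nT TP] := isometry_families T.
pose M := (nx + ny + nF + nT)%N.
have [] : [/\ (nx <= M)%N, (ny <= M)%N, (nF <= M)%N & (nT <= M)%N] by split; rewrite /M; lia.
move=> Mx My MF MT; have [sf sfP] := TP M MT.
have TxT : (Tx <= T)%N by rewrite /T; lia.
have TyT : (Ty <= T)%N by rewrite /T; lia.
pose p := large_proj M; pose q := small_proj M; pose s := phi (sf ord0).
have qE : 1 - p = q by rewrite /q small_proj_large.
have pp : projection p := large_proj_projection M.
have qp : projection q := small_proj_projection M.
have ss : star s * s = q by rewrite (isometry_gram _ _ sfP) eqxx.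
have ps : p * s = s := isometry_large _ sfP.
have fs : fixed alpha s by apply: fixed_phi => z; case: sfP => _ ->.
have s1 : cnorm s <= 1.
  rewrite -(@expr_le1 _ 2) ?cnorm_ge0 // -cnorm_star ss.
  exact: cnorm_projection_le1.
have psi1 f : S f -> cnorm (central_map M f) <= K.
  by move=> Sf; apply: le_trans (central_map_contractive M f) (KS f Sf).
(* Since [u] commutes with [phi a'], its commutator with [a] has norm at most [2 c d <= e / 2]. *)
have comm_small (u a : A) (a' : stg M) c : u * phi a' = phi a' * u -> cnorm (a - phi a') < d ->
    cnorm u <= c -> 0 <= c -> c <= K + 1 -> cnorm (u * a - a * u) < e.
  move=> uC aa uc c0 cK.
  have -> : u * a - a * u = u * (a - phi a') - (a - phi a') * u.
    by rewrite mulrBr mulrBl uC opprB addrA subrK.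
  apply: le_lt_trans (ler_cnormB _ _) _.
  have h1' := ler_cnormM2 uc (ltW aa); have h2' := ler_cnormM2 (ltW aa) uc.
  have : c * d <= e / 4 by rewrite -dK mulrC ler_pM2l.
  move: h1' h2'; rewrite [d * c]mulrC; lra.
have appr : approx_equivariant_central_mult alpha F S e (@central_map M).
  split.
  - by move=> f g _ _; rewrite central_mapM subrr cnorm0.
  - move=> f a Sf Fa; have [|a' aa] := FP M MF a; first by left; left.
    apply: (comm_small _ _ a' K _ aa) => //; [exact: central_mapC | exact: psi1 | by rewrite lerDl].
  - move=> f _; apply: le_lt_trans (_ : (0 : R)%:E < _)%E; last by rewrite lte_fin.
    apply: ge_ereal_sup => _ [z _ <-].
    by rewrite central_map_equivariant subrr cnorm0.
have cx : cuntz_sub1_in setT (1 - p) x.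
  by rewrite qE xE; exact: (xP M Mx _ (isometry_family_sub TxT sfP)).
have cy : cuntz_sub1_in (fixed alpha) (1 - p) y.
  by rewrite qE yE; exact: (yP M My _ (isometry_family_sub TyT sfP)).
have cp : cuntz_sub1_in (fixed alpha) (1 - p) p.
  rewrite qE; have [_ _ fS' _] := fixed_star_subring.
  (* For [w = star s] the defect [w * p * star w - q] is exactly 0. *)
  apply: (cuntz_sub_projection fixed_star_subring qp (w := star s)).
  - exact: small_proj_fixed.
  - exact: fS'.
  - exact: large_proj_fixed.
  - by case: pp.
  - by rewrite starK -mulrA ps ss subrr cnorm0.
(* Replacing [x] by [phi x'] costs at most [d] in its norm and [d] in its compression, so the
   compression of [x] has norm at least [1 - 2 d > 1 - e]. *)
have px : cnorm (p * x * p) > 1 - e.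
  have [|x' xx] := FP M MF x; first by right.
  have c1 := cnorm_compress x'.
  have p1 : cnorm p <= 1 by apply: cnorm_projection_le1.
  have := ler_cnorm_sub (p * phi x' * p) (p * x * p).
  rewrite -mulrBl -mulrBr => c2.
  have xx' : cnorm (phi x' - x) <= d by rewrite cnormBC ltW.
  have c3 := ler_cnormM2 (ler_cnormM2 p1 xx') p1.
  have c4 := ler_cnorm_sub x (phi x').
  by move: c1 c2 c3 c4; rewrite x1 -/p mul1r mulr1; move: xx de e0; lra.
exists p, (@central_map M), s; split.
- split; last exact: central_map_contractive.
  by split; [exact: large_proj_fixed | exact: pp | exact: central_map_ucp].
- by split=> //; apply: partial_isometry_of_gram; rewrite ss.
- by split.
- split=> //; first by rewrite ss qE; split=> //; apply: range_projection_le; rewrite ?ss.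
  move=> a F0a; have [|a' aa] := FP M MF a; first by left; right.
  apply: (comm_small _ _ a' 1 _ aa) => //; first exact: isometry_commute sfP.
  by rewrite lerDr.
Qed.

End Limit.

Theorem proposition8p22
  (R : realType) (N : nat) (theta : R) (r00 r10 : nat)
  (l00 l01 l10 l11 : nat -> nat)
  (hN : (2 <= N)%N) (htheta : @irrational R theta)
  (hr00 : (0 < r00)%N) (hr10 : (0 < r10)%N)
  (hl00 : forall n, (0 < l00 n)%N) (hl01 : forall n, (0 < l01 n)%N)
  (hl10 : forall n, (0 < l10 n)%N) (hl11 : forall n, (0 < l11 n)%N)
  (A : cstarAlgType R)
  (phi : forall n, stage R N r00 r10 l00 l01 l10 l11 n -> A)
  (alpha : circle R -> A -> A)
  (hA : limit_action theta phi alpha)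
  (hr : (r00 <= r10)%N)
  (h1000 : forall n, (l00 n <= l10 n)%N)
  (h0100 : forall n, (l00 n <= l01 n)%N)
  (h1101 : forall n, (l01 n <= l11 n)%N)
  (h1110 : forall n, (l10 n <= l11 n)%N)
  (hlim0 : ((l01 n)%:R / (l00 n)%:R : R) @[n --> \oo] --> +oo)
  (hlim1 : ((l11 n)%:R / (l10 n)%:R : R) @[n --> \oo] --> +oo) :
  [/\ tracial_rokhlin_comparison alpha,
      modified_tracial_rokhlin alpha &
      forall (F F0 : set A) (S : set (cfun R (circle R))) (e : R) (x y : A),
        finite_set F -> finite_set F0 -> F0 `<=` fixed alpha -> finite_set S ->
        0 < e -> positive_in setT x -> cnorm x = 1 ->
        positive_in (fixed alpha) y -> y <> 0 ->
      exists (p : A) (psi : cfun R (circle R) -> A) (s : A),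
        [/\ rokhlin_data alpha p psi /\ contractive psi,
            fixed alpha s /\ partial_isometry s,
            trpc_conditions alpha F S e x y p psi &
            mtrp_conditions alpha F F0 S e x p s psi]].
Proof.
have N0 : (0 < N)%N by apply: leq_trans hN.
have main := @rokhlin_simultaneous R N theta r00 r10 l00 l01 l10 l11 N0
  hl00 hl01 hl10 hl11 h1000 h1101 A phi alpha hA htheta hlim0 hlim1.
split=> [F S e x y fF fS e0 xpos x1 ypos yn0|F F0 S e x fF fF0 F0f fS e0 xpos x1|].
- have [p [psi [s [[dp _] _ tp _]]]] :=
    main F set0 S e x y fF (finite_set0 A) (@sub0set _ _) fS e0 xpos x1 ypos yn0.
  by exists p, psi.
(* The unit serves as [y]; it is nonzero because [x] has norm 1. *)
- have one_fixed : positive_in (fixed alpha) 1.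
    exists 1; last by rewrite star1 mulr1.
    by move=> z; exact: (sh1 (alpha_hom hA z)).
  have one_neq0 : (1 : A) <> 0.
    by move=> e1; move: x1; rewrite -[x]mulr1 e1 mulr0 cnorm0 => /eqP; rewrite eq_sym oner_eq0.
  have [p [psi [s [[dp cpsi] [fs si] _ mp]]]] :=
    main F F0 S e x 1 fF fF0 F0f fS e0 xpos x1 one_fixed one_neq0.
  by exists p, s, psi.
- exact: main.
Qed.
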